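(* Let $H\in(1/2,1)$, let $Z^H=\{Z^H(t)\}_{t\in[0,1]}$ be the Rosenblatt process with Hurst parameter $H$, let $\lambda\in\mathbb R$ with $\lambda\ne0$, and let $X(t)=\lambda t+Z^H(t)$, $t\in[0,1]$. Then the probability distributions of $Z^H$ and of $X$ on the space $C([0,1])$ of continuous functions (with its Borel $\sigma$-algebra) are mutually singular.
   Context: Let $(\Omega,\mathcal F,\mathbb P)$ be a complete probability space carrying a standard Wiener process $W=\{W(t)\}_{t\in[0,1]}$, with $\mathcal F$ generated by $W$. For $H\in(1/2,1)$ the Rosenblatt process is $Z^H(t):=I_2(L^H_t)$, $t\in[0,1]$, where $I_2$ is the Wiener–Itô multiple integral of order $2$ with respect to $W$ and \[ L_t^H(x_1,x_2):=C_H^Z\,x_1^{-\frac H2}x_2^{-\frac H2}\left[\int_{x_1\vee x_2}^t u^H(u-x_1)^{\frac H2-1}(u-x_2)^{\frac H2-1}\,du\right]\mathbf 1_{(0,t)^2}(x_1,x_2), \qquad C_H^Z:=\frac{\sqrt{2H(2H-1)}}{2\,\mathrm B\left(1-H,\frac H2\right)}, \] with $\mathrm B$ the Beta function. $Z^H$ is taken in its version with continuous sample paths. *)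

(* Defs.v *)
From HB Require Import structures.
From mathcomp Require Import all_boot all_order all_algebra.
From mathcomp Require Import all_classical all_reals all_analysis.
From mathcomp Require Import measurable_realfun lra.

Set Implicit Arguments.
Unset Strict Implicit.
Unset Printing Implicit Defensive.

Import Order.TTheory GRing.Theory Num.Theory.
Import numFieldNormedType.Exports.

Local Open Scope classical_set_scope.
Local Open Scope ring_scope.

Notation I01 R := (set_type [set` (`[0%R, 1%R] : interval R)]).

(* C([0,1]) with the topology of uniform convergence; [0,1] is a type of its
   own, so equality in C01 is equality on [0,1]. *)
Definition C01 (R : realType) : Type := continuousType (I01 R) R.

HB.instance Definition _ (R : realType) := Choice.on (C01 R).
HB.instance Definition _ (R : realType) :=
  isPointed.Build (C01 R) (cst 0 : continuousType (I01 R) R).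
HB.instance Definition _ (R : realType) :=
  Topological.copy (C01 R)
    (initial_topology (fun f : C01 R => (f : I01 R -> R) : {uniform I01 R -> R})).

Notation C01_borel R := (g_sigma_algebraType (@open (C01 R))).

Definition C01_eval (R : realType) (f : C01 R) (t : I01 R) : R :=
  (f : continuousType (I01 R) R) t.


Lemma C01_uniform (R : realType) (f : C01 R) (e : R) : 0 < e ->
  exists N : nat, forall s t : I01 R,
    `|\val s - \val t| <= N.+1%:R^-1 -> `|C01_eval f s - C01_eval f t| < e.
Proof.
move=> e0.
have key (s : I01 R) (d : R) : 0 < d -> exists2 r : R, 0 < r & forall t : I01 R,
    `|\val s - \val t| < r -> `|C01_eval f s - C01_eval f t| < d.
  move=> d0; have /cvgrPdist_lt/(_ _ d0) := @cts_fun _ _ (f : continuousType (I01 R) R) s.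
  by rewrite -nbhs_ballE => -[r r0 rf]; exists r => // t st; exact: rf.
have := @segment_compact R 0 1.
move/compact_near_coveringP/near_covering_withinP.
move=> /(_ nat \oo (fun N x => forall s t : I01 R, \val s = x ->
  `|\val s - \val t| <= N.+1%:R^-1 -> `|C01_eval f s - C01_eval f t| < e) _) [].
  move=> x Kx; pose s0 : I01 R := exist _ x (mem_set Kx).
  have [|r r0 rf] := key s0 (e / 2); first by rewrite divr_gt0.
  near=> x' N => /= K' s t sx st.
  have {}sx : \val s = x' := sx.
  have r2 : `|x - x'| < r / 2.
    by near: x'; apply: cvgr_dist_lt => //; rewrite divr_gt0.
  have N2 : N.+1%:R^-1 < r / 2.
    near: N; exact: (near_infty_natSinv_lt (PosNum (divr_gt0 r0 (ltr0Sn R 1)))).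
  have h1 : `|C01_eval f s0 - C01_eval f s| < e / 2.
    apply: rf; rewrite sx; apply: lt_trans r2 _; lra.
  have h2 : `|C01_eval f s0 - C01_eval f t| < e / 2.
    apply: rf.
    rewrite sx in st; have := ler_distD x' x (\val t).
    rewrite (_ : \val s0 = x) // => xt.
    have {N2}st := le_lt_trans st N2.
    apply: le_lt_trans xt _; rewrite [ltRHS]splitr; exact: ltrD.
  apply: le_lt_trans (ler_distD (C01_eval f s0) _ _) _.
  by rewrite [ltRHS]splitr; apply: ltrD => //; rewrite distrC.
move=> N _ /(_ N (leqnn N)) HN; exists N => s t st; apply: (HN (\val s)) => //.
exact: set_mem (valP s).
Unshelve. all: by end_near. Qed.

Section C01_cylinders.
Context (R : realType).

Let zeroI : I01 R.
Proof. by exists 0; apply/mem_set; rewrite /= in_itv/= lexx ler01. Defined.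

Let I01P (t : I01 R) : 0 <= \val t /\ \val t <= 1.
Proof. by have := set_mem (valP t); rewrite /= in_itv/= => /andP. Qed.

Let ratI (r : rat) : I01 R := insubd zeroI (ratr r).

Let cyl (c : seq (rat * rat) * nat * nat) : set (C01 R) :=
  [set f | forall pq, pq \in c.1.1 -> forall r : rat,
     `|\val (ratI r) - ratr pq.1| <= c.1.2.+1%:R^-1 ->
     `|C01_eval f (ratI r) - ratr pq.2| <= c.2.+1%:R^-1].

Let ratI_dense (t : I01 R) (e : R) : 0 < e ->
  exists r : rat, `|\val t - \val (ratI r)| < e.
Proof.
move=> e0; have [] := I01P t; move: (\val t) => {}t t0 t1.
have [|r] := @rat_in_itvoo R (Num.max 0 (t - e)) (Num.min 1 (t + e)).
  rewrite lt_min !gt_max; apply/andP; split; apply/andP; split; by lra.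
rewrite in_itv/= lt_min gt_max => /andP[/andP[r0 rt] /andP[r1 tr]].
exists r; rewrite /ratI val_insubd ifT; last first.
  by apply/mem_set; rewrite /= in_itv/= !ltW.
by rewrite distrC ltr_distl rt tr.
Qed.

Let cyl_basis (U : set (C01 R)) (f : C01 R) : open U -> U f ->
  exists2 c, cyl c f & cyl c `<=` U.
Proof.
move=> oU Uf.
have [e e0 eU] : exists2 e : R, 0 < e &
    forall h : C01 R, (forall t, `|C01_eval f t - C01_eval h t| < e) -> U h.
  case: oU => V oV VU; rewrite -VU in Uf.
  have /uniform_nbhs[E [entE EV]] := open_nbhs_nbhs (conj oV Uf).
  move: entE; rewrite -entourage_ballE => -[e /= e0 eE].
  exists e => // h fh; rewrite -VU; apply: EV => t _; apply: eE; exact: fh.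
have e80 : 0 < e / 8 by rewrite divr_gt0.
have [k _ /(_ k (leqnn k)) hk] := near_infty_natSinv_lt (PosNum e80).
rewrite /= in hk; have [K KE] : exists K : R, K = k.+1%:R^-1 by exists k.+1%:R^-1.
rewrite -KE in hk.
have d0 : 0 < K / 2 by rewrite divr_gt0// KE invr_gt0 ltr0Sn.
have [N fN] := C01_uniform f d0.
have Npos : 0 < N.+1%:R :> R by rewrite ltr0Sn.
pose p (j : nat) : rat := j%:R / N.+1%:R.
have pE j : ratr (p j) = j%:R / N.+1%:R :> R by rewrite /p fmorph_div/= !ratr_nat.
pose x (j : nat) : I01 R := insubd zeroI (ratr (p j)).
have xE j : (j <= N.+1)%N -> \val (x j) = ratr (p j).
  move=> jN; rewrite /x val_insubd ifT//; apply/mem_set => /=.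
  by rewrite in_itv/= pE divr_ge0//= ler_pdivrMr// mul1r ler_nat.
have qex (j : nat) : exists q : rat,
    `|C01_eval f (x j) - ratr q| < K / 2.
  have [|q] := @rat_in_itvoo R (C01_eval f (x j) - K / 2)
    (C01_eval f (x j) + K / 2); first lra.
  by rewrite in_itv/= => qP; exists q; rewrite distrC ltr_distl.
have [q qP] := choice qex.
exists ([seq (p j, q j) | j <- iota 0 N.+2], N, k).
  move=> _ /mapP[j + ->] r /= rj; rewrite mem_iota/= add0n ltnS => jN.
  rewrite -KE [leRHS]splitr ltW//.
  apply: le_lt_trans (ler_distD (C01_eval f (x j)) _ _) _.
  by apply: ltrD => //; apply: fN; rewrite xE.
move=> h ch; apply: eU => t.
have [Nf fNf] := C01_uniform f d0.
have [Nh hNh] := C01_uniform h d0.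
have [t0 t1] := I01P t.
pose j := Num.truncn (\val t * N.+1%:R).
have /andP[jt tj] : j%:R <= \val t * N.+1%:R < j.+1%:R.
  by apply: truncn_itv; rewrite mulr_ge0// ltW.
have jN : (j <= N.+1)%N.
  by rewrite -(@ler_nat R); apply: le_trans jt _; rewrite ler_piMl// ltW.
have tp1 : ratr (p j) <= \val t by rewrite pE ler_pdivrMr.
have tp2 : \val t - ratr (p j) < N.+1%:R^-1.
  rewrite pE -[X in X - _](mulfK (lt0r_neq0 Npos)) -mulrBl.
  by rewrite ltr_pdivrMr// mulVf ?lt0r_neq0// ltrBlDl natr1.
pose m := Num.min (N.+1%:R^-1 - (\val t - ratr (p j)))
            (Num.min Nf.+1%:R^-1 Nh.+1%:R^-1).
have m0 : 0 < m.
  by rewrite /m !lt_min subr_gt0 tp2 !invr_gt0 !ltr0Sn.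
have [r] := ratI_dense t m0.
rewrite /m !lt_min => /andP[r1 /andP[r2 r3]].
have rj : `|\val (ratI r) - ratr (p j)| <= N.+1%:R^-1.
  apply: le_trans (ler_distD (\val t) _ _) _.
  by rewrite distrC (ger0_norm (_ : 0 <= \val t - ratr (p j))) ?subr_ge0// -lerBrDr ltW.
have := ch (p j, q j) _ r rj; rewrite map_f ?mem_iota//= => /(_ isT) A1.
have A2 : `|C01_eval f (ratI r) - C01_eval f (x j)| < K / 2.
  by apply: fN; rewrite xE.
have A3 := qP j.
have A4 := fNf _ _ (ltW r2).
have A5 := hNh _ _ (ltW r3).
move: A1 A2 A3 A4 A5 hk; rewrite /= -KE.
rewrite ler_distl !ltr_distl; move: (C01_eval h _) (C01_eval f _) => *; lra.
Qed.

Let measurable_cyl d (Omega : measurableType d) (Z : Omega -> C01 R) c :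
  (forall t, measurable_fun [set: Omega] (fun w => C01_eval (Z w) t)) ->
  measurable (Z @^-1` cyl c).
Proof.
move=> mZ.
have -> : Z @^-1` cyl c = \bigcap_(r : rat)
    [set w | forall pq, pq \in c.1.1 ->
      `|\val (ratI r) - ratr pq.1| <= c.1.2.+1%:R^-1 ->
      `|C01_eval (Z w) (ratI r) - ratr pq.2| <= c.2.+1%:R^-1].
  apply/seteqP; split => [w Zw r _ pq pqc|w Zw pq pqc r]; first exact: Zw.
  exact: (Zw r Logic.I pq pqc).
rewrite -[X in measurable X]setCK setC_bigcap; apply: measurableC.
apply: bigcupT_measurable_rat => r; apply: measurableC.
case: c => -[s N] k /=; elim: s => [|[p q] s IHs].
  by rewrite (_ : [set w | _] = setT)//; apply/seteqP; split.
rewrite (_ : [set w | _] = [set w | `|\val (ratI r) - ratr p| <= N.+1%:R^-1 ->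
    `|C01_eval (Z w) (ratI r) - ratr q| <= k.+1%:R^-1] `&`
  [set w | forall pq, pq \in s ->
      `|\val (ratI r) - ratr pq.1| <= N.+1%:R^-1 ->
      `|C01_eval (Z w) (ratI r) - ratr pq.2| <= k.+1%:R^-1]); last first.
  apply/seteqP; split => [w Zw|w [Zw1 Zw2] pq].
    split=> [|pq pqs]; first by apply: (Zw (p, q)); rewrite mem_head.
    by apply: Zw; rewrite in_cons pqs orbT.
  by rewrite in_cons => /orP[/eqP ->|] //; exact: Zw2.
apply: measurableI => //.
have [h|h] := boolP (`|\val (ratI r) - ratr p| <= N.+1%:R^-1); last first.
  by rewrite (_ : [set w | _] = setT)//; apply/seteqP; split.
have mf : measurable_fun [set: Omega]
    (fun w => `|C01_eval (Z w) (ratI r) - ratr q|).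
  by apply: measurableT_comp => //; exact: measurable_funB.
have := mf measurableT _ (measurable_itv `]-oo, k.+1%:R^-1]).
rewrite setTI; congr measurable; apply/seteqP; split => w /=.
  by rewrite in_itv/=.
by rewrite in_itv/=; exact.
Qed.

(* The Borel sigma-algebra of C([0,1]) is generated by the evaluations, so every
   process with continuous paths is a random variable in C([0,1]); requiring
   measurability with respect to C01_borel is no restriction. *)
Lemma measurable_C01 d (Omega : measurableType d) (Z : Omega -> C01_borel R) :
  (forall t, measurable_fun [set: Omega] (fun w => C01_eval (Z w) t)) ->
  measurable_fun [set: Omega] Z.
Proof.
move=> mZ; apply: (@measurability _ _ Omega (C01_borel R) setT Z (@open (C01 R))) => //.
move=> _ [U oU <-]; rewrite setTI.
have -> : Z @^-1` U = \bigcup_(c in [set c | cyl c `<=` U]) Z @^-1` cyl c.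
  apply/seteqP; split => [w Uw|w [c cU Zc]]; last exact: cU.
  by have [c cc cU] := cyl_basis oU Uw; exists c.
rewrite bigcup_mkcond; apply: countable_bigcupT_measurable; first exact: countableP.
by move=> c; case: ifPn => // _; exact: measurable_cyl.
Qed.

End C01_cylinders.

Section distributions.
Context d (T : measurableType d) (R : realType).

Definition mutually_singular (mu nu : set T -> \bar R) :=
  exists A, [/\ measurable A, mu A = 0%E & nu (~` A) = 0%E].

End distributions.

Section wiener_process.
Context d (Omega : measurableType d) (R : realType) (P : probability Omega R).
Local Open Scope ereal_scope.

Definition incr (W : I01 R -> Omega -> R) (s t : I01 R) (w : Omega) : R :=
  (W t w - W s w)%R.

Definition independent_increments (W : I01 R -> Omega -> R) :=
  forall (n : nat) (t : nat -> I01 R),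
    (forall i j, (i <= j)%N -> (\val (t i) <= \val (t j))%R) ->
  forall B : nat -> set R, (forall i, measurable (B i)) ->
    P (\bigcap_(i < n) (incr W (t i) (t i.+1) @^-1` B i)) =
    \prod_(i < n) P (incr W (t i) (t i.+1) @^-1` B i).

Definition gaussian_increments (W : I01 R -> Omega -> R) :=
  forall s t : I01 R, (\val s < \val t)%R ->
  forall B : set R, measurable B ->
    P (incr W s t @^-1` B) = normal_prob 0%R (Num.sqrt (\val t - \val s)%R) B.

Definition standard_wiener_process (W : I01 R -> Omega -> R) :=
  [/\ forall t, measurable_fun [set: Omega] (W t),
      forall t, \val t = 0%R -> {ae P, forall w, W t w = 0%R},
      independent_increments W,
      gaussian_increments W
    & {ae P, forall w, continuous (W ^~ w)}].

(* Every event is, up to a null set, an event of the sigma-algebra generated by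
   W; for a complete P the ambient sigma-algebra is then the completion of the
   one generated by W. *)
Definition generated_by (W : I01 R -> Omega -> R) :=
  forall A, measurable A ->
    exists2 B, <<s \bigcup_t preimage_set_system setT (W t) measurable >> B
             & P.-negligible (A `+` B).

End wiener_process.

Section double_wiener_ito_integral.
Context d (Omega : measurableType d) (R : realType) (P : probability Omega R).

(* The data of the off-diagonal step function
     sum_(i, j < n, i != j) a_ij 1_(]t_i, t_{i+1}] * ]t_j, t_{j+1}]). *)
Record step_kernel := StepKernel {
  sk_size : nat ;
  sk_node : nat -> I01 R ;
  sk_coef : nat -> nat -> R ;
  sk_nodeP : forall i j, (i <= j)%N -> \val (sk_node i) <= \val (sk_node j) }.

Definition sk_cell (s : step_kernel) (i : nat) : set R :=
  `]\val (sk_node s i), \val (sk_node s i.+1)].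

Definition step_fun (s : step_kernel) (z : R * R) : R :=
  \sum_(i < sk_size s) \sum_(j < sk_size s | j != i)
    sk_coef s i j * \1_(sk_cell s i) z.1 * \1_(sk_cell s j) z.2.

Definition step_integral (W : I01 R -> Omega -> R) (s : step_kernel)
    (w : Omega) : R :=
  \sum_(i < sk_size s) \sum_(j < sk_size s | j != i)
    sk_coef s i j * incr W (sk_node s i) (sk_node s i.+1) w
                  * incr W (sk_node s j) (sk_node s j.+1) w.

(* Y is a version of I_2(f), for f square integrable on [0,1]^2: the limit in
   L^2(P) of the integrals of step functions converging to f in L^2([0,1]^2). *)
Definition is_double_integral (W : I01 R -> Omega -> R) (f : R * R -> R)
    (Y : Omega -> R) :=
  measurable_fun [set: Omega] Y /\
  exists s : nat -> step_kernel,
    (\int[lebesgue_measure \x lebesgue_measure]_(z in `[0%R, 1%R] `*` `[0%R, 1%R])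
        ((step_fun (s n) z - f z) ^+ 2)%:E @[n --> \oo] --> 0)%E /\
    (\int[P]_w ((step_integral W (s n) w - Y w) ^+ 2)%:E @[n --> \oo] --> 0)%E.

End double_wiener_ito_integral.

Section rosenblatt.
Context (R : realType).

(* The library's beta_fun only takes natural number arguments. *)
Definition Beta (a b : R) : R :=
  \int[lebesgue_measure]_(x in `]0, 1[) (x `^ (a - 1) * (1 - x) `^ (b - 1)).

Definition rosenblatt_constant (H : R) : R :=
  Num.sqrt (2 * H * (2 * H - 1)) / (2 * Beta (1 - H) (H / 2)).

(* On the diagonal the inner integral diverges and evaluates to 0 here; the
   diagonal is Lebesgue negligible. *)
Definition rosenblatt_kernel (H t : R) (x : R * R) : R :=
  rosenblatt_constant H * x.1 `^ (- (H / 2)) * x.2 `^ (- (H / 2)) *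
  (\int[lebesgue_measure]_(u in `]Num.max x.1 x.2, t[)
     (u `^ H * (u - x.1) `^ (H / 2 - 1) * (u - x.2) `^ (H / 2 - 1))) *
  \1_(`]0, t[ `*` `]0, t[) x.

(* A version with all paths continuous, as a random variable in C([0,1]). *)
Definition rosenblatt_process d (Omega : measurableType d)
    (P : probability Omega R) (W : I01 R -> Omega -> R) (H : R)
    (Z : {RV P >-> C01_borel R}) :=
  forall t : I01 R,
    is_double_integral P W (rosenblatt_kernel H (\val t))
      (fun w => C01_eval (Z w) t).

End rosenblatt.

(* Main.v *)
Require Import Defs.
From HB Require Import structures.
From mathcomp Require Import all_boot all_order all_algebra.
From mathcomp Require Import all_classical all_reals all_analysis.
From mathcomp Require Import measurable_realfun zify ring lra.

Import Order.TTheory GRing.Theory Num.Theory.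
Import numFieldNormedType.Exports.

Set Implicit Arguments.
Unset Strict Implicit.
Unset Printing Implicit Defensive.

Local Open Scope classical_set_scope.
Local Open Scope ring_scope.

(* Tudor and Viens' observation: for Rosenblatt paths the quadratic variation over
   [i/N, (i+1)/N], once centered and rescaled by N^H, converges in probability to a
   nonzero multiple of Z(1) - Z(0).  Hence the statistic "rescaled quadratic
   variation minus that multiple of f(1) - f(0)" tends to 0 on Z.  A drift lambda t
   changes the rescaled quadratic variation only by O(N^(H-1)), but f(1) - f(0) by
   lambda, so on X the same statistic has a nonzero limit.  Along a subsequence with
   summable error probabilities Borel-Cantelli turns this into a separating event.

   The paths are approximated by quadratic forms in the increments of W on a grid,
   whose moments Isserlis' formula expresses through c(p,p'), a discrete version of
   the kernel covariance Beta |u-v|^(H-1).  In the second moment of the statistic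
   the blocks at distance k contribute a multiple of
   N^(-2H) ((k-1)^(2H-2) - (k+1)^(2H-2)), which telescopes; the remaining terms are
   controlled by the square integrability of |u-v|^(H-1), that is by H > 1/2. *)

(** * Gaussian moments and mixed moments of Gaussian vectors *)

(** The statistic sums [b (Q i^2 - E Q i^2) - 4 Q i], where [Q i] discretises the increment over
    block [i] divided by the kernel constant. The coefficient 4 turns the second-chaos part of its
    second moment into a sum of [32 (b^2 X - 2 b Y + V)], where [V], [Y], [X] are cyclic products of
    two, three and four covariances. For two distant blocks the covariances joining them are close
    to a common value [rho], those inside a block integrate to [s = block_mass], and [b s = 1/N]
    makes the three terms cancel up to the variation of [rho] between the smallest and the largest
    distance of points of the blocks. Bounding the three terms separately would not do, since
    [k^(2H-2)] is not summable. So [X] and [V] are bounded above and [Y] below. The grid kernel lies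
    below the true one, which gives the upper bounds on every grid; the lower bound for [Y] holds
    only for fine grids, by Fatou's lemma. This fixes the order of limits: the mesh is refined while
    [N] is fixed. *)

Section density.
Context d (T : measurableType d) (R : realType).
Variables (mu nu : {measure set T -> \bar R}) (p : T -> R).
Hypothesis p0 : forall x, 0 <= p x.
Hypothesis mp : measurable_fun setT p.
Hypothesis nuE : forall A, measurable A -> nu A = (\int[mu]_(x in A) (p x)%:E)%E.
Local Open Scope ereal_scope.
Import HBNNSimple.

(** On indicators this is the density hypothesis; it extends to simple functions by linearity and to
    nonnegative functions by monotone convergence. *)
Lemma ge0_integral_density (f : T -> \bar R) : (forall x, 0 <= f x) ->
  measurable_fun setT f ->
  \int[nu]_x f x = \int[mu]_x (f x * (p x)%:E).
Proof.
move=> f0 mf.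
pose h := nnsfun_approx measurableT mf.
have hf x : EFin (h n x) @[n --> \oo] --> f x.
  by apply: cvg_nnsfun_approx => //; exact: f0.
have sub (g : {nnsfun T >-> R}) :
    \int[nu]_x (g x)%:E = \int[mu]_x ((g x)%:E * (p x)%:E).
  under eq_integral do rewrite fimfunE -fsumEFin//.
  have gE x : (g x)%:E * (p x)%:E = \sum_(r \in range g)
      ((r * \1_(g @^-1` [set r]) x)%:E * (p x)%:E).
    rewrite fimfunE -fsumEFin// ge0_mule_fsuml// => r.
    by rewrite EFinM nnfun_muleindic_ge0.
  under [RHS]eq_integral => x _ do rewrite gE.
  rewrite ge0_integral_fsum//; last 2 first.
  - by move=> r; exact/measurable_EFinP/measurableT_comp.
  - by move=> r x _; rewrite EFinM nnfun_muleindic_ge0.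
  rewrite ge0_integral_fsum//; last 2 first.
  - by move=> r; apply: emeasurable_funM => //;
      [exact/measurable_EFinP/measurableT_comp|exact/measurable_EFinP].
  - by move=> r x _; rewrite mule_ge0 ?EFinM ?nnfun_muleindic_ge0 ?lee_fin.
  apply: eq_fsbigr => r /[!inE] -[x _ <-{r}].
  under eq_integral do rewrite EFinM.
  under [RHS]eq_integral do rewrite EFinM -muleA.
  rewrite !ge0_integralZl//; last 5 first.
  - by apply: emeasurable_funM; apply/measurable_EFinP.
  - by move=> y _; rewrite mule_ge0// lee_fin.
  - by rewrite lee_fin.
  - exact/measurable_EFinP.
  - by rewrite lee_fin.
  rewrite integral_indic// setIT nuE// integral_mkcond; congr *%E.
  by apply: eq_integral => y _; rewrite patchE indicE; case: ifPn => _;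
    rewrite ?mul1e ?mul0e.
transitivity (limn (fun n => \int[nu]_x (h n x)%:E)).
  rewrite -monotone_convergence//.
  - by apply: eq_integral => x _; apply/esym/cvg_lim => //; exact: hf.
  - by move=> n; exact/measurable_EFinP.
  - by move=> n x _; rewrite lee_fin.
  - by move=> x _ m n mn; rewrite lee_fin; exact/lefP/nd_nnsfun_approx.
transitivity (limn (fun n => \int[mu]_x ((h n x)%:E * (p x)%:E))).
  by congr (limn _); apply/funext => n; exact: sub.
rewrite -monotone_convergence//.
- apply: eq_integral => x _; apply/cvg_lim => //.
  by apply: cvgeZr => //; exact: hf.
- by move=> n; apply: emeasurable_funM; apply/measurable_EFinP.
- by move=> n x _; rewrite mule_ge0// lee_fin.
- move=> x _ m n mn; rewrite lee_wpmul2r ?lee_fin//.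
  exact/lefP/nd_nnsfun_approx.
Qed.

Lemma integral_density (f : T -> R) : measurable_fun setT f ->
  \int[nu]_x (f x)%:E = \int[mu]_x (f x * p x)%:E.
Proof.
move=> mf; rewrite integralE [RHS]integralE; congr (_ - _).
- rewrite ge0_integral_density; last 2 first.
  - by move=> x; rewrite funeposE le_max lexx orbT.
  - by apply: measurable_funepos; exact/measurable_EFinP.
  apply: eq_integral => x _; rewrite !funeposE -!EFin_max -EFinM maxr_pMl ?mul0r//.
- rewrite ge0_integral_density; last 2 first.
  - by move=> x; rewrite funenegE le_max lexx orbT.
  - by apply: measurable_funeneg; exact/measurable_EFinP.
  apply: eq_integral => x _.
  by rewrite !funenegE -!EFinN -!EFin_max -EFinM maxr_pMl ?mul0r// mulNr.
Qed.

End density.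

Section gaussian_moments.
Context {R : realType}.
Notation mu := (@lebesgue_measure R).
Implicit Types (c x : R) (n : nat).

(** The centered Gaussian weight of variance [(2 c)^-1] without its normalising constant, which is
    never computed: moments are expressed as multiples of the integral of [gauss c]. *)
Definition gauss c x : R := expR (- (c * x ^+ 2)).

Lemma gauss_ge0 c x : 0 <= gauss c x. Proof. exact: expR_ge0. Qed.

Lemma gauss_continuous c : continuous (gauss c).
Proof.
move=> x; apply: (@continuous_comp _ _ _ (fun x => - (c * x ^+ 2)) expR).
  by apply: cvgN; apply: cvgM; [exact: cvg_cst|exact: exprn_continuous].
exact: continuous_expR.
Qed.

Lemma measurable_gauss c : measurable_fun setT (gauss c).
Proof. by apply: continuous_measurable_fun; exact: gauss_continuous. Qed.

(** Half of the exponent pays for the polynomial: [|x|^n <= 1 + (x^2)^(n+1)], and both terms are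
    controlled by [1 + y^(n+1) / (n+1)! <= e^y] at [y = (c/2) x^2]. *)
Lemma gauss_moment_le c n : 0 < c ->
  exists2 K : R, 0 < K & forall x, `|x| ^+ n * gauss c x <= K * gauss (c / 2) x.
Proof.
move=> c0; exists (1 + (2 / c) ^+ n.+1 * n.+1`!%:R).
  by rewrite ltr_pwDl// mulr_ge0// exprn_ge0// divr_ge0// ltW.
move=> x.
have -> : gauss c x = expR (- (c / 2 * x ^+ 2)) * gauss (c / 2) x.
  by rewrite -expRD; congr expR; lra.
rewrite mulrA ler_wpM2r ?gauss_ge0// expRN ler_pdivrMr ?expR_gt0//.
have y0 : 0 <= c / 2 * x ^+ 2 by rewrite mulr_ge0 ?sqr_ge0// divr_ge0// ltW.
have := expR_ge1Dxn n y0; set e := expR _ => he.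
have e1 : 1 <= e.
  by apply: le_trans he; rewrite lerDl divr_ge0// exprn_ge0.
have h : `|x| ^+ n <= 1 + (`|x| ^+ 2) ^+ n.+1.
  have [x1|x1] := leP `|x| 1.
    by apply: (@le_trans _ _ 1); rewrite ?exprn_ile1// lerDl !exprn_ge0.
  rewrite -exprM (le_trans (_ : _ <= `|x| ^+ (2 * n.+1))) ?lerDr//.
  by apply: ler_weXn2l; [exact: ltW|lia].
apply: le_trans h _; rewrite mulrDl mul1r lerD//.
have -> : `|x| ^+ 2 = 2 / c * (c / 2 * x ^+ 2).
  by rewrite real_normK ?num_real//; field; rewrite gt_eqF.
rewrite exprMn -[leRHS]mulrA ler_wpM2l ?exprn_ge0 ?divr_ge0 ?(ltW c0)//.
rewrite [leRHS]mulrC -ler_pdivrMr ?ltr0n ?fact_gt0//.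
by apply: le_trans he; rewrite lerDr.
Qed.

Lemma gauss_normal_pdf c : 0 < c ->
  exists2 p : R, 0 < p & forall x, normal_pdf 0 (Num.sqrt (2 * c)^-1) x = p * gauss c x.
Proof.
move=> c0.
have s0 : Num.sqrt (2 * c)^-1 != 0.
  by rewrite gt_eqF// sqrtr_gt0 invr_gt0 mulr_gt0.
exists (normal_peak (Num.sqrt (2 * c)^-1)); first exact: normal_peak_gt0.
move=> x; rewrite normal_pdfE//; congr (_ * expR _).
rewrite subr0 sqr_sqrtr ?invr_ge0 ?mulr_ge0 ?(ltW c0)//.
by field; rewrite gt_eqF.
Qed.

Lemma integrable_gauss c : 0 < c -> mu.-integrable setT (EFin \o gauss c).
Proof.
move=> c0; have [p p0 pE] := gauss_normal_pdf c0.
rewrite (_ : EFin \o gauss c =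
    (fun x => p^-1%:E * (normal_pdf 0 (Num.sqrt (2 * c)^-1) x)%:E)%E); last first.
  by apply/funext => x; rewrite /= pE -EFinM mulKf ?gt_eqF.
by apply: integrableZl => //; exact: integrable_normal_pdf.
Qed.

Lemma integrable_gauss_moment c n : 0 < c ->
  mu.-integrable setT (fun x => (x ^+ n * gauss c x)%:E).
Proof.
move=> c0; have [K K0 h] := gauss_moment_le n c0.
apply: (@le_integrable _ _ _ mu setT measurableT _
  (fun x : measurableTypeR R => (K * gauss (c / 2) x)%:E)).
- by apply/measurable_EFinP; apply: measurable_funM;
    [exact: measurable_funX|exact: measurable_gauss].
- move=> x _; rewrite lee_fin normrM normrX (ger0_norm (gauss_ge0 _ _)).
  by rewrite (le_trans (h x))// ler_norm.
- under eq_fun do rewrite EFinM.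
  by apply: integrableZl => //; apply: integrable_gauss; rewrite divr_gt0.
Qed.

Lemma is_derive_gauss c n x : is_derive x 1 (fun y => - (y ^+ n * gauss c y))
  ((2 * c * x ^+ n.+1 - n%:R * x ^+ n.-1) * gauss c x).
Proof.
have dg : is_derive x 1 (gauss c) (- (2 * c * x) * gauss c x).
  have h : is_derive x 1 (fun y : R => - (c * y ^+ 2)) (- (2 * c * x)).
    by apply: is_derive_eq; rewrite /GRing.scale/=; ring.
  have := @is_derive1_comp _ expR (fun y : R => - (c * y ^+ 2)) x _ _ _ h.
  by move=> /(_ _ (is_derive_expR _)); rewrite [_ * - _]mulrC.
have h := is_deriveN (is_deriveM (is_deriveX n (is_derive_id x (1 : R))) dg).
rewrite (_ : (fun y => _) = - (id ^+ n * gauss c)); last first.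
  by apply/funext => y; rewrite !fctE.
apply: (is_derive_eq h).
by rewrite !fctE /GRing.scale/= mulr1 exprS; ring.
Qed.

(** Integration by parts: the integrand is the derivative of [- x^n gauss c x], whose boundary
    values vanish at infinity. This is the recursion between the moments of orders [n+1] and [n-1];
    for [n = 0] it says that the first moment is zero. *)
Lemma gauss_moment_parts c n : 0 < c ->
  (\int[mu]_x ((2 * c * x ^+ n.+1 - n%:R * x ^+ n.-1) * gauss c x)%:E = 0)%E.
Proof.
move=> c0.
pose f x := (2 * c * x ^+ n.+1 - n%:R * x ^+ n.-1) * gauss c x.
pose F x := - (x ^+ n * gauss c x).
have fE : EFin \o f = (fun x : measurableTypeR R => (2 * c)%:E * (x ^+ n.+1 * gauss c x)%:E -
    n%:R%:E * (x ^+ n.-1 * gauss c x)%:E)%E.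
  by apply/funext => x; rewrite /f /= -!EFinM -EFinB; congr EFin; ring.
have fi : mu.-integrable setT (EFin \o f).
  rewrite fE; apply: integrableB => //; apply: integrableZl => //;
  exact: integrable_gauss_moment.
have mf : measurable_fun setT (EFin \o f) by case/integrableP: fi.
have cf : continuous f.
  move=> x; apply: cvgM; last exact: gauss_continuous.
  by apply: cvgB; apply: cvgM; try exact: cvg_cst; exact: exprn_continuous.
have dF x : derivable F x 1 by have [] := is_derive_gauss c n x.
pose I (m : nat) : interval R := `[- m.+1%:R, m.+1%:R].
have [|||||_ _] := @dominated_convergence _ _ _ mu setT measurableT
  (fun m => (EFin \o f) \_ [set` I m]) (EFin \o f) (abse \o (EFin \o f)).
- by move=> m; apply/(measurable_restrictT _ _).1 => //; exact: measurable_funTS.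
- exact: mf.
- apply: aeW => x _; apply: cvg_near_cst.
  exists (Num.trunc `|x|) => // m /= xm; rewrite patchE ifT// inE /I/= in_itv/=.
  rewrite -ler_norml ltW// (lt_le_trans (truncnS_gt _))// ler_nat//.
- exact: integrable_abse.
- apply: aeW => x m _; rewrite patchE; case: ifPn => //= _.
  by rewrite normr0 lee_fin.
have cF : continuous F.
  by move=> x; apply/differentiable_continuous; rewrite -derivable1_diffP.
have IE m : (\int[mu]_x ((EFin \o f) \_ [set` I m]) x =
    (F m.+1%:R - F (- m.+1%:R))%:E)%E.
  rewrite -integral_mkcond EFinB; apply: continuous_FTC2.
  - by rewrite gtrN.
  - exact: continuous_subspaceT.
  - split=> [x _|//|//]; first exact: dF.
      by apply: cvg_at_right_filter; exact: cF.
    by apply: cvg_at_left_filter; exact: cF.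
  - by move=> x _; rewrite derive1E; have [_ ->] := is_derive_gauss c n x.
under eq_fun do rewrite IE; move=> cvf.
(* Bounding the moment of order [n+1] instead of [n] gains the factor [1 / |x|] that makes the
   boundary terms vanish. *)
have [K K0 hK] := gauss_moment_le n.+1 c0.
have FK x : 0 < `|x| -> `|F x| <= K / `|x|.
  move=> x0; rewrite normrN normrM normrX (ger0_norm (gauss_ge0 _ _)).
  rewrite ler_pdivlMr// mulrAC -exprSr (le_trans (hK _))//.
  by rewrite ler_piMr ?(ltW K0)// expR_le1 oppr_le0 mulr_ge0 ?sqr_ge0// divr_ge0// ltW.
have cv0 : (F m.+1%:R - F (- m.+1%:R)) @[m --> \oo] --> 0.
  apply: (@squeeze_cvgr _ _ _ _ (fun m => - (2 * K * m.+1%:R^-1)) (fun m => 2 * K * m.+1%:R^-1)).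
  - near=> m; rewrite -ler_norml (le_trans (ler_normB _ _))//.
    have -> : 2 * K * m.+1%:R^-1 = K / `|m.+1%:R| + K / `|- m.+1%:R|.
      by rewrite normrN ger0_norm//; ring.
    by rewrite lerD// FK// ?normrN normr_gt0 pnatr_eq0.
  - rewrite -oppr0; apply: cvgN; rewrite -(mulr0 (2 * K)).
    by apply: cvgMr; exact: cvg_harmonic.
  - rewrite -(mulr0 (2 * K)).
    by apply: cvgMr; exact: cvg_harmonic.
have cv1 : (F m.+1%:R - F (- m.+1%:R))%:E @[m --> \oo] --> 0%E.
  by apply: cvg_EFin => //; exact: nearW.
exact: (cvg_unique (@ereal_hausdorff R) cvf cv1).
Unshelve. all: by end_near. Qed.

(** Moments of a centered normal variable of variance [v]. For [v = 0] the recursion gives the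
    moments of the constant 0, which covers increments between equal nodes. *)
Fixpoint gaussian_moment (v : R) n : R :=
  match n with
  | 0 => 1
  | 1 => 0
  | n'.+2 => n'.+1%:R * v * gaussian_moment v n'
  end.

Lemma integral_gauss_moment c n : 0 < c ->
  (\int[mu]_x (x ^+ n * gauss c x)%:E =
   (gaussian_moment (2 * c)^-1 n)%:E * \int[mu]_x (gauss c x)%:E)%E.
Proof.
move=> c0.
have step k : (\int[mu]_x (x ^+ k.+1 * gauss c x)%:E =
    (k%:R / (2 * c))%:E * \int[mu]_x (x ^+ k.-1 * gauss c x)%:E)%E.
  have := gauss_moment_parts k c0.
  have -> : (fun x => ((2 * c * x ^+ k.+1 - k%:R * x ^+ k.-1) * gauss c x)%:E) =
      (fun x : measurableTypeR R => (2 * c)%:E * (x ^+ k.+1 * gauss c x)%:E -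
    k%:R%:E * (x ^+ k.-1 * gauss c x)%:E)%E.
    by apply/funext => x; rewrite /= -!EFinM -EFinB; congr EFin; ring.
  have i1 := integrable_gauss_moment k.+1 c0.
  have i2 := integrable_gauss_moment k.-1 c0.
  rewrite integralB//; try by apply: integrableZl.
  rewrite !integralZl//.
  rewrite -(fineK (integrable_fin_num measurableT i1)).
  rewrite -(fineK (integrable_fin_num measurableT i2)) -!EFinM -EFinB => -[].
  move=> /eqP; rewrite subr_eq0 => /eqP h; congr EFin.
  apply: (@mulfI _ (2 * c)); first by rewrite gt_eqF// mulr_gt0.
  by rewrite h; field; rewrite gt_eqF.
suff : forall k, (\int[mu]_x (x ^+ k * gauss c x)%:E =
     (gaussian_moment (2 * c)^-1 k)%:E * \int[mu]_x (gauss c x)%:E)%E /\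
   (\int[mu]_x (x ^+ k.+1 * gauss c x)%:E =
     (gaussian_moment (2 * c)^-1 k.+1)%:E * \int[mu]_x (gauss c x)%:E)%E.
  by move=> /(_ n)[].
elim=> [|k [IH1 IH2]].
  split; last by rewrite step mul0r !mul0e.
  by rewrite /= mul1e; apply: eq_integral => x _; rewrite expr0 mul1r.
by split=> //; rewrite step IH1 muleA -EFinM.
Qed.

Lemma normal_moment s n : 0 < s ->
  mu.-integrable setT (fun x => (x ^+ n * normal_pdf 0 s x)%:E) /\
  (\int[mu]_x (x ^+ n * normal_pdf 0 s x)%:E = (gaussian_moment (s ^+ 2) n)%:E)%E.
Proof.
move=> s0; pose c := (2 * s ^+ 2)^-1.
have c0 : 0 < c by rewrite invr_gt0 mulr_gt0// exprn_gt0.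
have cE : (2 * c)^-1 = s ^+ 2 by rewrite /c; field; rewrite gt_eqF.
have [p p0] := gauss_normal_pdf c0; rewrite cE sqrtr_sqr gtr0_norm// => pE.
have -> : (fun x => (x ^+ n * normal_pdf 0 s x)%:E) =
    (fun x : measurableTypeR R => p%:E * (x ^+ n * gauss c x)%:E)%E.
  by apply/funext => x; rewrite pE -EFinM mulrCA.
have ii := integrable_gauss_moment n c0.
split; first exact: integrableZl.
rewrite integralZl// integral_gauss_moment// cE muleCA.
rewrite -integralZl//; last exact: integrable_gauss.
under eq_integral do rewrite -EFinM -pE.
by rewrite integral_normal_pdf mule1.
Qed.

End gaussian_moments.

(** * Random variables with finite moments of all orders *)

Section finite_moments.
Context d (T : measurableType d) (R : realType) (P : probability T R).
Implicit Types X Y : T -> R.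

(** This class is closed under sums and products, so every polynomial in the increments of [W] can
    be integrated term by term. *)
Definition finite_moments X := measurable_fun setT X /\
  forall n, P.-integrable setT (fun w => (`|X w| ^+ n)%:E).

Lemma finite_moments_le X (Y : nat -> T -> R) : measurable_fun setT X ->
  (forall n, P.-integrable setT (EFin \o Y n)) ->
  (forall n w, `|X w| ^+ n <= Y n w) -> finite_moments X.
Proof.
move=> mX iY XY; split=> // n.
apply: (le_integrable measurableT _ _ (iY n)).
  by apply/measurable_EFinP; apply: measurable_funX; exact: measurableT_comp.
move=> w _; rewrite lee_fin ger0_norm ?exprn_ge0// (le_trans (XY n w))//.
exact: ler_norm.
Qed.

Lemma finite_moments_integrable X : finite_moments X ->
  P.-integrable setT (EFin \o X).
Proof.
move=> [mX /(_ 1%N) iX]; apply: (le_integrable measurableT _ _ iX).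
  exact/measurable_EFinP.
by move=> w _; rewrite lee_fin expr1 normr_id.
Qed.

Lemma finite_moments_cst (r : R) : finite_moments (cst r).
Proof.
by split=> // n; exact: (finite_measure_integrable_cst P (`|r| ^+ n)).
Qed.

Lemma finite_momentsM X Y : finite_moments X -> finite_moments Y ->
  finite_moments (fun w => X w * Y w).
Proof.
move=> [mX iX] [mY iY].
apply: (@finite_moments_le _ (fun n w => `|X w| ^+ (2 * n) + `|Y w| ^+ (2 * n))).
- exact: measurable_funM.
- move=> n; rewrite /comp; under eq_fun do rewrite EFinD.
  exact: integrableD (iX _) (iY _).
- move=> n w; rewrite normrM exprMn mulnC !exprM.
  have := sqr_ge0 (`|X w| ^+ n - `|Y w| ^+ n).
  have := exprn_ge0 n (normr_ge0 (X w)); have := exprn_ge0 n (normr_ge0 (Y w)).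
  by set a := `|X w| ^+ n; set b := `|Y w| ^+ n => *; nra.
Qed.

Lemma finite_momentsD X Y : finite_moments X -> finite_moments Y ->
  finite_moments (fun w => X w + Y w).
Proof.
move=> [mX iX] [mY iY].
apply: (@finite_moments_le _ (fun n w => 2 ^+ n * `|X w| ^+ n + 2 ^+ n * `|Y w| ^+ n)).
- exact: measurable_funD.
- move=> n; rewrite /comp; under eq_fun do rewrite EFinD !EFinM.
  exact: integrableD (integrableZl _ _ (iX _)) (integrableZl _ _ (iY _)).
- move=> n w; rewrite -!exprMn.
  have h : `|X w + Y w| <= `|X w| + `|Y w| by exact: ler_normD.
  have [xy|xy] := leP `|X w| `|Y w|.
    apply: (@le_trans _ _ ((2 * `|Y w|) ^+ n)).
      by rewrite lerXn2r ?nnegrE ?mulr_ge0//; lra.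
    by rewrite lerDr exprn_ge0 ?mulr_ge0.
  apply: (@le_trans _ _ ((2 * `|X w|) ^+ n)).
    by rewrite lerXn2r ?nnegrE ?mulr_ge0//; lra.
  by rewrite lerDl exprn_ge0 ?mulr_ge0.
Qed.

Lemma finite_momentsZ (r : R) X : finite_moments X ->
  finite_moments (fun w => r * X w).
Proof. by move=> ?; apply: finite_momentsM => //; exact: finite_moments_cst. Qed.

Lemma finite_momentsB X Y : finite_moments X -> finite_moments Y ->
  finite_moments (fun w => X w - Y w).
Proof.
move=> fX fY; under eq_fun do rewrite -mulN1r.
by apply: finite_momentsD => //; exact: finite_momentsZ.
Qed.

Lemma finite_moments_sum (I : Type) (s : seq I) (p : pred I) (X : I -> T -> R) :
  (forall i, finite_moments (X i)) ->
  finite_moments (fun w => \sum_(i <- s | p i) X i w).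
Proof.
move=> fX; elim: s => [|i s IH].
  by under eq_fun do rewrite big_nil; exact: finite_moments_cst.
under eq_fun do rewrite big_cons; case: (p i) => //.
exact: finite_momentsD.
Qed.

Lemma finite_moments_prod (I : Type) (s : seq I) (X : I -> T -> R) :
  (forall i, finite_moments (X i)) ->
  finite_moments (fun w => \prod_(i <- s) X i w).
Proof.
move=> fX; elim: s => [|i s IH].
  by under eq_fun do rewrite big_nil; exact: finite_moments_cst.
under eq_fun do rewrite big_cons; exact: finite_momentsM.
Qed.

Lemma finite_momentsX X n : finite_moments X -> finite_moments (fun w => X w ^+ n).
Proof.
move=> fX; elim: n => [|n IH].
  by under eq_fun do rewrite expr0; exact: finite_moments_cst.
by under eq_fun do rewrite exprS; exact: finite_momentsM.
Qed.

Definition Ex X : R := \int[P]_w X w.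

Lemma ExE X : finite_moments X -> (\int[P]_w (X w)%:E = (Ex X)%:E)%E.
Proof.
move=> /finite_moments_integrable iX; rewrite /Ex /Rintegral fineK//.
exact: integrable_fin_num.
Qed.

Lemma Ex_cst (r : R) : Ex (cst r) = r.
Proof.
rewrite /Ex /Rintegral (_ : (\int[P]_w (cst r w)%:E = r%:E)%E)//.
rewrite (integral_cst P measurableT r%:E).
by rewrite [X in (_ * X)%E](_ : _ = 1%E) ?mule1//; exact: (@probability_setT _ _ _ P). Qed.

Lemma ExD X Y : finite_moments X -> finite_moments Y ->
  Ex (fun w => X w + Y w) = Ex X + Ex Y.
Proof. by move=> *; rewrite /Ex RintegralD//; exact: finite_moments_integrable. Qed.

Lemma ExB X Y : finite_moments X -> finite_moments Y ->
  Ex (fun w => X w - Y w) = Ex X - Ex Y.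
Proof. by move=> *; rewrite /Ex RintegralB//; exact: finite_moments_integrable. Qed.

Lemma ExZ (r : R) X : finite_moments X -> Ex (fun w => r * X w) = r * Ex X.
Proof. by move=> *; rewrite /Ex RintegralZl//; exact: finite_moments_integrable. Qed.

Lemma Ex_sum (I : Type) (s : seq I) (p : pred I) (X : I -> T -> R) :
  (forall i, finite_moments (X i)) ->
  Ex (fun w => \sum_(i <- s | p i) X i w) = \sum_(i <- s | p i) Ex (X i).
Proof.
move=> fX; elim: s => [|i s IH].
  by rewrite big_nil; under eq_fun do rewrite big_nil; exact: Ex_cst.
rewrite big_cons; under eq_fun do rewrite big_cons.
case: (p i) => //; rewrite ExD ?IH//.
exact: finite_moments_sum.
Qed.

Lemma eq_Ex X Y : X =1 Y -> Ex X = Ex Y.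
Proof. by move=> /funext ->. Qed.

End finite_moments.

(** * Expectations of products of independent variables *)

Section independence.
Context d (T : measurableType d) (R : realType) (P : probability T R).
Local Open Scope ereal_scope.
Import HBNNSimple.

(** A factorisation known for indicators of [Y] passes to nonnegative functions of [Y], with [A] and
    [C] kept fixed. This allows the factors of a product to be generalised one at a time. *)
Lemma ge0_integral_factor (A Y : T -> R) (C : R) (g : R -> R) :
  (forall w, 0 <= A w)%R -> measurable_fun setT A -> measurable_fun setT Y ->
  (0 <= C)%R ->
  (forall B, measurable B ->
    \int[P]_w (A w * \1_B (Y w))%:E = C%:E * \int[P]_w (\1_B (Y w))%:E) ->
  (forall x, 0 <= g x)%R -> measurable_fun setT g ->
  \int[P]_w (A w * g (Y w))%:E = C%:E * \int[P]_w (g (Y w))%:E.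
Proof.
move=> A0 mA mY C0 hB g0 mg.
have mEg : measurable_fun setT (EFin \o g) by exact/measurable_EFinP.
pose h := nnsfun_approx measurableT mEg.
have hg x : EFin (h n x) @[n --> \oo] --> (EFin \o g) x.
  by apply: cvg_nnsfun_approx => // y _; rewrite lee_fin.
have ndh (m n : nat) x : (m <= n)%N -> (h m x <= h n x)%R.
  by move=> mn; exact/lefP/nd_nnsfun_approx.
have mind (B : set R) : measurable B -> measurable_fun setT (fun w => \1_B (Y w) : R).
  by move=> mB; exact: measurableT_comp.
have sub (f : {nnsfun R >-> R}) :
    \int[P]_w (A w * f (Y w))%:E = C%:E * \int[P]_w (f (Y w))%:E.
  have gE w : (f (Y w))%:E = \sum_(r \in range f)
      ((r * \1_(f @^-1` [set r]) (Y w))%:E).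
    by rewrite fimfunE -fsumEFin.
  have gE' w : (A w * f (Y w))%:E = \sum_(r \in range f)
      ((A w)%:E * (r * \1_(f @^-1` [set r]) (Y w))%:E).
    by rewrite EFinM gE ge0_mule_fsumr// => r; rewrite EFinM nnfun_muleindic_ge0.
  under eq_integral => w _ do rewrite gE'.
  under [in RHS]eq_integral => w _ do rewrite gE.
  have mB (r : R) : measurable (f @^-1` [set r]) by [].
  rewrite ge0_integral_fsum//; last 2 first.
  - by move=> r; apply: emeasurable_funM; apply/measurable_EFinP => //;
      apply: measurable_funM => //; exact: mind.
  - by move=> r w _; rewrite mule_ge0 ?EFinM ?nnfun_muleindic_ge0 ?lee_fin.
  rewrite ge0_integral_fsum//; last 2 first.
  - by move=> r; apply/measurable_EFinP; apply: measurable_funM => //; exact: mind.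
  - by move=> r w _; rewrite EFinM nnfun_muleindic_ge0.
  rewrite ge0_mule_fsumr; last first.
    by move=> r; apply: integral_ge0 => w _; rewrite EFinM nnfun_muleindic_ge0.
  apply: eq_fsbigr => r /[!inE] -[x _ <-{r}].
  under eq_integral do rewrite -EFinM mulrCA EFinM.
  under [in RHS]eq_integral do rewrite EFinM.
  rewrite !ge0_integralZl//; last 5 first.
  - by apply/measurable_EFinP; exact: mind.
  - by rewrite lee_fin.
  - by apply/measurable_EFinP; apply: measurable_funM => //; exact: mind.
  - by move=> w _; rewrite lee_fin mulr_ge0.
  - by rewrite lee_fin.
  by rewrite hB// muleCA.
have mh n : measurable_fun setT (fun w => h n (Y w)) by exact: measurableT_comp.
transitivity (limn (fun n => \int[P]_w (A w * h n (Y w))%:E)).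
  rewrite -monotone_convergence//.
  - apply: eq_integral => w _; apply/esym/cvg_lim => //.
    by rewrite EFinM; under eq_fun do rewrite EFinM; apply: cvgeZl => //; exact: hg.
  - by move=> n; apply/measurable_EFinP; exact: measurable_funM.
  - by move=> n x _; rewrite lee_fin mulr_ge0.
  - by move=> x _ m n mn; rewrite lee_fin ler_wpM2l// ndh.
have hl : \int[P]_w (h n (Y w))%:E @[n --> \oo] --> \int[P]_w (g (Y w))%:E.
  rewrite [X in _ --> X](_ : _ = \int[P]_w (limn (fun n => (h n (Y w))%:E))).
    apply: cvg_monotone_convergence => //.
    - by move=> n; exact/measurable_EFinP.
    - by move=> n w _; rewrite lee_fin.
    - by move=> w _ m n mn; rewrite lee_fin ndh.
  by apply: eq_integral => w _; apply/esym/cvg_lim => //; exact: hg.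
under eq_fun do rewrite sub.
by apply/cvg_lim => //; exact: cvgeZl.
Qed.

Variables (X : nat -> T -> R) (n : nat).
Hypothesis mX : forall i, measurable_fun setT (X i).
Hypothesis indX : forall B : nat -> set R, (forall i, measurable (B i)) ->
  P (\bigcap_(i < n) (X i @^-1` B i)) = \prod_(i < n) P (X i @^-1` B i).

Let mfX (f : nat -> R -> R) i : measurable_fun setT (f i) ->
  measurable_fun setT (fun w => f i (X i w)).
Proof. by move=> mf; exact: measurableT_comp. Qed.

(** Induction on the number [j] of factors that are arbitrary nonnegative functions, the remaining
    ones being indicators. For [j = 0] this is the independence of events; the step frees the factor
    [j] by [ge0_integral_factor]. *)
Let ge0_indep_prod (j : nat) : (j <= n)%N -> forall f : nat -> R -> R,
  (forall i, measurable_fun setT (f i)) ->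
  (forall i x, 0 <= f i x)%R ->
  (forall i, P.-integrable setT (fun w => (f i (X i w))%:E)) ->
  (forall i, (j <= i < n)%N -> exists2 B, measurable B & f i = \1_B) ->
  \int[P]_w (\prod_(i < n) f i (X i w))%:E =
    (\prod_(i < n) \int[P]_w f i (X i w))%:E.
Proof.
elim: j => [_|j IH jn] f mf f0 fi fB.
  have [B mB fE] : exists2 B : nat -> set R, (forall i, measurable (B i)) &
      forall i, (i < n)%N -> f i = \1_(B i).
    have h i : exists B, measurable B /\ ((i < n)%N -> f i = \1_B).
      have [ni|_] := ltnP i n; last by exists set0.
      by have [B mB fE] := fB i ni; exists B.
    by have [B hB] := choice h; exists B => i; case: (hB i).
  have E w : (\prod_(i < n) f i (X i w) = \1_(\bigcap_(i < n) (X i @^-1` B i)) w :> R)%R.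
    rewrite indicE; case: (boolP (w \in _)) => [/set_mem h|/negP h].
      rewrite big1// => i _; rewrite fE// indicE mem_set//.
      by apply: (h i) => /=.
    have [i hi] : exists i : 'I_n, ~ B i (X i w).
      apply/not_existsP => h'; apply: h; apply/mem_set => i /= ilt.
      by apply: contrapT; exact: (h' (Ordinal ilt)).
    by rewrite (bigD1 i)//= fE// indicE memNset// mul0r.
  under eq_integral do rewrite E.
  have mBX : forall i, measurable (X i @^-1` B i).
    by move=> i; rewrite -[X in measurable X]setTI; exact: mX.
  rewrite integral_indic//= ?setIT ?indX//; last by apply: fin_bigcap_measurable.
  rewrite -prodEFin; apply: eq_bigr => i _.
  rewrite /Rintegral fineK; last exact: (integrable_fin_num measurableT (fi i)).
  under [RHS]eq_integral do rewrite fE//.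
  rewrite (_ : (fun w => (\1_(B i) (X i w))%:E) = (fun w => (\1_(X i @^-1` B i) w)%:E))//.
  by rewrite integral_indic// setIT.
have i0 : 'I_n := Ordinal jn.
pose A w := (\prod_(i < n | i != Ordinal jn) f i (X i w))%R.
have split_prod (h : nat -> R -> R) w :
    (\prod_(i < n) h i (X i w) =
     (\prod_(i < n | i != Ordinal jn) h i (X i w)) * h j (X j w))%R.
  by rewrite (bigD1 (Ordinal jn))//= mulrC.
pose C := (\prod_(i < n | i != Ordinal jn) \int[P]_w f i (X i w))%R.
have mA : measurable_fun setT A.
  rewrite /A; under eq_fun do rewrite -big_filter.
  by apply: measurable_prod => i _; exact: (measurableT_comp (mf i) (mX i)).
under eq_integral do rewrite split_prod.
rewrite (@ge0_integral_factor A (X j) C)//.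
- rewrite (bigD1 (Ordinal jn))//= mulrC EFinM; congr *%E.
  rewrite /Rintegral fineK//; exact: (integrable_fin_num measurableT (fi j)).
- by move=> w; apply: prodr_ge0.
- by apply: prodr_ge0 => i _; apply: Rintegral_ge0.
move=> B mB; pose f' i := if i == j then \1_B else f i.
have f'j : f' j = \1_B by rewrite /f' eqxx.
have f'i i : i != j -> f' i = f i by rewrite /f' => /negbTE ->.
have mf' i : measurable_fun setT (f' i).
  by rewrite /f'; case: ifPn => // _; exact: measurable_indic.
have iB : P.-integrable setT (fun w => (\1_B (X j w))%:E).
  have i1 : P.-integrable setT (fun _ : T => 1%:E) := finite_measure_integrable_cst P 1 measurableT.
  apply: (le_integrable measurableT _ _ i1) => //.
    by apply/measurable_EFinP; apply: (measurableT_comp _ (mX j)); exact: measurable_indic.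
  by move=> w _; rewrite lee_fin normr1 indicE; case: (_ \in _); rewrite ?normr0 ?normr1.
have := IH (ltnW jn) f'.
have E w : (\prod_(i < n) f' i (X i w) = A w * \1_B (X j w))%R.
  rewrite split_prod f'j; congr (_ * _)%R; apply: eq_bigr => i ij.
  by rewrite f'i// -(inj_eq val_inj).
under eq_integral do rewrite E.
move=> ->.
- rewrite (bigD1 (Ordinal jn))//= f'j mulrC EFinM; congr *%E.
    by congr EFin; apply: eq_bigr => i ij; rewrite f'i// -(inj_eq val_inj).
  rewrite /Rintegral fineK//; exact: (integrable_fin_num measurableT iB).
- exact: mf'.
- by move=> i x; rewrite /f'; case: ifPn => // _; rewrite indicE.
- by move=> i; rewrite /f'; case: ifPn => // /eqP ->.
- move=> i /andP[ji ni]; rewrite /f'; case: eqP => [_|/eqP ij]; first by exists B.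
  by apply: fB; rewrite ltn_neqAle eq_sym ij ji.
Qed.

(** Induction on the number [j] of factors of arbitrary sign, the remaining ones being nonnegative;
    the step writes the factor [j] as the difference of its positive and negative parts. *)
Let indep_prod (j : nat) : (j <= n)%N -> forall f : nat -> R -> R,
  (forall i, measurable_fun setT (f i)) ->
  (forall i, P.-integrable setT (fun w => (f i (X i w))%:E)) ->
  (forall i, (j <= i)%N -> forall x, 0 <= f i x)%R ->
  P.-integrable setT (fun w => (\prod_(i < n) f i (X i w))%:E) /\
  Ex P (fun w => \prod_(i < n) f i (X i w))%R = (\prod_(i < n) Ex P (fun w => f i (X i w)))%R.
Proof.
elim: j => [_|j IH jn] f mf fi f0.
  have h : \int[P]_w (\prod_(i < n) f i (X i w))%:E =
      (\prod_(i < n) \int[P]_w f i (X i w))%:E.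
    apply: (@ge0_indep_prod n) => //; first by move=> i; exact: f0.
    by move=> i /andP[/leq_ltn_trans h /h]; rewrite ltnn.
  have mp : measurable_fun setT (fun w => (\prod_(i < n) f i (X i w))%R).
    by apply: measurable_prod => i _; exact: (measurableT_comp (mf i) (mX i)).
  split; last by rewrite /Ex /Rintegral h.
  apply/integrableP; split; first exact/measurable_EFinP.
  rewrite (eq_integral (fun w => (\prod_(i < n) f i (X i w))%:E)); first by rewrite h ltry.
  by move=> w _; rewrite gee0_abs// lee_fin; apply: prodr_ge0 => i _; exact: f0.
(* For [s = 1] and [s = -1] the factor [j] becomes its positive and its negative part. *)
pose f1 s i := if i == j then (fun x => Num.max (s * f i x) 0)%R else f i.
have mf1 s i : measurable_fun setT (f1 s i).
  rewrite /f1; case: ifPn => // _; apply: measurable_maxr => //.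
  exact: measurable_funM.
have f1n s i : i != j -> f1 s i = f i by rewrite /f1 => /negbTE ->.
have f1j s : f1 s j = (fun x => Num.max (s * f j x) 0)%R by rewrite /f1 eqxx.
have if1 s i : (`|s| = 1)%R -> P.-integrable setT (fun w => (f1 s i (X i w))%:E).
  move=> s1; have [->|ij] := eqVneq i j; last by rewrite f1n.
  rewrite f1j; apply: (le_integrable measurableT _ _ (fi j)).
    by apply/measurable_EFinP; have := mfX (mf1 s j); rewrite f1j.
  move=> w _; rewrite lee_fin; apply: (@le_trans _ _ `|s * f j (X j w)|)%R.
    by rewrite /Num.max; case: ifPn => // _; rewrite normr0.
  by rewrite normrM s1 mul1r.
have f1_ge0 s i : (j <= i)%N -> forall x, (0 <= f1 s i x)%R.
  move=> ji x; have [->|ij] := eqVneq i j; first by rewrite f1j le_max lexx orbT.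
  by rewrite f1n// f0// ltn_neqAle eq_sym ij.
have s1 : (`|1%R : R| = 1)%R by rewrite normr1.
have s2 : (`|- 1%R : R| = 1)%R by rewrite normrN1.
have [i1 E1] := IH (ltnW jn) _ (mf1 1%R) (fun i => if1 _ i s1) (f1_ge0 1%R).
have [i2 E2] := IH (ltnW jn) _ (mf1 (- 1)%R) (fun i => if1 _ i s2) (f1_ge0 (- 1)%R).
have fE x : (f j x = f1 1 j x - f1 (- 1) j x)%R.
  rewrite !f1j mul1r mulN1r; have [h|h] := lerP 0%R (f j x).
    by rewrite max_r ?oppr_le0// subr0.
  by rewrite max_l ?oppr_ge0 ?(ltW h)// sub0r opprK.
have sp (F : nat -> R) : (\prod_(i < n) F i =
    F j * \prod_(i < n | i != Ordinal jn) F i)%R by rewrite (bigD1 (Ordinal jn)).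
have spE (F G : nat -> R) : (forall i, i != j -> F i = G i) ->
    (\prod_(i < n | i != Ordinal jn) F i = \prod_(i < n | i != Ordinal jn) G i)%R.
  by move=> FG; apply: eq_bigr => i ij; apply: FG; rewrite -(inj_eq val_inj) in ij.
have E w : (\prod_(i < n) f i (X i w) =
    \prod_(i < n) f1 1 i (X i w) - \prod_(i < n) f1 (- 1) i (X i w))%R.
  rewrite (sp (fun i => f i (X i w))) (sp (fun i => f1 1 i (X i w)))%R.
  rewrite (sp (fun i => f1 (- 1) i (X i w)))%R fE mulrBl.
  rewrite (@spE (fun i => f1 1 i (X i w)) (fun i => f i (X i w)))%R.
    rewrite (@spE (fun i => f1 (- 1) i (X i w)) (fun i => f i (X i w)))%R//.
    by move=> i ij; rewrite f1n.
  by move=> i ij; rewrite f1n.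
rewrite (_ : (fun w => (\prod_(i < n) f i (X i w))%:E) = (fun w =>
    (\prod_(i < n) f1 1 i (X i w))%:E - (\prod_(i < n) f1 (- 1) i (X i w))%:E)); last first.
  by apply/funext => w; rewrite E EFinB.
split; first exact: integrableB.
rewrite (_ : (fun w => _)%R = (fun w =>
    \prod_(i < n) f1 1 i (X i w) - \prod_(i < n) f1 (- 1) i (X i w)))%R; last first.
  by apply/funext => w; rewrite E.
rewrite {1}/Ex RintegralB//.
transitivity (Ex P (fun w => \prod_(i < n) f1 1 i (X i w)) -
  Ex P (fun w => \prod_(i < n) f1 (- 1) i (X i w)))%R; first by [].
rewrite E1 E2 (sp (fun i => Ex P (fun w => f i (X i w)))).
rewrite (sp (fun i => Ex P (fun w => f1 1 i (X i w))))%R.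
rewrite (sp (fun i => Ex P (fun w => f1 (- 1) i (X i w))))%R.
have -> : (Ex P (fun w => f j (X j w)) = Ex P (fun w => f1 1 j (X j w)) -
    Ex P (fun w => f1 (- 1) j (X j w)))%R.
  rewrite /Ex -RintegralB//; [|exact: if1|exact: if1].
  by apply: eq_Rintegral => w _; rewrite fE.
rewrite mulrBl.
rewrite (@spE (fun i => Ex P (fun w => f1 1 i (X i w))) (fun i => Ex P (fun w => f i (X i w))))%R.
  rewrite (@spE (fun i => Ex P (fun w => f1 (- 1) i (X i w))) (fun i => Ex P (fun w => f i (X i w))))%R//.
  by move=> i ij; rewrite f1n.
by move=> i ij; rewrite f1n.
Qed.

Lemma Ex_indep_prod (f : nat -> R -> R) :
  (forall i, measurable_fun setT (f i)) ->
  (forall i, P.-integrable setT (fun w => (f i (X i w))%:E)) ->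
  Ex P (fun w => \prod_(i < n) f i (X i w))%R =
  (\prod_(i < n) Ex P (fun w => f i (X i w)))%R.
Proof.
move=> mf fi.
(* [indep_prod] asks for nonnegative functions from index [n] on; replacing those by 0 leaves the
   product over [i < n] unchanged. *)
pose f' i := if (i < n)%N then f i else cst 0%R.
have f'i (i : 'I_n) : f' i = f i by rewrite /f' ltn_ord.
have [] := @indep_prod n (leqnn n) f'.
- by move=> i; rewrite /f'; case: ifPn => // _; exact: measurable_cst.
- move=> i; rewrite /f'; case: ifPn => // _.
  exact: (finite_measure_integrable_cst P 0).
- by move=> i; rewrite /f' leqNgt => /negbTE ->.
move=> _; under eq_Ex do under eq_bigr do rewrite f'i.
by move=> ->; apply: eq_bigr => i _; rewrite f'i.
Qed.

End independence.

(** * Isserlis' formula for linear forms in independent Gaussian variables *)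

Section words.
Variables (R : realType) (I : finType).
Implicit Types (s : seq I) (v : I -> R).

Definition rem_at A j (s : seq A) := take j s ++ drop j.+1 s.

Lemma size_rem_at A j (s : seq A) : (j < size s)%N -> (size (rem_at j s)).+1 = size s.
Proof. by move=> js; rewrite /rem_at size_cat size_takel ?size_drop ?(ltnW js)//; lia. Qed.

Lemma count_rem_at s j x0 a : (j < size s)%N ->
  count_mem a s = ((nth x0 s j == a) + count_mem a (rem_at j s))%N.
Proof.
move=> js; rewrite -{1}(cat_take_drop j s) (drop_nth x0 js) !count_cat/=.
by rewrite eq_sym; lia.
Qed.

(** The expectation of the monomial with letters [s] in independent centered normal variables of
    variances [v]. *)
Definition word_moment v s : R :=
  \prod_(i : I) gaussian_moment (v i) (count_mem i s).

Lemma gaussian_momentS (c : R) n :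
  gaussian_moment c n.+1 = n%:R * (c * gaussian_moment c n.-1).
Proof. by case: n => [|n] /=; rewrite ?mul0r// mulrA. Qed.

(** Gaussian integration by parts, [E [X_k F] = v_k E [d_k F]], for a monomial [F]: differentiation
    deletes one occurrence of the letter [k] at a time. *)
Lemma word_moment_cons v x0 k s : word_moment v (k :: s) =
  \sum_(j < size s) (nth x0 s j == k)%:R * v k * word_moment v (rem_at j s).
Proof.
pose D := gaussian_moment (v k) (count_mem k s).-1 *
  \prod_(i | i != k) gaussian_moment (v i) (count_mem i s).
transitivity (\sum_(j < size s) (nth x0 s j == k)%:R * v k * D); last first.
  apply: eq_bigr => j _; have [jk|] := eqVneq (nth x0 s j) k; last by rewrite !mul0r.
  rewrite !mul1r; congr (_ * _); rewrite /word_moment (bigD1 k)//=.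
  rewrite /D (count_rem_at x0 k (ltn_ord j)) jk eqxx add1n/=; congr (_ * _).
  apply: eq_bigr => i ik; rewrite (count_rem_at x0 i (ltn_ord j)) jk.
  by rewrite eq_sym (negbTE ik).
under eq_bigr do rewrite -mulrA.
rewrite -mulr_suml -natr_sum.
have -> : (\sum_(j < size s) (nth x0 s j == k))%N = count_mem k s.
  by rewrite -(big_mkord xpredT (fun j => (nth x0 s j == k) : nat))
    -(big_nth x0 xpredT (fun x => (x == k) : nat)) -sum1_count [RHS]big_mkcond;
    apply: eq_bigr => x _ /=; case: eqP.
rewrite /word_moment (bigD1 k)//= eqxx add1n gaussian_momentS /D -!mulrA.
congr (_ * (_ * (_ * _))); apply: eq_bigr => i ik.
by rewrite eq_sym (negbTE ik).
Qed.

(** Multilinear extension of a function of words: a product of linear forms with coefficient vectors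
    [vs] is expanded into words, each weighted by the product of its coefficients. *)
Fixpoint ext (vs : seq (I -> R)) (F : seq I -> R) : R :=
  if vs is v :: vs' then \sum_k v k * ext vs' (fun s => F (k :: s)) else F [::].

Lemma eq_ext vs F G : (forall s, size s = size vs -> F s = G s) -> ext vs F = ext vs G.
Proof.
elim: vs F G => [|v vs IH] F G FG /=; first exact: FG.
by apply: eq_bigr => k _; congr (_ * _); apply: IH => s ss; apply: FG; rewrite /= ss.
Qed.

Lemma ext_sum (J : Type) (r : seq J) vs (F : J -> seq I -> R) :
  ext vs (fun s => \sum_(j <- r) F j s) = \sum_(j <- r) ext vs (F j).
Proof.
elim: vs F => [//|v vs IH] F /=; rewrite exchange_big/=.
by apply: eq_bigr => k _; rewrite IH mulr_sumr.
Qed.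

Lemma extZ vs (c : R) F : ext vs (fun s => c * F s) = c * ext vs F.
Proof.
elim: vs F => [//|v vs IH] F /=; rewrite mulr_sumr.
by apply: eq_bigr => k _; rewrite IH mulrCA.
Qed.

Lemma ext_rem_at vs x0 v0 j (u : I -> R) G : (j < size vs)%N ->
  ext vs (fun s => u (nth x0 s j) * G (rem_at j s)) =
  (\sum_l u l * nth v0 vs j l) * ext (rem_at j vs) G.
Proof.
elim: vs j G => [//|v vs IH] [|j] G /= js.
  rewrite mulr_suml; apply: eq_bigr => k _.
  rewrite /rem_at /= !drop0 extZ mulrA (mulrC (v k)); congr (_ * _).
  by apply: eq_ext => s _; rewrite drop0.
rewrite mulr_sumr; apply: eq_bigr => k _.
by rewrite (IH _ (fun s => G (k :: s)) js) mulrCA.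
Qed.

(** Integration by parts made multilinear: the first form is contracted with each of the others in
    turn, and the contraction of two forms is their covariance. *)
Lemma ext_word_moment v a vs v0 : ext (a :: vs) (word_moment v) =
  \sum_(j < size vs) (\sum_k v k * a k * nth v0 vs j k) * ext (rem_at j vs) (word_moment v).
Proof.
rewrite /=.
(* An empty alphabet offers no default letter for [nth]; in that case all covariances are empty
   sums. *)
have [I0|/card_gt0P[x0 _]] := posnP #|I|.
  have empty (F : I -> R) : \sum_k F k = 0.
    by rewrite big1// => k; have := card0_eq I0 k.
  by rewrite empty big1 // => j _; rewrite empty mul0r.
under eq_bigr => k _ do rewrite (eq_ext (fun s _ => word_moment_cons v x0 k s)).
under eq_bigr => k _.
  rewrite (eq_ext (G := fun s => \sum_(j < size vs) ((nth x0 s j == k)%:R * v k) * word_moment v (rem_at j s))); last by move=> s ->.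
  rewrite ext_sum mulr_sumr.
  over.
rewrite exchange_big/=; apply: eq_bigr => j _; rewrite mulr_suml.
apply: eq_bigr => k _.
rewrite (ext_rem_at x0 v0 (fun l => (l == k)%:R * v k))//.
rewrite (bigD1 k)//= eqxx mul1r big1 ?addr0; last first.
  by move=> l /negbTE ->; rewrite !mul0r.
by rewrite mulrA mulrA (mulrC (a k)).
Qed.

End words.

(** A sum by structural recursion, so that [isserlis] applied to an explicit list of indices
    simplifies to a polynomial that [ring] can treat. *)
Fixpoint sumr (R : realType) (f : nat -> R) m : R :=
  if m is m'.+1 then sumr f m' + f m' else 0.

Lemma sumrE (R : realType) (f : nat -> R) m : sumr f m = \sum_(j < m) f j.
Proof. by elim: m => [|m IH]; rewrite ?big_ord0// big_ord_recr/= IH. Qed.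

(* Isserlis' (Wick's) recursion for the mixed moments of centered Gaussian
   variables with covariance c, listed by l; the number n is only fuel. *)
Fixpoint isserlis (R : realType) (c : nat -> nat -> R) n (l : seq nat) : R :=
  match n, l with
  | n'.+1, i :: t => sumr (fun j => c i (nth 0%N t j) * isserlis c n' (rem_at j t)) (size t)
  | _, [::] => 1
  | 0, _ => 0
  end.

Section gaussian_vector.
Context d (T : measurableType d) (R : realType) (P : probability T R).
Variables (X : nat -> T -> R) (n : nat) (v : 'I_n -> R).
Hypothesis fX : forall i, finite_moments P (X i).
Hypothesis indX : forall B : nat -> set R, (forall i, measurable (B i)) ->
  (P (\bigcap_(i < n) (X i @^-1` B i)) = \prod_(i < n) P (X i @^-1` B i))%E.
Hypothesis momX : forall (i : 'I_n) m, Ex P (fun w => X i w ^+ m) = gaussian_moment (v i) m.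

Lemma Ex_word (s : seq 'I_n) : Ex P (fun w => \prod_(k <- s) X k w) = word_moment v s.
Proof.
have E w : \prod_(k <- s) X k w = \prod_(i < n) X i w ^+ count (fun k : 'I_n => val k == i) s.
  elim: s => [|k s IH]; first by rewrite big_nil big1.
  rewrite big_cons IH (bigD1 k)//= [RHS](bigD1 k)//= eqxx add1n exprS mulrA.
  congr (_ * _); apply: eq_bigr => i ik.
  by rewrite -(inj_eq val_inj) eq_sym in ik; rewrite (negbTE ik).
under eq_Ex do rewrite E.
rewrite (@Ex_indep_prod _ _ _ P X n _ indX
  (fun i x => x ^+ count (fun k : 'I_n => val k == i) s)).
- by apply: eq_bigr => i _; rewrite momX.
- by move=> i; have [] := fX i.
- by move=> i; exact: measurable_funX.
- by move=> i; apply: finite_moments_integrable; exact: finite_momentsX.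
Qed.

Definition lin (a : 'I_n -> R) w : R := \sum_k a k * X k w.

Lemma finite_moments_lin a : finite_moments P (lin a).
Proof. by apply: finite_moments_sum => k; exact: finite_momentsZ. Qed.

Lemma Ex_lin_ext vs : Ex P (fun w => \prod_(a <- vs) lin a w) = ext vs (word_moment v).
Proof.
(* The word [s0] collects the letters already chosen while the linear forms are expanded one after
   the other. *)
suff H s0 : Ex P (fun w => (\prod_(k <- s0) X (k : 'I_n) w) * \prod_(a <- vs) lin a w) =
    ext vs (fun s => word_moment v (s0 ++ s)).
  by rewrite -(H [::]); apply: eq_Ex => w; rewrite big_nil mul1r.
elim: vs s0 => [|a vs IH] s0 /=.
  by rewrite cats0 -Ex_word; apply: eq_Ex => w; rewrite big_nil mulr1.
have E w : (\prod_(k <- s0) X (k : 'I_n) w) * \prod_(b <- a :: vs) lin b w =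
    \sum_k a k * ((\prod_(l <- rcons s0 k) X (l : 'I_n) w) * \prod_(b <- vs) lin b w).
  rewrite big_cons {1}/lin mulr_suml mulr_sumr; apply: eq_bigr => k _.
  by rewrite -cats1 big_cat big_seq1/=; ring.
under eq_Ex do rewrite E.
have f1 k : finite_moments P (fun w => (\prod_(l <- rcons s0 k) X (l : 'I_n) w) * \prod_(b <- vs) lin b w).
  apply: finite_momentsM; apply: finite_moments_prod => // b.
  exact: finite_moments_lin.
rewrite Ex_sum; last by move=> k; exact: finite_momentsZ.
apply: eq_bigr => k _; rewrite ExZ// IH.
by congr (_ * _); apply: eq_ext => s _; rewrite cat_rcons.
Qed.

Lemma Ex_isserlis (G : nat -> 'I_n -> R) (l : seq nat) :
  Ex P (fun w => \prod_(i <- l) lin (G i) w) =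
  isserlis (fun i j => \sum_k v k * G i k * G j k) (size l) l.
Proof.
transitivity (ext (map G l) (word_moment v)).
  by rewrite -Ex_lin_ext; apply: eq_Ex => w; rewrite big_map.
have := leqnn (size l); move: {2 3}(size l) => m.
elim: m l => [|m IH] [|i l]//= lm.
- by rewrite /word_moment big1.
- by rewrite /word_moment big1.
rewrite sumrE; transitivity (ext (G i :: map G l) (word_moment v)); first by [].
rewrite (ext_word_moment v (G i) (map G l) (G 0%N)) size_map.
apply: eq_bigr => j _; rewrite (nth_map 0%N)//; congr (_ * _).
rewrite -IH; last by rewrite -ltnS size_rem_at// ltnW.
by rewrite /rem_at map_cat map_take map_drop.
Qed.

Section wick_squares.
Variable G : nat -> 'I_n -> R.
Let g i := lin (G i).
Let c i j := \sum_k v k * G i k * G j k.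
Let cC i j : c i j = c j i.
Proof. by apply: eq_bigr => k _; rewrite mulrAC. Qed.

Lemma Ex_words (l : seq (R * seq nat)) :
  Ex P (fun w => \sum_(p <- l) p.1 * \prod_(i <- p.2) g i w) =
  \sum_(p <- l) p.1 * isserlis c (size p.2) p.2.
Proof.
have fw s : finite_moments P (fun w => \prod_(i <- s) g i w).
  by apply: finite_moments_prod => i; exact: finite_moments_lin.
rewrite Ex_sum; last by move=> p; exact: finite_momentsZ.
by apply: eq_bigr => p _; rewrite ExZ// Ex_isserlis.
Qed.

(** Centering the squares removes every pairing of an index with itself, so only cycles through at
    least two indices survive. Here and in the next two lemmas a cycle through [m] given indices in
    a given cyclic order has weight 2, 8 or 16 for [m] equal to 2, 3 or 4, and disjoint cycles
    multiply. The product is first expanded into plain words, to which Isserlis' recursion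
    applies. *)
Lemma Ex_wick2 : Ex P (fun w => (g 0 w ^+ 2 - c 0 0) * (g 1 w ^+ 2 - c 1 1)) = 2 * c 0 1 ^+ 2.
Proof.
transitivity (Ex P (fun w => \sum_(p <- [:: (1, [:: 0; 0; 1; 1]%N); (- c 1 1, [:: 0; 0]%N);
   (- c 0 0, [:: 1; 1]%N); (c 0 0 * c 1 1, [::])]) p.1 * \prod_(i <- p.2) g i w)).
  by apply: eq_Ex => w; rewrite ?(big_cons, big_nil)/= ?(big_cons, big_nil); ring.
rewrite Ex_words ?(big_cons, big_nil)/=; ring.
Qed.

Lemma Ex_wick3 : Ex P (fun w => (g 0 w ^+ 2 - c 0 0) * (g 1 w ^+ 2 - c 1 1) *
  (g 2 w ^+ 2 - c 2 2)) = 8 * c 0 1 * c 1 2 * c 2 0.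
Proof.
transitivity (Ex P (fun w => \sum_(p <- [:: (1, [:: 0; 0; 1; 1; 2; 2]%N);
   (- c 2 2, [:: 0; 0; 1; 1]%N); (- c 1 1, [:: 0; 0; 2; 2]%N); (- c 0 0, [:: 1; 1; 2; 2]%N);
   (c 1 1 * c 2 2, [:: 0; 0]%N); (c 0 0 * c 2 2, [:: 1; 1]%N); (c 0 0 * c 1 1, [:: 2; 2]%N);
   (- (c 0 0 * c 1 1 * c 2 2), [::])]) p.1 * \prod_(i <- p.2) g i w)).
  by apply: eq_Ex => w; rewrite ?(big_cons, big_nil)/= ?(big_cons, big_nil); ring.
rewrite Ex_words ?(big_cons, big_nil)/= (cC 2 0); ring.
Qed.

Lemma Ex_wick4 : Ex P (fun w => (g 0 w ^+ 2 - c 0 0) * (g 1 w ^+ 2 - c 1 1) *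
  (g 2 w ^+ 2 - c 2 2) * (g 3 w ^+ 2 - c 3 3)) =
  4 * (c 0 1 ^+ 2 * c 2 3 ^+ 2 + c 0 2 ^+ 2 * c 1 3 ^+ 2 + c 0 3 ^+ 2 * c 1 2 ^+ 2) +
  16 * (c 0 1 * c 1 2 * c 2 3 * c 3 0 + c 0 1 * c 1 3 * c 3 2 * c 2 0 +
        c 0 2 * c 2 1 * c 1 3 * c 3 0).
Proof.
transitivity (Ex P (fun w => \sum_(p <- [:: (1, [:: 0; 0; 1; 1; 2; 2; 3; 3]%N);
   (- c 3 3, [:: 0; 0; 1; 1; 2; 2]%N); (- c 2 2, [:: 0; 0; 1; 1; 3; 3]%N);
   (- c 1 1, [:: 0; 0; 2; 2; 3; 3]%N); (- c 0 0, [:: 1; 1; 2; 2; 3; 3]%N);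
   (c 2 2 * c 3 3, [:: 0; 0; 1; 1]%N); (c 1 1 * c 3 3, [:: 0; 0; 2; 2]%N);
   (c 1 1 * c 2 2, [:: 0; 0; 3; 3]%N); (c 0 0 * c 3 3, [:: 1; 1; 2; 2]%N);
   (c 0 0 * c 2 2, [:: 1; 1; 3; 3]%N); (c 0 0 * c 1 1, [:: 2; 2; 3; 3]%N);
   (- (c 1 1 * c 2 2 * c 3 3), [:: 0; 0]%N); (- (c 0 0 * c 2 2 * c 3 3), [:: 1; 1]%N);
   (- (c 0 0 * c 1 1 * c 3 3), [:: 2; 2]%N); (- (c 0 0 * c 1 1 * c 2 2), [:: 3; 3]%N);
   (c 0 0 * c 1 1 * c 2 2 * c 3 3, [::])]) p.1 * \prod_(i <- p.2) g i w)).
  by apply: eq_Ex => w; rewrite ?(big_cons, big_nil)/= ?(big_cons, big_nil); ring.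
rewrite Ex_words ?(big_cons, big_nil)/= (cC 2 0) (cC 2 1) (cC 3 0) (cC 3 2).
ring.
Qed.

End wick_squares.
End gaussian_vector.

(** * Increments of the Wiener process and step kernels *)

Section law.
Context d (T : measurableType d) (R : realType) (P : probability T R).
Variables (Y : T -> R) (s : R).
Hypothesis mY : measurable_fun setT Y.
Hypothesis lawY : forall B, measurable B -> P (Y @^-1` B) = normal_prob 0 s B.
Local Open Scope ereal_scope.

Let ge0_integral_law (f : R -> \bar R) : (forall x, 0 <= f x) -> measurable_fun setT f ->
  \int[P]_w f (Y w) = \int[normal_prob 0%R s]_x f x.
Proof.
move=> f0 mf.
have := @ge0_integral_pushforward _ _ _ (measurableTypeR R) _ Y mY P setT f measurableT mf (fun x _ => f0 x).
rewrite preimage_setT => <-.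
have := @eq_measure_integral _ _ _ setT (normal_prob 0%R s)
  (pushforward P (Y : T -> measurableTypeR R)) f.
move=> /(_ mY) h; apply: h => B mB _.
exact: lawY.
Qed.

Lemma integral_law (f : R -> R) : measurable_fun setT f ->
  \int[P]_w (f (Y w))%:E = \int[lebesgue_measure]_x (f x * normal_pdf 0 s x)%:E.
Proof.
move=> mf.
have mf' : measurable_fun setT (EFin \o f) by exact/measurable_EFinP.
rewrite -(@integral_density _ _ _ lebesgue_measure (normal_prob 0%R s)); last 4 first.
- by move=> x; exact: normal_pdf_ge0.
- exact: measurable_normal_pdf.
- by [].
- exact: mf.
rewrite [LHS]integralE [RHS]integralE; congr (_ - _).
  transitivity (\int[P]_w ((EFin \o f)^\+ (Y w))).
    by apply: eq_integral => w _; rewrite !funeposE.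
  rewrite ge0_integral_law//; last exact: measurable_funepos.
transitivity (\int[P]_w ((EFin \o f)^\- (Y w))).
    by apply: eq_integral => w _; rewrite !funenegE.
  rewrite ge0_integral_law//; last exact: measurable_funeneg.
Qed.

Hypothesis s0 : (0 < s)%R.

Lemma finite_moments_normal : finite_moments P Y.
Proof.
have i2 n : P.-integrable setT (fun w => (`|Y w| ^+ (2 * n))%:E).
  have mx : measurable_fun setT (fun x : R => (`|x| ^+ (2 * n))%R).
    by apply: measurable_funX.
  apply/integrableP; split.
    by apply/measurable_EFinP; exact: (measurableT_comp mx mY).
  under eq_integral do rewrite gee0_abs ?lee_fin ?exprn_ge0//.
  rewrite (integral_law mx).
  have [+ _] := normal_moment (2 * n) s0.
  move=> /integrableP[_].
  apply: le_lt_trans.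
  rewrite le_eqVlt; apply/orP; left; apply/eqP; apply: eq_integral => x _.
  rewrite gee0_abs ?lee_fin; last by rewrite mulr_ge0 ?normal_pdf_ge0// exprM exprn_ge0 ?sqr_ge0.
  by rewrite exprM real_normK ?num_real// -exprM.
(* Only even moments were computed; the others follow from [|y|^n <= 1 + |y|^(2n)], the constant 1
   being written as the power [2 * 0]. *)
apply: (@finite_moments_le _ _ _ _ _ (fun n w => `|Y w| ^+ (2 * 0) + `|Y w| ^+ (2 * n))%R) => //.
  by move=> n; rewrite /comp; under eq_fun do rewrite EFinD; apply: integrableD (i2 0%N) (i2 n).
move=> n w; rewrite muln0 expr0.
have [x1|x1] := lerP `|Y w|%R 1%R.
  by apply: (@le_trans _ _ 1%R); rewrite ?exprn_ile1// lerDl exprn_ge0.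
rewrite (@le_trans _ _ (`|Y w| ^+ (2 * n)))%R ?lerDr//.
by apply: ler_weXn2l; [exact: ltW|lia].
Qed.

Lemma Ex_normal_moment n : Ex P (fun w => Y w ^+ n)%R = gaussian_moment (s ^+ 2) n.
Proof.
rewrite /Ex /Rintegral (@integral_law (fun x => x ^+ n)%R); last exact: measurable_funX.
by have [_ ->] := normal_moment n s0.
Qed.

End law.

Section wiener_increments.
Context d (T : measurableType d) (R : realType) (P : probability T R).
Variable W : I01 R -> T -> R.
Hypothesis wW : standard_wiener_process P W.

Lemma measurable_incr s t : measurable_fun setT (incr W s t).
Proof. by case: wW => mW _ _ _ _; exact: measurable_funB. Qed.

Lemma incr0 s t : \val s = \val t -> incr W s t = cst 0.
Proof. by move=> /val_inj ->; apply/funext => w; rewrite /incr subrr. Qed.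

Lemma incr_moments (s t : I01 R) : \val s <= \val t ->
  finite_moments P (incr W s t) /\
  forall n, Ex P (fun w => incr W s t w ^+ n) = gaussian_moment (\val t - \val s) n.
Proof.
rewrite le_eqVlt => /predU1P[st|st].
  rewrite (incr0 st) st subrr; split=> [|n]; first exact: finite_moments_cst.
  rewrite (@eq_Ex _ _ _ _ _ (cst (0 ^+ n)))// Ex_cst.
  by case: n => [|[|n]]; rewrite ?expr0// ?expr1// exprS mul0r /= mulr0 mul0r.
have [_ _ _ gW _] := wW.
have ts : 0 < Num.sqrt (\val t - \val s) by rewrite sqrtr_gt0 subr_gt0.
have lawst B : measurable B -> P (incr W s t @^-1` B) = normal_prob 0 (Num.sqrt (\val t - \val s)) B.
  exact: gW.
split; first exact: (finite_moments_normal (@measurable_incr s t) lawst ts).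
move=> n; rewrite (Ex_normal_moment (@measurable_incr s t) lawst ts) sqr_sqrtr//.
by rewrite subr_ge0 ltW.
Qed.

Section nodes.
Variables (t : nat -> I01 R) (n : nat).
Hypothesis tP : forall i j, (i <= j)%N -> \val (t i) <= \val (t j).

Definition dW i := incr W (t i) (t i.+1).
Definition dt i : R := \val (t i.+1) - \val (t i).

Lemma dt_ge0 i : 0 <= dt i. Proof. by rewrite subr_ge0 tP. Qed.

Lemma finite_moments_dW i : finite_moments P (dW i).
Proof. by have [] := @incr_moments (t i) (t i.+1) (tP (leqnSn i)). Qed.

Lemma Ex_dW (i : 'I_n) m : Ex P (fun w => dW i w ^+ m) = gaussian_moment (dt i) m.
Proof. by have [_] := @incr_moments (t i) (t i.+1) (tP (leqnSn i)). Qed.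

Lemma indep_dW (B : nat -> set R) : (forall i, measurable (B i)) ->
  (P (\bigcap_(i < n) (dW i @^-1` B i)) = \prod_(i < n) P (dW i @^-1` B i))%E.
Proof. by case: wW => _ _ iW _ _; exact: iW. Qed.

(** Isserlis' formula gives [\sum (c k l^2 + c k l c l k) dt k dt l], since the pairing inside one
    product meets the zero diagonal. The coefficients may be asymmetric, so the mixed term is
    bounded by the mean of the squares, whence the factor 2. *)
Lemma Ex_offdiag_sqr_le (c : 'I_n -> 'I_n -> R) : (forall k, c k k = 0) ->
  Ex P (fun w => (\sum_k \sum_l c k l * dW k w * dW l w) ^+ 2) <=
  2 * \sum_k \sum_l c k l ^+ 2 * dt k * dt l.
Proof.
move=> c0.
(* [dd k l] is the covariance of the increments [k] and [l]. *)
pose dd k l : R := (k == l :> 'I_n)%:R * dt k.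
have ddE (f : 'I_n -> R) k : \sum_p dd k p * f p = dt k * f k.
  rewrite (bigD1 k)//= /dd eqxx mul1r big1 ?addr0// => p pk.
  by rewrite eq_sym (negbTE pk) !mul0r.
have E4 (k l p q : 'I_n) : Ex P (fun w => (dW k w * dW l w) * (dW p w * dW q w)) =
    dd k l * dd p q + dd k p * dd l q + dd k q * dd l p.
  pose e i (m : 'I_n) : R := (m == nth k [:: k; l; p; q] i)%:R.
  have le i w : lin dW (e i) w = dW (nth k [:: k; l; p; q] i) w.
    rewrite /lin (bigD1 (nth k [:: k; l; p; q] i))//= /e eqxx mul1r big1 ?addr0//.
    by move=> m /negbTE ->; rewrite mul0r.
  pose u := nth k [:: k; l; p; q].
  have ce : (fun i j => \sum_(m < n) dt m * e i m * e j m) = (fun i j => dd (u i) (u j)).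
    apply/funext => i; apply/funext => j.
    rewrite (bigD1 (u i))//= big1; last first.
      by move=> m /negbTE h; rewrite /e -/(u i) h mulr0 mul0r.
    by rewrite addr0 /e -/u eqxx mulr1 mulrC.
  have := Ex_isserlis finite_moments_dW indep_dW Ex_dW e [:: 0; 1; 2; 3]%N.
  rewrite ce => E; transitivity (Ex P (fun w => \prod_(i <- [:: 0; 1; 2; 3]%N) lin dW (e i) w)).
    by apply: eq_Ex => w; rewrite !(big_cons, big_nil) !le/=; ring.
  by rewrite E /=; ring.
pose F (x : 'I_n * 'I_n) w := c x.1 x.2 * (dW x.1 w * dW x.2 w).
have fF x : finite_moments P (F x).
  by apply: finite_momentsZ; apply: finite_momentsM; exact: finite_moments_dW.
have -> : Ex P (fun w => (\sum_k \sum_l c k l * dW k w * dW l w) ^+ 2) =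
    \sum_x \sum_y Ex P (fun w => F x w * F y w).
  transitivity (Ex P (fun w => \sum_x \sum_y F x w * F y w)).
    apply: eq_Ex => w; rewrite pair_bigA/= expr2 big_distrlr/=.
    by apply: eq_bigr => x _; apply: eq_bigr => y _; rewrite /F -!mulrA.
  rewrite Ex_sum; last by move=> x; apply: finite_moments_sum => y; exact: finite_momentsM.
  by apply: eq_bigr => x _; rewrite Ex_sum// => y; exact: finite_momentsM.
have EF x y : Ex P (fun w => F x w * F y w) = c x.1 x.2 * c y.1 y.2 *
   (dd x.1 x.2 * dd y.1 y.2 + dd x.1 y.1 * dd x.2 y.2 + dd x.1 y.2 * dd x.2 y.1).
  rewrite -E4 -ExZ; first by apply: eq_Ex => w; rewrite /F; ring.
  by do ! apply: finite_momentsM; exact: finite_moments_dW.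
have inner x : \sum_y Ex P (fun w => F x w * F y w) =
    (c x.1 x.2 ^+ 2 + c x.1 x.2 * c x.2 x.1) * (dt x.1 * dt x.2).
  under eq_bigr => y _ do rewrite EF.
  have cd k l : c k l * dd k l = 0.
    by rewrite /dd; case: eqP => [->|_]; rewrite ?c0 ?mul0r ?mulr0.
  rewrite -(pair_bigA _ (fun p q => c x.1 x.2 * c p q * (dd x.1 x.2 * dd p q +
    dd x.1 p * dd x.2 q + dd x.1 q * dd x.2 p)))/=.
  transitivity (\sum_p dd x.1 p * (\sum_q dd x.2 q * (c x.1 x.2 * c p q)) +
      \sum_p dd x.2 p * (\sum_q dd x.1 q * (c x.1 x.2 * c p q))).
    rewrite -big_split/=; apply: eq_bigr => p _; rewrite !mulr_sumr -big_split/=.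
    apply: eq_bigr => q _; rewrite !mulrDr mulrACA cd mul0r add0r; ring.
  under eq_bigr do rewrite ddE.
  under [X in _ + X]eq_bigr do rewrite ddE.
  by rewrite !ddE; ring.
under eq_bigr do rewrite inner.
rewrite -(pair_bigA _ (fun k l => (c k l ^+ 2 + c k l * c l k) * (dt k * dt l)))/=.
have S : \sum_k \sum_l c k l ^+ 2 * (dt k * dt l) = \sum_k \sum_l c l k ^+ 2 * (dt k * dt l).
  by rewrite exchange_big/=; apply: eq_bigr => k _; apply: eq_bigr => l _; rewrite (mulrC (dt k)).
apply: (@le_trans _ _ (\sum_k \sum_l (c k l ^+ 2 + (c k l ^+ 2 + c l k ^+ 2) / 2) * (dt k * dt l))).
  apply: ler_sum => k _; apply: ler_sum => l _.
  rewrite ler_wpM2r ?mulr_ge0 ?dt_ge0// lerD2l.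
  by have := sqr_ge0 (c k l - c l k); nra.
rewrite le_eqVlt; apply/orP; left; apply/eqP.
have -> : \sum_k \sum_l c k l ^+ 2 * dt k * dt l = \sum_k \sum_l c k l ^+ 2 * (dt k * dt l).
  by apply: eq_bigr => k _; apply: eq_bigr => l _; rewrite mulrA.
transitivity (\sum_k \sum_l c k l ^+ 2 * (dt k * dt l) +
  (\sum_k \sum_l c k l ^+ 2 * (dt k * dt l) + \sum_k \sum_l c l k ^+ 2 * (dt k * dt l)) / 2).
  rewrite -big_split/= mulr_suml -big_split/=; apply: eq_bigr => k _.
  rewrite -big_split/= mulr_suml -big_split/=; apply: eq_bigr => l _; by field.
by rewrite -S; field.
Qed.

End nodes.
End wiener_increments.

(** * Common refinements and the L2 bound for step integrals *)

Section refinement.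
Context (R : realType).
Variables (t : nat -> I01 R) (n : nat).
Hypothesis tP : forall i j, (i <= j)%N -> \val (t i) <= \val (t j).

Definition refines (s : step_kernel R) := forall i, (i <= sk_size s)%N ->
  exists2 p, (p <= n)%N & t p = sk_node s i.

Lemma mem_sk_cell (s : step_kernel R) i (x : R) :
  (x \in sk_cell s i) = (\val (sk_node s i) < x <= \val (sk_node s i.+1)).
Proof.
rewrite /sk_cell; apply/idP/idP => [/set_mem/=|h]; first by rewrite in_itv.
by apply/mem_set => /=; rewrite in_itv.
Qed.

(** Cells are open on the left and closed on the right, so a nonempty cell of the refinement lies in
    a cell of [s] exactly when its right end point does; empty cells carry a zero increment. *)
Lemma incr_refine d (T : measurableType d) (W : I01 R -> T -> R) (s : step_kernel R) i w : refines s ->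
  (i < sk_size s)%N ->
  incr W (sk_node s i) (sk_node s i.+1) w =
  \sum_(k < n) \1_(sk_cell s i) (\val (t k.+1)) * dW W t k w.
Proof.
move=> rs ilt; have [p pn tp] := rs i (ltnW ilt); have [q qn tq] := rs i.+1 ilt.
have pq : \val (t p) <= \val (t q) by rewrite tp tq sk_nodeP.
have E k : \1_(sk_cell s i) (\val (t k.+1)) * dW W t k w =
    (p <= k < q)%:R * dW W t k w.
  have [tk|] := eqVneq (\val (t k)) (\val (t k.+1)); first by rewrite /dW incr0// !mulr0.
  move=> tk; congr (_ * _).
  rewrite indicE mem_sk_cell -tp -tq.
  have tk' : \val (t k) < \val (t k.+1) by rewrite lt_neqAle tk tP.
  congr ((nat_of_bool _)%:R); congr andb.
    apply/idP/idP => [|pk]; last by exact: le_lt_trans (tP pk) tk'.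
    by rewrite ltNge => h; rewrite -ltnS ltnNge; apply: contra h; exact: tP.
  apply/idP/idP => [|kq]; last exact: tP.
  rewrite leNgt => h; rewrite ltnNge; apply: contra h => qk.
  exact: le_lt_trans (tP qk) tk'.
under eq_bigr do rewrite E.
rewrite -(big_mkord xpredT (fun k => (p <= k < q)%:R * dW W t k w)).
(* With repeated nodes the indices found for the two end points may come in the wrong order; the end
   points then coincide and both sides vanish. *)
have [qp|pq'] := ltnP q p.
  rewrite big1 => [|k _]; last first.
    rewrite (_ : (p <= k < q)%N = false) ?mul0r//; apply/negP => /andP[pk kq].
    by move: (leq_trans (leq_ltn_trans pk kq) (ltnW qp)); rewrite ltnn.
  have /le_anti h : \val (t p) <= \val (t q) <= \val (t p) by rewrite pq tP// ltnW.
  by rewrite /incr -tp -tq (val_inj h) subrr.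
rewrite (big_cat_nat (leq0n p) pn)//= big_nat_cond big1 ?add0r; last first.
  by move=> k; rewrite andbT => /andP[_ kp]; rewrite leqNgt kp mul0r.
rewrite (big_cat_nat pq' qn)//= [X in _ + X]big_nat_cond [X in _ + X]big1 ?addr0; last first.
  by move=> k; rewrite andbT => /andP[qk _]; rewrite (ltnNge k q) qk andbF mul0r.
rewrite big_nat_cond; under eq_bigr => k; [rewrite andbT => ->|]; rewrite ?mul1r; first by over.
rewrite -big_nat_cond /dW /incr telescope_sumr// tp tq//.
Qed.

Lemma step_integral_refine d (T : measurableType d) (W : I01 R -> T -> R) s w :
  refines s -> step_integral W s w =
  \sum_(k < n) \sum_(l < n)
    step_fun s (\val (t k.+1), \val (t l.+1)) * dW W t k w * dW W t l w.
Proof.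
move=> rs; rewrite /step_integral /step_fun /=.
transitivity (\sum_(i < sk_size s) \sum_(j < sk_size s | j != i)
  \sum_(k < n) \sum_(l < n) sk_coef s i j * \1_(sk_cell s i) (\val (t k.+1)) *
     \1_(sk_cell s j) (\val (t l.+1)) * dW W t k w * dW W t l w).
  apply: eq_bigr => i _; apply: eq_bigr => j _.
  rewrite !(incr_refine W w rs)// -mulrA big_distrlr/= mulr_sumr.
  apply: eq_bigr => k _; rewrite mulr_sumr; apply: eq_bigr => l _; ring.
etransitivity; first by apply: eq_bigr => i _; exact: exchange_big.
rewrite exchange_big/=.
apply: eq_bigr => k _.
etransitivity; first by apply: eq_bigr => i _; exact: exchange_big.
rewrite exchange_big/=.
apply: eq_bigr => l _; rewrite !mulr_suml; apply: eq_bigr => i _.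
by rewrite !mulr_suml.
Qed.

Lemma sk_cell_inj (s : step_kernel R) i j x :
  x \in sk_cell s i -> x \in sk_cell s j -> i = j.
Proof.
wlog ij : i j / (i <= j)%N => [wh|].
  by have [/wh|/ltnW/wh h xi xj] := leqP i j; [exact|rewrite h].
rewrite !mem_sk_cell => /andP[_ xi] /andP[xj _].
move: ij; rewrite leq_eqVlt => /predU1P[//|ij].
have := le_lt_trans (sk_nodeP s ij) xj.
by rewrite ltNge xi.
Qed.

Lemma step_fun_diag (s : step_kernel R) x : step_fun s (x, x) = 0.
Proof.
rewrite /step_fun big1// => i _; rewrite big1// => j ji /=.
rewrite !indicE; have [xi|_] := boolP (x \in sk_cell s i); last by rewrite mulr0 mul0r.
have [xj|_] := boolP (x \in sk_cell s j); last by rewrite mulr0.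
by case/negP: ji; apply/eqP/val_inj/esym; exact: sk_cell_inj xi xj.
Qed.

Definition node_cell k : set R := `]\val (t k), \val (t k.+1)].

Lemma mem_node_cell k (x : R) :
  (x \in node_cell k) = (\val (t k) < x <= \val (t k.+1)).
Proof.
rewrite /node_cell; apply/idP/idP => [/set_mem/=|h]; first by rewrite in_itv.
by apply/mem_set => /=; rewrite in_itv.
Qed.

Lemma sk_cell_node s i k x : refines s -> (i < sk_size s)%N -> x \in node_cell k ->
  (x \in sk_cell s i) = (\val (t k.+1) \in sk_cell s i).
Proof.
move=> rs ilt; have [p pn tp] := rs i (ltnW ilt); have [q qn tq] := rs i.+1 ilt.
rewrite mem_node_cell !mem_sk_cell -tp -tq => /andP[kx xk].
congr andb; apply/idP/idP => h.
- exact: lt_le_trans h xk.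
- have [pk|kp] := leqP p k; first exact: le_lt_trans (tP pk) kx.
  by move: h; rewrite ltNge tP.
- have [qk|kq] := leqP q k; last exact: tP.
  by move: (lt_le_trans kx h); rewrite ltNge tP.
- exact: le_trans xk h.
Qed.

Lemma step_fun_node s k l x y : refines s -> x \in node_cell k -> y \in node_cell l ->
  step_fun s (x, y) = step_fun s (\val (t k.+1), \val (t l.+1)).
Proof.
move=> rs xk yl; rewrite /step_fun; apply: eq_bigr => i _; apply: eq_bigr => j _ /=.
by rewrite !indicE (sk_cell_node rs (ltn_ord i) xk) (sk_cell_node rs (ltn_ord j) yl).
Qed.

Lemma node_cell_inj k l x : x \in node_cell k -> x \in node_cell l -> k = l.
Proof.
wlog kl : k l / (k <= l)%N => [wh|].
  by have [/wh|/ltnW/wh h xk xl] := leqP k l; [exact|rewrite h].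
rewrite !mem_node_cell => /andP[_ xk] /andP[xl _].
move: kl; rewrite leq_eqVlt => /predU1P[//|kl].
by have := le_lt_trans (tP kl) xl; rewrite ltNge xk.
Qed.

(** The cells are disjoint, so at most one term survives. It is an inequality because [z] may lie in
    no cell. *)
Lemma sum_node_cells (f : R * R -> R) (a : 'I_n -> 'I_n -> R) z :
  (forall k l : 'I_n, z.1 \in node_cell k -> z.2 \in node_cell l -> a k l = f z) ->
  \sum_k \sum_l a k l ^+ 2 * \1_(node_cell k) z.1 * \1_(node_cell l) z.2 <= f z ^+ 2.
Proof.
move=> af.
have [[k kz]|nk] := pselect (exists k : 'I_n, z.1 \in node_cell k); last first.
  rewrite big1 ?sqr_ge0// => k _; rewrite big1// => l _; rewrite !indicE.
  by case: (boolP (z.1 \in _)) => h; [exfalso; apply: nk; exists k|rewrite mulr0 mul0r].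
have [[l lz]|nl] := pselect (exists l : 'I_n, z.2 \in node_cell l); last first.
  rewrite big1 ?sqr_ge0// => k' _; rewrite big1// => l _; rewrite !indicE.
  by case: (boolP (z.2 \in _)) => h; [exfalso; apply: nl; exists l|rewrite mulr0].
rewrite (bigD1 k)//= [X in _ + X]big1 => [|k' k'k]; last first.
  rewrite big1// => l' _; rewrite !indicE; case: (boolP (z.1 \in node_cell k')) => h.
    by case/negP: k'k; apply/eqP/val_inj; exact: node_cell_inj h kz.
  by rewrite mulr0 mul0r.
rewrite (bigD1 l)//= [X in _ + X + _]big1 => [|l' l'l]; last first.
  rewrite !indicE; case: (boolP (z.2 \in node_cell l')) => h.
    by case/negP: l'l; apply/eqP/val_inj; exact: node_cell_inj h lz.
  by rewrite mulr0.
by rewrite !addr0 !indicE kz lz !mulr1 (af k l).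
Qed.

Lemma node_cell_measure k : lebesgue_measure (node_cell k) = (dt t k)%:E.
Proof.
rewrite /node_cell lebesgue_measure_itv/= lte_fin /dt.
case: ltP => [_|h]; first by rewrite EFinB.
have /le_anti -> : \val (t k) <= \val (t k.+1) <= \val (t k) by rewrite tP//=.
by rewrite subrr.
Qed.

Let mu := (@lebesgue_measure R).
Let D : set (R * R) := `[0%R, 1%R] `*` `[0%R, 1%R].

Let node_cellS k : node_cell k `<=` `[0%R, 1%R].
Proof.
move=> x /mem_set; rewrite mem_node_cell /= in_itv/= => /andP[kx xk].
have := set_mem (valP (t k)); have := set_mem (valP (t k.+1)).
rewrite /= !in_itv/= => /andP[_ h1] /andP[h0 _].
by rewrite (le_trans h0 (ltW kx)) (le_trans xk h1).
Qed.

Lemma integral_node_cells (a : 'I_n -> 'I_n -> R) :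
  (\int[mu \x mu]_(z in D)
    (\sum_k \sum_l a k l ^+ 2 * \1_(node_cell k) z.1 * \1_(node_cell l) z.2)%:E =
  (\sum_k \sum_l a k l ^+ 2 * dt t k * dt t l)%:E)%E.
Proof.
pose C (x : 'I_n * 'I_n) : set (R * R) := node_cell x.1 `*` node_cell x.2.
have mC x : measurable (C x) by apply: measurableX; exact: measurable_itv.
have mD : measurable D by apply: measurableX; exact: measurable_itv.
transitivity (\int[mu \x mu]_(z in D) \sum_x ((a x.1 x.2 ^+ 2)%:E * (\1_(C x) z)%:E))%E.
  apply: eq_integral => z _; rewrite pair_bigA/= -sumEFin; apply: eq_bigr => x _.
  by rewrite -EFinM -mulrA /C !indicE in_setX -natrM mulnb.
rewrite ge0_integral_sum//; last 2 first.
- move=> x; apply: emeasurable_funM; apply/measurable_EFinP; first exact: measurable_cst.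
  by apply: measurable_funTS; exact: (measurable_indic (mC x)).
- by move=> x z _; rewrite mule_ge0// lee_fin// sqr_ge0.
rewrite pair_bigA/= -sumEFin; apply: eq_bigr => x _.
rewrite ge0_integralZl//; last 2 first.
- by apply/measurable_EFinP; apply: measurable_funTS; exact: (measurable_indic (mC x)).
- by rewrite lee_fin sqr_ge0.
have CD : C x `&` D = C x.
  by apply: setIidl => z [h1 h2]; split; [exact: (@node_cellS _ _ h1)|exact: (@node_cellS _ _ h2)].
have -> : (\int[mu \x mu]_(z in D) (\1_(C x) z)%:E = (mu \x mu) (C x))%E.
  by rewrite integral_indic; [rewrite CD|exact: mD|exact: mC].
rewrite product_measure1E; try exact: measurable_itv.
transitivity ((a x.1 x.2 ^+ 2)%:E * ((dt t x.1)%:E * (dt t x.2)%:E))%E.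
  by congr (_ * (_ * _))%E; exact: node_cell_measure.
by rewrite -!EFinM mulrA.
Qed.

Lemma measurable_step_fun (s : step_kernel R) : measurable_fun setT (step_fun s).
Proof.
apply: measurable_sum => i; rewrite /step_fun.
under eq_fun do rewrite big_mkcond/=.
apply: measurable_sum => j; case: (j != i) => //.
apply: measurable_funM; first apply: measurable_funM => //.
- by apply: measurableT_comp => //; exact: measurable_indic (measurable_itv _).
- by apply: measurableT_comp => //; exact: measurable_indic (measurable_itv _).
Qed.

(** On a common refinement the difference of the two integrals is a single quadratic form whose
    coefficients are the values of the difference of the step functions; they vanish on the diagonal
    by [step_fun_diag]. *)
Lemma step_isometry_refined d (T : measurableType d) (P : probability T R)
    (W : I01 R -> T -> R) s1 s2 : standard_wiener_process P W ->
  refines s1 -> refines s2 ->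
  (\int[P]_w ((step_integral W s1 w - step_integral W s2 w) ^+ 2)%:E <=
   2%:E * \int[mu \x mu]_(z in D) ((step_fun s1 z - step_fun s2 z) ^+ 2)%:E)%E.
Proof.
move=> wW r1 r2.
pose c (k l : 'I_n) := step_fun s1 (\val (t k.+1), \val (t l.+1)) -
   step_fun s2 (\val (t k.+1), \val (t l.+1)).
have c0 k : c k k = 0 by rewrite /c !step_fun_diag subrr.
have E w : (step_integral W s1 w - step_integral W s2 w) ^+ 2 =
    (\sum_k \sum_l c k l * dW W t k w * dW W t l w) ^+ 2.
  rewrite !step_integral_refine// -sumrB; congr (_ ^+ 2); apply: eq_bigr => k _.
  by rewrite -sumrB; apply: eq_bigr => l _; rewrite /c; ring.
under eq_integral do rewrite E.
rewrite ExE; last first.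
  apply: finite_momentsX; apply: finite_moments_sum => k; apply: finite_moments_sum => l.
  by apply: finite_momentsM; [apply: finite_momentsZ|]; exact: finite_moments_dW.
apply: (@le_trans _ _ (2 * \sum_k \sum_l c k l ^+ 2 * dt t k * dt t l)%:E).
  by rewrite lee_fin; exact: Ex_offdiag_sqr_le.
rewrite EFinM -integral_node_cells lee_wpmul2l//.
have mD : measurable D by apply: measurableX; exact: measurable_itv.
apply: ge0_le_integral => //.
- move=> z _; rewrite lee_fin sumr_ge0// => k _; rewrite sumr_ge0// => l _.
  by rewrite mulr_ge0// mulr_ge0// sqr_ge0.
- apply/measurable_EFinP; apply: measurable_funTS.
  apply: measurable_sum => k; apply: measurable_sum => l.
  apply: measurable_funM; first apply: measurable_funM => //.
  + by apply: measurableT_comp => //; exact: measurable_indic (measurable_itv _).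
  + by apply: measurableT_comp => //; exact: measurable_indic (measurable_itv _).
- apply/measurable_EFinP; apply: measurable_funTS; apply: measurable_funX.
  by apply: measurable_funB; exact: measurable_step_fun.
- move=> z _; rewrite lee_fin.
  apply: (sum_node_cells (f := fun z => step_fun s1 z - step_fun s2 z)).
  by move=> k l zk zl; rewrite /c [z]surjective_pairing !(step_fun_node _ zk zl).
Qed.

End refinement.

Section isometry.
Context (R : realType).

Lemma common_refinement (s1 s2 : step_kernel R) :
  exists (t : nat -> I01 R) (n : nat),
   [/\ forall i j, (i <= j)%N -> \val (t i) <= \val (t j), refines t n s1 & refines t n s2].
Proof.
pose l := [seq sk_node s1 i | i <- iota 0 (sk_size s1).+1] ++
  [seq sk_node s2 i | i <- iota 0 (sk_size s2).+1].
pose r (x y : I01 R) := \val x <= \val y.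
have rtot : total r by move=> x y; exact: le_total.
have rtr : transitive r by move=> y x z; exact: le_trans.
have rr : reflexive r by move=> x; exact: lexx.
pose sl := sort r l; pose x0 := sk_node s1 0%N.
have ss : (0 < size sl)%N by rewrite size_sort.
(* The index is clamped at the last node, so that the sequence is nondecreasing on all of [nat]. *)
exists (fun i => nth x0 sl (minn i (size sl).-1)), (size sl).
have sorted_sl : sorted r sl by exact: sort_sorted.
have key s : {subset [seq sk_node s i | i <- iota 0 (sk_size s).+1] <= l} ->
    refines (fun i => nth x0 sl (minn i (size sl).-1)) (size sl) s.
  move=> sub i ilt.
  have : sk_node s i \in sl.
    by rewrite mem_sort; apply: sub; apply: map_f; rewrite mem_iota.
  move=> /(nthP x0)[p plt pE]; exists p; first exact: ltnW.
  by rewrite (minn_idPl _)// -ltnS prednK.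
split.
- move=> i j ij; apply: (sorted_leq_nth rtr rr x0 sorted_sl); rewrite ?inE.
  + by rewrite gtn_min ltn_predL ss orbT.
  + by rewrite gtn_min ltn_predL ss orbT.
  + by rewrite leq_min geq_minr andbT geq_min ij.
- by apply: key => x xl; rewrite mem_cat xl.
- by apply: key => x xl; rewrite mem_cat xl orbT.
Qed.

Lemma step_isometry d (T : measurableType d) (P : probability T R)
    (W : I01 R -> T -> R) s1 s2 : standard_wiener_process P W ->
  (\int[P]_w ((step_integral W s1 w - step_integral W s2 w) ^+ 2)%:E <=
   2%:E * \int[lebesgue_measure \x lebesgue_measure]_(z in `[0%R, 1%R] `*` `[0%R, 1%R])
     ((step_fun s1 z - step_fun s2 z) ^+ 2)%:E)%E.
Proof.
have [t [n [tP r1 r2]]] := common_refinement s1 s2.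
by move=> wW; apply: step_isometry_refined wW r1 r2.
Qed.

End isometry.

(** * The kernel of the Rosenblatt process *)

Section improper.
Context (R : realType).
Notation mu := (@lebesgue_measure R).
Variables (a b : R).
Hypothesis ab : a < b.

(** The denominator [n.+3] keeps every truncated interval nondegenerate, [a + e n < b - e n]. *)
Let e n : R := (b - a) / n.+3%:R.
Let I n : set R := `[a + e n, b - e n].

Let e_gt0 n : 0 < e n. Proof. by rewrite divr_gt0// subr_gt0. Qed.

Let e_le n : e n <= (b - a) / 3.
Proof.
rewrite /e ler_wpM2l ?subr_ge0 ?(ltW ab)// lef_pV2 ?posrE// ler_nat//.
Qed.

Let e_lt n : a + e n < b - e n.
Proof. by have := e_le n; have := ab; lra. Qed.

Let cvg_e : e n @[n --> \oo] --> 0.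
Proof.
rewrite -(mulr0 (b - a)); apply: cvgMr.
have := @cvg_harmonic R; rewrite -(cvg_shiftn 2) => h.
rewrite (_ : (fun n => n.+3%:R^-1) = (fun n => @harmonic R (n + 2)%N))//.
by apply/funext => n; rewrite /harmonic /= addn2.
Qed.

Let I_nd : nondecreasing_seq I.
Proof.
move=> m n mn; apply/subsetPset => x; rewrite /I /= !in_itv/=.
have : e n <= e m.
  by rewrite /e ler_wpM2l ?subr_ge0 ?(ltW ab)// lef_pV2 ?posrE// ler_nat !ltnS.
by move=> h /andP[? ?]; apply/andP; split; lra.
Qed.

Let I_bigcup : \bigcup_n I n = `]a, b[%classic.
Proof.
apply/seteqP; split => x /=.
  move=> [n _]; rewrite /I /= !in_itv/= => /andP[h1 h2].
  by have en := e_gt0 n; apply/andP; split; lra.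
rewrite in_itv/= => /andP[ax xb].
have m0 : 0 < Num.min (x - a) (b - x) by rewrite lt_min !subr_gt0 ax xb.
have /cvgrPdist_lt/(_ _ m0)[n _ /(_ n (leqnn n))] := cvg_e.
rewrite /= sub0r normrN gtr0_norm// lt_min => /andP[h1 h2].
by exists n => //; rewrite /I /= in_itv/=; apply/andP; split; lra.
Qed.

Lemma cvg_integral_oo (f : R -> R) : (forall x, a < x < b -> 0 <= f x) ->
  measurable_fun `]a, b[ f ->
  (\int[mu]_(x in `[(a + e n)%R, (b - e n)%R]) (f x)%:E @[n --> \oo] -->
   \int[mu]_(x in `]a, b[) (f x)%:E)%E.
Proof.
move=> f0 mf; rewrite -I_bigcup.
apply: ge0_nondecreasing_set_cvg_integral => //.
- move=> n; apply/measurable_EFinP; apply: measurable_funS mf; first exact: measurable_itv.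
  by rewrite -I_bigcup => x Ix; exists n.
- move=> n x Ix; rewrite lee_fin f0//.
  have : `]a, b[%classic x by rewrite -I_bigcup; exists n.
  by rewrite /= in_itv.
Qed.

Let cvg_comp_left (F : R -> R) (l : R) : F x @[x --> a^'+] --> l -> F (a + e n) @[n --> \oo] --> l.
Proof.
move=> /cvg_at_rightP; apply; split=> [n|]; first by rewrite ltrDl.
by rewrite -[X in _ --> X]addr0; apply: cvgD; [exact: cvg_cst|exact: cvg_e].
Qed.

Let cvg_comp_right (F : R -> R) (l : R) : F x @[x --> b^'-] --> l -> F (b - e n) @[n --> \oo] --> l.
Proof.
move=> /cvg_at_leftP; apply; split=> [n|]; first by rewrite ltrBlDr ltrDl.
by rewrite -[X in _ --> X]subr0; apply: cvgB; [exact: cvg_cst|exact: cvg_e].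
Qed.

Let cvg_right_comp (F : R -> R) x : {for x, continuous F} -> F y @[y --> x^'+] --> F x.
Proof. exact: cvg_at_right_filter. Qed.

Let cvg_left_comp (F : R -> R) x : {for x, continuous F} -> F y @[y --> x^'-] --> F x.
Proof. exact: cvg_at_left_filter. Qed.

Let continuous_itv (F : R -> R) u v : a < u -> v < b ->
  (forall x, a < x < b -> {for x, continuous F}) -> {within `[u, v], continuous F}.
Proof.
move=> au vb cF; apply: continuous_in_subspaceT => x /set_mem/=.
rewrite in_itv/= => /andP[ux xv]; apply: cF.
by rewrite (lt_le_trans au ux) (le_lt_trans xv vb).
Qed.

Let derivable_cont (F : R -> R) x : derivable F x 1 -> {for x, continuous F}.
Proof. by move=> dF; apply/differentiable_continuous; rewrite -derivable1_diffP. Qed.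

Let continuous_mfun (f : R -> R) : (forall x, a < x < b -> {for x, continuous f}) ->
  measurable_fun `]a, b[ f.
Proof.
move=> cf; apply: open_continuous_measurable_fun; first exact: itv_open.
by move=> x /set_mem/=; rewrite in_itv; exact: cf.
Qed.

(** Meant for integrands that are unbounded at an end point: the fundamental theorem is used on
    compact subintervals, which exhaust the open one by monotone convergence. *)
Lemma ge0_FTC2_oo (f F : R -> R) (l r : R) :
  (forall x, a < x < b -> 0 <= f x) ->
  (forall x, a < x < b -> {for x, continuous f}) ->
  (forall x, a < x < b -> is_derive x 1 F (f x)) ->
  F x @[x --> a^'+] --> l -> F x @[x --> b^'-] --> r ->
  (\int[mu]_(x in `]a, b[) (f x)%:E = (r - l)%:E)%E.
Proof.
move=> f0 cf dF Fl Fr.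
have dF' x : a < x < b -> derivable F x 1 by move=> /dF[].
have := cvg_integral_oo f0 (continuous_mfun cf).
have E n : (\int[mu]_(x in `[(a + e n)%R, (b - e n)%R]) (f x)%:E =
    (F (b - e n) - F (a + e n))%:E)%E.
  have h1 : a < a + e n by rewrite ltrDl.
  have h2 : b - e n < b by rewrite ltrBlDr ltrDl.
  have h3 := e_lt n.
  rewrite EFinB; apply: continuous_FTC2 => //.
  - exact: continuous_itv.
  - split.
    + move=> x; rewrite in_itv/= => /andP[ux xv]; apply: dF'.
      by rewrite (lt_trans h1 ux) (lt_trans xv h2).
    + by apply: cvg_right_comp; apply: derivable_cont; apply: dF'; rewrite h1 (lt_trans h3 h2).
    + by apply: cvg_left_comp; apply: derivable_cont; apply: dF'; rewrite h2 (lt_trans h1 h3).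
  - move=> x; rewrite in_itv/= => /andP[ux xv]; rewrite derive1E.
    have xab : a < x < b by rewrite (lt_trans h1 ux) (lt_trans xv h2).
    by have [_ ->] := dF _ xab.
under eq_fun do rewrite E.
move=> h; apply: (cvg_unique (@ereal_hausdorff R) h).
apply: cvg_EFin; first exact: nearW.
by apply: cvgB; [exact: cvg_comp_right|exact: cvg_comp_left].
Qed.

(** The change of variables on compact subintervals is passed to the limit on both sides by monotone
    convergence; the images of the subintervals exhaust []c, d[] because [F] increases from [c] to
    [d]. *)
Lemma ge0_substitution_oo (c d : R) (F f G : R -> R) :
  (forall x, a < x < b -> is_derive x 1 F (f x)) ->
  (forall x, a < x < b -> {for x, continuous f}) ->
  (forall x, a < x < b -> 0 < f x) ->
  F x @[x --> a^'+] --> c -> F x @[x --> b^'-] --> d ->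
  (forall y, c < y < d -> 0 <= G y) ->
  (forall y, c < y < d -> {for y, continuous G}) ->
  (\int[mu]_(y in `]c, d[) (G y)%:E = \int[mu]_(x in `]a, b[) (G (F x) * f x)%:E)%E.
Proof.
move=> dF cf f0 Fc Fd G0 cG.
have dF' x : a < x < b -> derivable F x 1 by move=> /dF[].
have F'E x : a < x < b -> (derive1 F) x = f x by move=> h; rewrite derive1E; have [_ ->] := dF _ h.
have cF x : a < x < b -> {for x, continuous F} by move=> h; exact: derivable_cont (dF' _ h).
have incF x y : a < x -> x < y -> y < b -> F x < F y.
  move=> ax xy yb; apply: (@gtr0_derive1_lt_oo _ F a b) => //.
  - by move=> z; rewrite in_itv/= => h; rewrite F'E// f0.
  - by move=> z; rewrite inE/= in_itv; exact: cF.
  - by rewrite in_itv/= ax (lt_trans xy yb).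
  - by rewrite in_itv/= yb (lt_trans ax xy).
pose u n := a + e n; pose v n := b - e n.
have au n : a < u n by rewrite ltrDl.
have vb n : v n < b by rewrite ltrBlDr ltrDl.
have uv n : u n < v n := e_lt n.
have Fu : F (u n) @[n --> \oo] --> c by exact: cvg_comp_left.
have Fv : F (v n) @[n --> \oo] --> d by exact: cvg_comp_right.
have e_nincr m n : (m <= n)%N -> e n <= e m.
  by move=> mn; rewrite /e ler_wpM2l ?subr_ge0 ?(ltW ab)// lef_pV2 ?posrE// ler_nat !ltnS.
have FleI x y : a < x -> x <= y -> y < b -> F x <= F y.
  by move=> ax; rewrite le_eqVlt => /predU1P[->//|xy] yb; exact/ltW/incF.
have u_nincr m n : (m <= n)%N -> F (u n) <= F (u m).
  move=> mn; apply: FleI => //; first by rewrite lerD2l e_nincr.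
  exact: lt_trans (uv m) (vb m).
have v_ndecr m n : (m <= n)%N -> F (v m) <= F (v n).
  move=> mn; apply: FleI => //; first exact: lt_trans (au m) (uv m).
  by rewrite lerB// e_nincr.
have e_strict n : e n.+1 < e n.
  by rewrite /e ltr_pM2l ?subr_gt0// ltf_pV2 ?posrE// ltr_nat.
(* The limit only gives [c <= F (u n.+1)]; the strict bound comes from [F (u n.+1) < F (u n)]. *)
have cFu n : c < F (u n).
  apply: (@le_lt_trans _ _ (F (u n.+1))).
    rewrite -(cvg_lim _ Fu)//; apply: limr_le; first by apply/cvg_ex; exists c.
    by exists n.+1 => // m /= nm; exact: u_nincr.
  by apply: incF => //; [rewrite ltrD2l|exact: lt_trans (uv n) (vb n)].
have Fvd n : F (v n) < d.
  apply: (@lt_le_trans _ _ (F (v n.+1))).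
    by apply: incF => //; [exact: lt_trans (au n) (uv n)|rewrite ltrD2l ltrN2].
  rewrite -(cvg_lim _ Fv)//; apply: limr_ge; first by apply/cvg_ex; exists d.
  by exists n.+1 => // m /= nm; exact: v_ndecr.
pose J n : set R := `[F (u n), F (v n)]%classic.
have J_bigcup : \bigcup_n J n = `]c, d[%classic.
  apply/seteqP; split => y /=.
    move=> [n _]; rewrite /J /= !in_itv/= => /andP[h1 h2].
    by rewrite (lt_le_trans (cFu n) h1) (le_lt_trans h2 (Fvd n)).
  rewrite in_itv/= => /andP[cy yd].
  have /cvgrPdist_lt/(_ (y - c)) := Fu; rewrite subr_gt0 => /(_ cy)[n1 _ h1].
  have /cvgrPdist_lt/(_ (d - y)) := Fv; rewrite subr_gt0 => /(_ yd)[n2 _ h2].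
  exists (maxn n1 n2) => //; rewrite /J /= in_itv/=.
  have := h1 (maxn n1 n2) (leq_maxl _ _); have := h2 (maxn n1 n2) (leq_maxr _ _).
  rewrite /= !ltr_distl => /andP[k1 k2] /andP[k3 k4].
  by apply/andP; split; lra.
have step n : (\int[mu]_(y in J n) (G y)%:E =
    \int[mu]_(x in `[(a + e n)%R, (b - e n)%R]) (G (F x) * f x)%:E)%E.
  have inab x : x \in `[u n, v n] -> a < x < b.
    by rewrite in_itv/= => /andP[? ?]; rewrite (lt_le_trans (au n))// (le_lt_trans _ (vb n)).
  have inab' x : x \in `]u n, v n[ -> a < x < b.
    by move=> h; apply: inab; exact: subset_itv_oo_cc h.
  have cF' x : a < x < b -> {for x, continuous (derive1 F)}.
    move=> xab; have h : derive1 F y @[y --> x] --> f x.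
      apply: cvg_trans (cf _ xab); apply: near_eq_cvg.
      have : \forall y \near x, y \in `]a, b[ by apply: near_in_itvoo; rewrite in_itv.
      by apply: filterS => y; rewrite in_itv/= => h; rewrite F'E.
    by rewrite -F'E// in h.
  have uab : a < u n < b by rewrite au (lt_trans (uv n)).
  have vab : a < v n < b by rewrite vb (lt_trans (au n)).
  rewrite /J integration_by_substitution_increasing//; last 7 first.
  - exact: ltW.
  - move=> x y xI yI xy; have /andP[ax _] := inab _ xI; have /andP[_ yb] := inab _ yI.
    exact: incF.
  - by move=> x xI; exact/cF'/inab'.
  - by apply/cvg_ex; exists ((derive1 F) (u n)); apply: cvg_right_comp; exact: cF'.
  - by apply/cvg_ex; exists ((derive1 F) (v n)); apply: cvg_left_comp; exact: cF'.
  - split; first by move=> x /inab'; exact: dF'.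
      by apply: cvg_right_comp; exact: cF.
    by apply: cvg_left_comp; exact: cF.
  - apply: continuous_in_subspaceT => y /set_mem/=; rewrite in_itv/= => /andP[h1 h2].
    by apply: cG; rewrite (lt_le_trans (cFu n) h1) (le_lt_trans h2 (Fvd n)).
  by apply: eq_integral => x /set_mem xI; rewrite -F'E//; exact: inab.
have Fcd x : a < x < b -> c < F x < d.
  move=> xab; have : (\bigcup_n I n) x by rewrite I_bigcup /= in_itv.
  move=> [n _]; rewrite /I /= in_itv/= => /andP[h1 h2].
  have /andP[ax xb] := xab.
  by rewrite (lt_le_trans (cFu n) (FleI _ _ (au n) h1 xb)) (le_lt_trans (FleI _ _ ax h2 (vb n)) (Fvd n)).
have cvR : (\int[mu]_(x in `[(a + e n)%R, (b - e n)%R]) (G (F x) * f x)%:E @[n --> \oo] -->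
   \int[mu]_(x in `]a, b[) (G (F x) * f x)%:E)%E.
  apply: (cvg_integral_oo (f := fun x => G (F x) * f x)).
    by move=> x xab; rewrite mulr_ge0 ?(ltW (f0 _ _))// G0// Fcd.
  apply: continuous_mfun => x xab; apply: cvgM; last exact: cf.
  by apply: continuous_comp; [exact: cF|apply: cG; exact: Fcd].
have cvL : (\int[mu]_(y in J n) (G y)%:E @[n --> \oo] --> \int[mu]_(y in `]c, d[) (G y)%:E)%E.
  have Jcd n : J n `<=` `]c, d[ by rewrite -J_bigcup => y Jy; exists n.
  rewrite -J_bigcup; apply: ge0_nondecreasing_set_cvg_integral => //.
  - move=> m n mn; apply/subsetPset => y; rewrite /J /= !in_itv/= => /andP[h1 h2].
    by rewrite (le_trans (u_nincr _ _ mn) h1) (le_trans h2 (v_ndecr _ _ mn)).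
  - by move=> n; exact: measurable_itv.
  - move=> n; apply/measurable_EFinP; apply: (@measurable_funS _ _ _ _ `]c, d[%classic) => //.
    apply: open_continuous_measurable_fun; first exact: itv_open.
    by move=> y /set_mem/=; rewrite in_itv; exact: cG.
  - by move=> n y /Jcd; rewrite /= in_itv/= => ycd; rewrite lee_fin G0.
have stepE := funext step; rewrite /= in stepE; rewrite stepE in cvL.
exact: (cvg_unique (@ereal_hausdorff R) cvL).
Qed.

End improper.

Section power_integrals.
Context (R : realType).
Notation mu := (@lebesgue_measure R).
Implicit Types (a b p x : R).

Lemma powR_expln x p : 0 < x -> x `^ p = expR (p * ln x).
Proof. by move=> x0; rewrite /powR gt_eqF. Qed.

Lemma powR_anti p x y : p <= 0 -> 0 < x -> x <= y -> y `^ p <= x `^ p.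
Proof.
move=> p0 x0 xy; have y0 := lt_le_trans x0 xy.
by rewrite !powR_expln// ler_expR ler_wnM2l// ler_ln.
Qed.

Lemma powR_continuous p x : 0 < x -> {for x, continuous (fun y : R => y `^ p)}.
Proof.
move=> x0; apply/differentiable_continuous; rewrite -derivable1_diffP.
by apply: derivable_powR; rewrite in_itv/= x0.
Qed.

Lemma is_derive_powR_shift a p x : a < x ->
  is_derive x 1 (fun y => (y - a) `^ p) (p * (x - a) `^ (p - 1)).
Proof.
move=> ax; have xa : 0 < x - a by rewrite subr_gt0.
have h : is_derive x 1 (fun y : R => y - a) 1.
  by apply: is_derive_eq; rewrite subr0.
have := @is_derive1_comp _ (fun y : R => y `^ p) (fun y : R => y - a) x _ _ (is_derive1_powR _ xa) h.
by rewrite mulr1.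
Qed.

Lemma is_derive_powR_rev b p x : x < b ->
  is_derive x 1 (fun y => (b - y) `^ p) (- (p * (b - x) `^ (p - 1))).
Proof.
move=> xb; have bx : 0 < b - x by rewrite subr_gt0.
have h : is_derive x 1 (fun y : R => b - y) (- 1).
  by apply: is_derive_eq; ring.
have := @is_derive1_comp _ (fun y : R => y `^ p) (fun y : R => b - y) x _ _ (is_derive1_powR _ bx) h.
by rewrite mulrN1.
Qed.

Lemma derive_continuous (F : R -> R) x (l : R) : is_derive x 1 F l -> {for x, continuous F}.
Proof.
by move=> [dF _]; apply/differentiable_continuous; rewrite -derivable1_diffP.
Qed.

Lemma integral_powR_shift a b p : a < b -> -1 < p ->
  (\int[mu]_(x in `]a, b[) ((x - a) `^ p)%:E = ((b - a) `^ (p + 1) / (p + 1))%:E)%E.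
Proof.
move=> ab p1; have p10 : 0 < p + 1 by rewrite -ltrBlDr sub0r.
rewrite -[RHS]sube0 -EFinB; apply: (@ge0_FTC2_oo _ _ _ ab _ (fun x => (x - a) `^ (p + 1) / (p + 1))).
- by move=> x _; exact: powR_ge0.
- by move=> x /andP[ax _]; exact: derive_continuous (is_derive_powR_shift _ ax).
- move=> x /andP[ax _].
  rewrite (_ : (x - a) `^ p = ((p + 1) * (x - a) `^ (p + 1 - 1)) / (p + 1)).
    have h := is_derive_powR_shift (p + 1) ax.
    rewrite (_ : (fun y => _) = (fun y => (y - a) `^ (p + 1)) * cst (p + 1)^-1); last first.
      by apply/funext.
    by apply: is_derive_eq; rewrite /GRing.scale/= !mulr0 add0r mulrC.
  by rewrite addrK mulrAC divff ?mul1r// gt_eqF.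
- rewrite -(mul0r (p + 1)^-1); apply: cvgMl; apply/cvg_at_rightP => u [au cu].
  apply: ((cvg_at_rightP (fun y : R => y `^ (p + 1)) 0 0).1 (powR_cvg0 p10) (fun n => u n - a)).
  split=> [n|]; first by rewrite subr_gt0.
  by rewrite -(subrr a); apply: cvgB; [exact: cu|exact: cvg_cst].
- apply: cvg_at_left_filter; apply: cvgMl.
  exact: derive_continuous (is_derive_powR_shift _ ab).
Qed.

Lemma integral_powR_rev a b p : a < b -> -1 < p ->
  (\int[mu]_(x in `]a, b[) ((b - x) `^ p)%:E = ((b - a) `^ (p + 1) / (p + 1))%:E)%E.
Proof.
move=> ab p1; have p10 : 0 < p + 1 by rewrite -ltrBlDr sub0r.
rewrite -[X in _ = X%:E]opprK -[X in _ = X%:E]sub0r.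
apply: (@ge0_FTC2_oo _ _ _ ab _ (fun x => - ((b - x) `^ (p + 1) / (p + 1)))).
- by move=> x _; exact: powR_ge0.
- by move=> x /andP[_ xb]; exact: derive_continuous (is_derive_powR_rev _ xb).
- move=> x /andP[_ xb].
  rewrite (_ : (b - x) `^ p = - ((- ((p + 1) * (b - x) `^ (p + 1 - 1))) / (p + 1))).
    have h := is_derive_powR_rev (p + 1) xb.
    rewrite (_ : (fun y => _) = - ((fun y => (b - y) `^ (p + 1)) * cst (p + 1)^-1)); last first.
      by apply/funext.
    by apply: is_derive_eq; rewrite /GRing.scale/= !mulr0 add0r mulrC.
  by rewrite addrK mulNr opprK mulrAC divff ?mul1r// gt_eqF.
- apply: cvg_at_right_filter; apply: cvgN; apply: cvgMl.
  exact: derive_continuous (is_derive_powR_rev _ ab).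
- rewrite -oppr0 -(mul0r (p + 1)^-1); apply: cvgN; apply: cvgMl; apply/cvg_at_leftP => u [ub cu].
  apply: ((cvg_at_rightP (fun y : R => y `^ (p + 1)) 0 0).1 (powR_cvg0 p10) (fun n => b - u n)).
  split=> [n|]; first by rewrite subr_gt0.
  by rewrite -(subrr b); apply: cvgB; [exact: cvg_cst|exact: cu].
Qed.

End power_integrals.

(** * The factor of the kernel and its covariance *)

Section kernel.
Context (R : realType) (H : R).
Notation mu := (@lebesgue_measure R).
Hypothesis H12 : 2^-1 < H < 1.

Let a := H / 2.

(** Sharing the factor [u^H] evenly between the two variables makes the Rosenblatt kernel, up to its
    constant, the integral over [u] of [fkernel u x * fkernel u y]. *)
Definition fkernel (u x : R) : R :=
  if x < u then u `^ (H / 2) * x `^ (- (H / 2)) * (u - x) `^ (H / 2 - 1) else 0.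

(** The covariance of the Wiener integrals of [fkernel u] and [fkernel v]. Extended values are
    needed because the integral diverges on the diagonal. *)
Definition kernel_cov (u v : R) : \bar R :=
  (\int[mu]_(x in `]0%R, 1%R]) (fkernel u x * fkernel v x)%:E)%E.

Lemma fkernel_ge0 u x : 0 <= fkernel u x.
Proof. by rewrite /fkernel; case: ifPn => // _; rewrite !mulr_ge0 ?powR_ge0. Qed.

Definition beta_int : \bar R :=
  (\int[mu]_(s in `]0%R, 1%R[) (s `^ (- H) * (1 - s) `^ (H / 2 - 1))%:E)%E.

Let beta_integrand_cont (s : R) : 0 < s < 1 ->
  {for s, continuous (fun s => s `^ (- H) * (1 - s) `^ (H / 2 - 1))}.
Proof.
move=> /andP[s0 s1]; apply: cvgM; first exact: powR_continuous.
exact: derive_continuous (is_derive_powR_rev _ s1).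
Qed.

Let measurable_oo (f : R -> R) (u v : R) :
  (forall s, u < s < v -> {for s, continuous f}) -> measurable_fun `]u, v[ f.
Proof.
move=> cf; apply: open_continuous_measurable_fun; first exact: itv_open.
by move=> s; rewrite inE/= in_itv/=; exact: cf.
Qed.

(** On each half of the interval one factor is bounded by its value at 1/2 and the other is an
    integrable power. *)
Lemma beta_int_fin : (beta_int < +oo)%E.
Proof.
have /andP[h1 h2] := H12.
pose c1 : R := (1 / 2) `^ (H / 2 - 1); pose c2 : R := (1 / 2) `^ (- H).
have c10 : 0 <= c1 by exact: powR_ge0.
have c20 : 0 <= c2 by exact: powR_ge0.
have m1 : measurable_fun (`]0%R, 1%R[ : set R) (fun s : R => (s `^ (- H))%:E).
  by apply/measurable_EFinP; apply: measurable_oo => s /andP[s0 _]; exact: powR_continuous.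
have m2 : measurable_fun (`]0%R, 1%R[ : set R) (fun s : R => ((1 - s) `^ (H / 2 - 1))%:E).
  apply/measurable_EFinP; apply: measurable_oo => s /andP[_ s1].
  exact: derive_continuous (is_derive_powR_rev _ s1).
apply: (@le_lt_trans _ _ (\int[mu]_(s in `]0%R, 1%R[)
  (c1%:E * (s `^ (- H))%:E + c2%:E * ((1 - s) `^ (H / 2 - 1))%:E))%E).
  apply: ge0_le_integral => //.
  - by move=> s _; rewrite lee_fin mulr_ge0 ?powR_ge0.
  - by apply/measurable_EFinP; apply: measurable_oo; exact: beta_integrand_cont.
  - by apply: emeasurable_funD; apply: emeasurable_funM.
  move=> s; rewrite /= in_itv/= => /andP[s0 s1].
  rewrite -!EFinM -EFinD lee_fin.
  have p1 := powR_ge0 s (- H); have p2 := powR_ge0 (1 - s) (H / 2 - 1).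
  have [h|h] := lerP s (1 / 2).
    have : (1 - s) `^ (H / 2 - 1) <= c1 by apply: powR_anti; lra.
    by nra.
  have : s `^ (- H) <= c2 by apply: powR_anti; lra.
  by nra.
rewrite ge0_integralD//; last 4 first.
- by move=> s _; rewrite mule_ge0// lee_fin powR_ge0.
- by apply: emeasurable_funM.
- by move=> s _; rewrite mule_ge0// lee_fin powR_ge0.
- by apply: emeasurable_funM.
have p0 (g : R -> R) p x : (0 <= (g x `^ p)%:E)%E by rewrite lee_fin powR_ge0.
rewrite !ge0_integralZl// ?lee_fin//.
rewrite integral_powR_rev//; last lra.
have : (\int[mu]_(s in `]0%R, 1%R[) ((s - 0) `^ (- H))%:E = ((1 - 0) `^ (- H + 1) / (- H + 1))%:E)%E.
  by apply: integral_powR_shift => //; rewrite ltrN2.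
rewrite (_ : (fun s : R => ((s - 0) `^ (- H))%:E) = (fun s => (s `^ (- H))%:E)).
  by move=> ->; rewrite -!EFinM -EFinD ltry.
by apply/funext => s; rewrite subr0.
by move=> s _; rewrite lee_fin powR_ge0.
Qed.

Lemma beta_int_ge1 : (1 <= beta_int)%E.
Proof.
have /andP[h1 h2] := H12.
have -> : (1 = \int[mu]_(s in `]0%R, 1%R[) (cst 1 s))%E.
  by rewrite integral_cst//= lebesgue_measure_itv/= lte_fin ltr01 mul1e oppr0 adde0.
apply: ge0_le_integral => //.
  by apply/measurable_EFinP; apply: measurable_oo; exact: beta_integrand_cont.
move=> s; rewrite /= in_itv/= => /andP[s0 s1]; rewrite lee_fin.
have e1 p : 1 `^ p = 1 :> R by rewrite powR1.
rewrite -[X in X <= _]mulr1 ler_pM//.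
- by rewrite -[leLHS](e1 (- H)); apply: powR_anti; lra.
- by rewrite -[leLHS](e1 (H / 2 - 1)); apply: powR_anti; lra.
Qed.

Definition beta_real : R := fine beta_int.

Lemma beta_realE : beta_int = beta_real%:E.
Proof.
rewrite /beta_real fineK// ge0_fin_numE ?beta_int_fin//.
by apply: le_trans beta_int_ge1.
Qed.

Lemma beta_real_ge1 : 1 <= beta_real.
Proof. by rewrite -lee_fin -beta_realE beta_int_ge1. Qed.

Lemma Beta_beta_real : Beta (1 - H) (H / 2) = beta_real.
Proof.
rewrite /Beta /Rintegral /beta_real /beta_int; congr fine; apply: eq_integral => s _.
by congr (_ `^ _ * _)%:E; ring.
Qed.

(** The substitution [s = x (v - u) / (u (v - x))] maps []0, u[] onto []0, 1[] and turns the
    integrand into [(v - u)^(H-1) s^(-H) (1 - s)^(H/2-1) ds], a multiple of a Beta integrand. *)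
Lemma kernel_cov_lt u v : 0 < u -> u < v -> v <= 1 ->
  kernel_cov u v = (beta_real * (v - u) `^ (H - 1))%:E.
Proof.
move=> u0 uv v1; have /andP[h1 h2] := H12; have v0 := lt_trans u0 uv.
have vu : 0 < v - u by rewrite subr_gt0.
pose F x := (v - u) / u * (v * (v - x)^-1 - 1).
pose f x := (v - u) * v / (u * (v - x) ^+ 2).
pose G (s : R) := s `^ (- H) * (1 - s) `^ (H / 2 - 1).
have cG s : 0 < s < 1 -> {for s, continuous G} by exact: beta_integrand_cont.
have G0 s : 0 < s < 1 -> 0 <= G s by rewrite mulr_ge0 ?powR_ge0.
have dF x : x < v -> is_derive x 1 F (f x).
  move=> xv; have xv0 : v - x != 0 by rewrite gt_eqF ?subr_gt0.
  have hv : is_derive x 1 (fun y : R => v - y) (- 1).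
    by apply: is_derive_eq; ring.
  have hi := @is_deriveV _ (fun y : R => v - y) x (- 1) 1 xv0 hv.
  rewrite (_ : F = (fun y => (v - y)^-1) * cst ((v - u) / u * v) - cst ((v - u) / u)); last first.
    by apply/funext => y; rewrite !fctE /F; ring.
  apply: is_derive_eq; rewrite /GRing.scale/= /f; field.
  by rewrite xv0 gt_eqF.
have cf x : x < v -> {for x, continuous f}.
  move=> xv; apply: cvgM; first exact: cvg_cst.
  apply: cvgV; first by rewrite mulf_neq0 ?expf_neq0 ?gt_eqF ?subr_gt0.
  apply: cvgM; first exact: cvg_cst.
  have hB : v - y @[y --> x] --> v - x by apply: cvgB; [exact: cvg_cst|exact: cvg_id].
  under eq_fun do rewrite expr2.
  by rewrite expr2; apply: cvgM.
have F0 : F 0 = 0 by rewrite /F subr0 divff ?gt_eqF// subrr mulr0.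
have Fu : F u = 1 by rewrite /F; field; rewrite !gt_eqF.
have f0 x : x < v -> 0 < f x.
  by move=> xv; rewrite divr_gt0 ?mulr_gt0 ?exprn_gt0 ?subr_gt0.
have sub : (\int[mu]_(y in `]0%R, 1%R[) (G y)%:E =
    \int[mu]_(x in `]0%R, u[) (G (F x) * f x)%:E)%E.
  refine (@ge0_substitution_oo R 0 u u0 0 1 F f G _ _ _ _ _ G0 cG).
  - by move=> x /andP[_ xu]; apply: dF; exact: lt_trans xu uv.
  - by move=> x /andP[_ xu]; apply: cf; exact: lt_trans xu uv.
  - by move=> x /andP[_ xu]; apply: f0; exact: lt_trans xu uv.
  - by rewrite -[X in _ --> X]F0; apply: cvg_at_right_filter; exact: derive_continuous (dF _ v0).
  - by rewrite -[X in _ --> X]Fu; apply: cvg_at_left_filter; exact: derive_continuous (dF _ uv).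
have key x : 0 < x < u -> fkernel u x * fkernel v x = (v - u) `^ (H - 1) * (G (F x) * f x).
  move=> /andP[x0 xu]; have xv := lt_trans xu uv.
  have ux0 : 0 < u - x by rewrite subr_gt0.
  have vx0 : 0 < v - x by rewrite subr_gt0.
  rewrite /fkernel xu xv.
  (* All factors are positive; written as exponentials, the identity of powers becomes a linear
     identity between logarithms. *)
  have FE : F x = expR (ln x + ln (v - u) - ln u - ln (v - x)).
    rewrite !expRB !expRD !lnK ?posrE// /F; field; by rewrite !gt_eqF.
  have FE1 : 1 - F x = expR (ln v + ln (u - x) - ln u - ln (v - x)).
    rewrite !expRB !expRD !lnK ?posrE// /F; field; by rewrite !gt_eqF.
  have fE : f x = expR (ln (v - u) + ln v - ln u - (ln (v - x) + ln (v - x))).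
    rewrite !expRB !expRD !lnK ?posrE// /f; field; by rewrite !gt_eqF.
  rewrite /G FE1 FE fE -!expRM !powR_expln// -!expRD; congr expR; by field.
have -> : kernel_cov u v = (\int[mu]_(x in `]0%R, u[) (fkernel u x * fkernel v x)%:E)%E.
  rewrite /kernel_cov integral_mkcond [RHS]integral_mkcond; apply: eq_integral => x _.
  rewrite !patchE; case: ifPn => [/set_mem/=|/negP h]; rewrite ?in_itv/=.
    move=> /andP[x0 x1]; case: ifPn => //= /negP h; rewrite /fkernel ltNge.
    suff -> : u <= x by rewrite mul0r.
    by rewrite leNgt; apply/negP => xu; apply: h; apply/mem_set; rewrite /= in_itv/= x0.
  case: ifPn => // /set_mem/=; rewrite in_itv/= => /andP[x0 xu]; exfalso; apply: h.
  by apply/mem_set; rewrite /= in_itv/= x0 (le_trans (ltW (lt_trans xu uv))).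
have mGf : measurable_fun (`]0, u[ : set R) (fun x => G (F x) * f x).
  apply: measurable_oo => x /andP[x0 xu]; have xv := lt_trans xu uv.
  apply: cvgM; last exact: cf.
  apply: continuous_comp; first exact: derive_continuous (dF _ xv).
  apply: cG; rewrite {1}/F.
  have ux0 : 0 < u - x by rewrite subr_gt0.
  have vx0 : 0 < v - x by rewrite subr_gt0.
  have e1 : F x = x * (v - u) / (u * (v - x)).
    by rewrite /F; field; rewrite !gt_eqF.
  have e2 : 1 - F x = v * (u - x) / (u * (v - x)).
    by rewrite /F; field; rewrite !gt_eqF.
  rewrite -/(F x) e1 divr_gt0 ?mulr_gt0//= -e1 -subr_gt0 e2.
  by rewrite divr_gt0 ?mulr_gt0.
transitivity (\int[mu]_(x in `]0%R, u[) (((v - u) `^ (H - 1))%:E * (G (F x) * f x)%:E))%E.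
  by apply: eq_integral => x /set_mem /=; rewrite in_itv/= => xu; rewrite key.
rewrite ge0_integralZl//; last 3 first.
- exact/measurable_EFinP.
- move=> x; rewrite /= in_itv/= => /andP[x0 xu].
  by rewrite lee_fin mulr_ge0 ?(ltW (f0 _ (lt_trans xu uv)))// mulr_ge0 ?powR_ge0.
- by rewrite lee_fin powR_ge0.
by rewrite -sub -/beta_int beta_realE -EFinM mulrC.
Qed.

Lemma kernel_covC u v : kernel_cov u v = kernel_cov v u.
Proof. by apply: eq_integral => x _; rewrite mulrC. Qed.

Lemma kernel_cov_neq u v : 0 < u <= 1 -> 0 < v <= 1 -> u != v ->
  kernel_cov u v = (beta_real * `|u - v| `^ (H - 1))%:E.
Proof.
move=> /andP[u0 u1] /andP[v0 v1]; rewrite neq_lt => /orP[uv|vu].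
  by rewrite kernel_cov_lt// distrC gtr0_norm ?subr_gt0.
by rewrite kernel_covC kernel_cov_lt// gtr0_norm ?subr_gt0.
Qed.

End kernel.

(** * Approximation of the kernel on a grid *)

Section countable_range.
Context d (T : measurableType d) (C : countType).

(** Grid functions depend on a point only through the index of its cell, so their measurability
    reduces to that of the cells. *)
Lemma measurable_countable_range (h : T -> C) :
  (forall c, measurable (h @^-1` [set c])) -> forall Y : set C, measurable (h @^-1` Y).
Proof.
move=> mh Y.
have -> : h @^-1` Y = \bigcup_c (if `[< Y c >] then h @^-1` [set c] else set0).
  apply/seteqP; split => [x Yx|x [c _]].
    by exists (h x) => //; rewrite ifT//; apply/asboolP.
  by case: ifPn => // /asboolP Yc /= ->.
by apply: countable_bigcupT_measurable; [exact: countableP|move=> c; case: ifPn].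
Qed.

Lemma measurable_countable_comp d' (T' : measurableType d') (D : set T) (h : T -> C) (f : C -> T') :
  (forall c, measurable (h @^-1` [set c])) -> measurable D -> measurable_fun D (f \o h).
Proof.
move=> mh mD _ Y mY; apply: measurableI => //; rewrite comp_preimage.
exact: measurable_countable_range.
Qed.

End countable_range.

Section sandwich.
Context d (T : measurableType d) (R : realType) (mu : {measure set T -> \bar R}).
Local Open Scope ereal_scope.

Lemma le_liminf_integral (D : set T) (f : nat -> T -> \bar R) (g : T -> \bar R) :
  measurable D -> (forall n, measurable_fun D (f n)) -> measurable_fun D g ->
  (forall n x, D x -> 0 <= f n x) -> (forall x, D x -> 0 <= g x) ->
  (forall x, D x -> g x <= limn_einf (f^~ x)) ->
  \int[mu]_(x in D) g x <= limn_einf (fun n => \int[mu]_(x in D) f n x).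
Proof.
move=> mD mf mg f0 g0 gf; apply: le_trans (fatou mu mD mf f0).
apply: ge0_le_integral => //.
rewrite (_ : (fun x => _) = -%E \o (fun x => limn_esup (fun n => - f n x))); last first.
  by apply/funext => x /=; rewrite -limn_einfN; congr limn_einf; apply/funext => n /=; rewrite oppeK.
by apply: measurableT_comp => //; apply: measurable_fun_limn_esup => n; exact: measurableT_comp.
Qed.

(** Fatou's lemma bounds the lower limit from below and [f n <= g] bounds the integrals from above.
    This covers infinite limits and sequences that are not monotone in [n]. *)
Lemma sandwich_integral (D : set T) (f : nat -> T -> \bar R) (g : T -> \bar R) :
  measurable D -> (forall n, measurable_fun D (f n)) ->
  (forall n x, D x -> 0 <= f n x) -> (forall n x, D x -> f n x <= g x) ->
  (forall x, D x -> f n x @[n --> \oo] --> g x) ->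
  \int[mu]_(x in D) f n x @[n --> \oo] --> \int[mu]_(x in D) g x.
Proof.
move=> mD mf f0 fg fcg.
have mg : measurable_fun D g by exact: emeasurable_fun_cvg fcg.
have g0 x : D x -> 0 <= g x by move=> Dx; apply: le_trans (fg 0%N x Dx); exact: f0.
have h1 : \int[mu]_(x in D) g x <= limn_einf (fun n => \int[mu]_(x in D) f n x).
  by apply: le_liminf_integral => // x Dx; have [-> _] := cvg_limn_einf_sup (fcg _ Dx).
have h2 n : \int[mu]_(x in D) f n x <= \int[mu]_(x in D) g x.
  by apply: ge0_le_integral => //; [exact: f0|exact: fg].
pose u := fun n => \int[mu]_(x in D) f n x.
have e1 n : einfs u n <= u n by apply: ereal_inf_lbound; exists n => /=.
have e2 : einfs u @ \oo --> \int[mu]_(x in D) g x.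
  suff -> : \int[mu]_(x in D) g x = limn_einf u by rewrite limn_einf_lim; exact: is_cvg_einfs.
  apply/eqP; rewrite eq_le h1 limn_einf_lim/=.
  by apply: lime_le; [exact: is_cvg_einfs|apply: nearW => n; exact: le_trans (e1 n) (h2 n)].
apply: (squeeze_cvge _ e2 (cvg_cst _)); apply: nearW => n /=.
by rewrite e1 h2.
Qed.

End sandwich.

Section grid_index.
Context (R : realType).
Notation mu := (@lebesgue_measure R).

(* For [u] positive, the index of the cell ]p/M, (p+1)/M] that contains [u]. *)
Definition grid_idx (M : nat) (u : R) : nat := `|Num.ceil (u * M%:R)|%N.-1.

Lemma grid_idx_gt M u : (0 < M)%N -> 0 < u -> (grid_idx M u)%:R / M%:R < u.
Proof.
move=> M0 u0; have M0' : 0 < M%:R :> R by rewrite ltr0n.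
rewrite ltr_pdivrMr// /grid_idx.
have uM : 0 < u * M%:R by rewrite mulr_gt0.
have c0 : (0 < Num.ceil (u * M%:R))%R by rewrite ceil_gt0.
have := ceilB1_lt (u * M%:R); case: (Num.ceil _) c0 => // -[|n]//= _.
by rewrite -addn1 PoszD addrK.
Qed.

Lemma grid_idx_le M u : (0 < M)%N -> 0 < u -> u <= (grid_idx M u).+1%:R / M%:R.
Proof.
move=> M0 u0; have M0' : 0 < M%:R :> R by rewrite ltr0n.
rewrite ler_pdivlMr// /grid_idx.
have c0 : (0 < Num.ceil (u * M%:R))%R by rewrite ceil_gt0 mulr_gt0.
by have := ceil_ge (u * M%:R); case: (Num.ceil _) c0 => // -[|n].
Qed.

Lemma grid_idxE M p u : (0 < M)%N -> p%:R / M%:R < u <= p.+1%:R / M%:R -> grid_idx M u = p.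
Proof.
move=> M0; have M0' : 0 < M%:R :> R by rewrite ltr0n.
rewrite ltr_pdivrMr// ler_pdivlMr// => h.
rewrite /grid_idx (_ : Num.ceil _ = p.+1%:Z)//; apply: ceil_def.
by rewrite (_ : p.+1%:Z - 1 = p%:Z)// -addn1 PoszD addrK.
Qed.

Lemma grid_idx_lt M n u : (0 < M)%N -> 0 < u -> u <= n%:R / M%:R -> (grid_idx M u < n)%N.
Proof.
move=> M0 u0 un; have := lt_le_trans (grid_idx_gt M0 u0) un.
by rewrite ltr_pM2r ?invr_gt0 ?ltr0n// ltr_nat.
Qed.

Lemma le_grid_idx M u v : (0 < M)%N -> 0 < u -> u <= v -> (grid_idx M u <= grid_idx M v)%N.
Proof.
move=> M0 u0 uv; have v0 := lt_le_trans u0 uv.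
have := lt_le_trans (grid_idx_gt M0 u0) (le_trans uv (grid_idx_le M0 v0)).
by rewrite ltr_pM2r ?invr_gt0 ?ltr0n// ltr_nat ltnS.
Qed.

Lemma measurable_grid_idx M (p : nat) : measurable (grid_idx M @^-1` [set p] : set R).
Proof.
have -> : grid_idx M @^-1` [set p] =
    (fun u : R => Num.ceil (u * M%:R)) @^-1` [set z | `|z|%N.-1 = p] by [].
apply: measurable_countable_range => z.
have -> : (fun u : R => Num.ceil (u * M%:R)) @^-1` [set z] =
    (fun u : R => u * M%:R) @^-1` `](z - 1)%:~R, z%:~R].
  apply/seteqP; split => u /=; rewrite in_itv/=.
    by move=> <-; exact: ceil_itv.
  by move=> h; apply: ceil_def.
have mf : measurable_fun setT (fun u : R => u * M%:R) by exact: measurable_funM.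
by have := mf measurableT _ (measurable_itv `](z - 1)%:~R, z%:~R]); rewrite setTI.
Qed.

Lemma measurable_grid d (T : measurableType d) M (D : set R) (f : nat -> T) :
  measurable D -> measurable_fun D (fun u => f (grid_idx M u)).
Proof. by move=> mD; apply: (measurable_countable_comp f (measurable_grid_idx M)). Qed.

Lemma measurable_grid2 d (T : measurableType d) M (D : set (R * R)) (f : nat -> nat -> T) :
  measurable D -> measurable_fun D (fun z => f (grid_idx M z.1) (grid_idx M z.2)).
Proof.
move=> mD; pose h (z : R * R) := (grid_idx M z.1, grid_idx M z.2).
apply: (measurable_countable_comp (h := h) (fun pq => f pq.1 pq.2)) => // -[p q].
have -> : h @^-1` [set (p, q)] = (grid_idx M @^-1` [set p]) `*` (grid_idx M @^-1` [set q]).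
  by apply/seteqP; split => -[u v] /=; rewrite /h/= => -[-> ->].
by apply: measurableX; exact: measurable_grid_idx.
Qed.

Lemma integral_grid M a b (f : nat -> R) : (0 < M)%N -> (a <= b)%N ->
  (forall p, 0 <= f p) ->
  (\int[mu]_(u in `](a%:R / M%:R)%R, (b%:R / M%:R)%R]) (f (grid_idx M u))%:E =
  (\sum_(a <= p < b) f p / M%:R)%:E)%E.
Proof.
move=> M0 ab f0; have M0' : 0 < M%:R :> R by rewrite ltr0n.
rewrite -(subnKC ab); elim: (b - a)%N => [|n IHn].
  by rewrite addn0 big_geq// set_itv_ge ?integral_set0// bnd_simp ltxx.
rewrite addnS big_nat_recr ?leq_addr//=.
rewrite (@itv_bndbnd_setU _ _ _ (BRight ((a + n)%:R / M%:R))); last 2 first.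
- by rewrite bnd_simp ler_pM2r ?invr_gt0// ler_nat leq_addr.
- by rewrite bnd_simp ler_pM2r ?invr_gt0// ler_nat.
rewrite ge0_integral_setU//=; last 3 first.
- by apply: (@measurable_grid _ _ M _ (fun p => (f p)%:E)); exact: measurableU.
- by move=> x _; rewrite lee_fin.
- apply/disj_setPS => x [] /=; rewrite !in_itv/= => /andP[_ h1] /andP[h2 _].
  by have := lt_le_trans h2 h1; rewrite ltxx.
rewrite IHn EFinD; congr (_ + _)%E.
transitivity (\int[mu]_(u in `]((a + n)%:R / M%:R)%R, ((a + n).+1%:R / M%:R)%R]) cst (f (a + n)%N)%:E u)%E.
  by apply: eq_integral => u /set_mem/=; rewrite in_itv/= => h; rewrite (grid_idxE M0 h).
rewrite integral_cst//= lebesgue_measure_itv/= lte_fin ltr_pM2r ?invr_gt0// ltr_nat ltnSn.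
by rewrite -EFinB -EFinM; congr (_ * _)%:E; rewrite -mulrBl -natr1 addrAC subrr add0r mul1r.
Qed.

End grid_index.

(** * The kernel on a grid, approximated from below *)

Section grid_kernel.
Context (R : realType) (H : R).
Notation mu := (@lebesgue_measure R).
Hypothesis H12 : 2^-1 < H < 1.

(* A lower bound of the kernel on the product of the cells [p] and [q]. *)
Definition kap (M p q : nat) : R :=
  if (q < p)%N then (p%:R / M%:R) `^ (H / 2) * (q.+1%:R / M%:R) `^ (- (H / 2)) *
                    ((p.+1%:R - q%:R) / M%:R) `^ (H / 2 - 1)
  else 0.

Lemma kap_ge0 M p q : 0 <= kap M p q.
Proof. by rewrite /kap; case: ifPn => // _; rewrite !mulr_ge0 ?powR_ge0. Qed.

(** Each factor is taken at the corner of the cells where it is smallest: the increasing power of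
    [u] at the left end, the decreasing power of [x] at the right end, and the decreasing power of
    [u - x] at the largest difference. *)
Lemma kap_le M (u x : R) : (0 < M)%N -> 0 < u -> 0 < x ->
  kap M (grid_idx M u) (grid_idx M x) <= fkernel H u x.
Proof.
move=> M0 u0 x0; have M0' : 0 < M%:R :> R by rewrite ltr0n.
have /andP[h1 h2] := H12.
rewrite /kap; case: ifPn => [qp|_]; last exact: fkernel_ge0.
have pu := grid_idx_gt M0 u0; have up := grid_idx_le M0 u0.
have qx := grid_idx_gt M0 x0; have xq := grid_idx_le M0 x0.
set p := grid_idx M u in qp pu up *; set q := grid_idx M x in qp qx xq *.
have xu : x < u.
  apply: le_lt_trans xq (le_lt_trans _ pu).
  by rewrite ler_pM2r ?invr_gt0// ler_nat.
rewrite /fkernel xu; apply: ler_pM; rewrite ?mulr_ge0 ?powR_ge0//.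
  apply: ler_pM; rewrite ?powR_ge0//.
    by apply: ge0_ler_powR; rewrite ?nnegrE; [lra|rewrite divr_ge0|exact: ltW|exact: ltW].
  by apply: powR_anti => //; lra.
apply: powR_anti; rewrite ?subr_gt0//; first lra.
by rewrite mulrBl; apply: lerB => //; exact: ltW.
Qed.

(** Grids run along a sequence because a prescribed time [b m / Ms m = t] has to be a node of every
    grid. *)
Variable Ms : nat -> nat.
Hypothesis Ms_gt0 : forall m, (0 < Ms m)%N.
Hypothesis Ms_cvg : (Ms m)%:R^-1 @[m --> \oo] --> (0 : R).

Lemma grid_idx_cvg (u : R) : 0 < u -> (grid_idx (Ms m) u)%:R / (Ms m)%:R @[m --> \oo] --> (u : R).
Proof.
move=> u0.
have h : u - (Ms m)%:R^-1 @[m --> \oo] --> u - 0 by apply: cvgB => //; exact: cvg_cst.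
rewrite subr0 in h; apply: (squeeze_cvgr _ h (cvg_cst _)); apply: nearW => m.
rewrite (ltW (grid_idx_gt _ u0))// andbT lerBlDr.
by rewrite -[X in _ + X]mul1r -mulrDl natr1; exact: grid_idx_le.
Qed.

Lemma kap_cvg (u x : R) : 0 < u -> 0 < x ->
  kap (Ms m) (grid_idx (Ms m) u) (grid_idx (Ms m) x) @[m --> \oo] --> fkernel H u x.
Proof.
move=> u0 x0; have cu := grid_idx_cvg u0; have cx := grid_idx_cvg x0.
rewrite /fkernel; case: ifPn => [xu|]; last first.
  rewrite -leNgt => ux; apply: cvg_near_cst; apply: nearW => m.
  by rewrite /kap ltnNge le_grid_idx.
have cx1 : (grid_idx (Ms m) x).+1%:R / (Ms m)%:R @[m --> \oo] --> x.
  have h : (grid_idx (Ms m) x)%:R / (Ms m)%:R + (Ms m)%:R^-1 @[m --> \oo] --> x + 0 by exact: cvgD.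
  rewrite addr0 in h.
  by under eq_fun do rewrite -[_.+1%:R]natr1 mulrDl mul1r.
have cux : ((grid_idx (Ms m) u).+1%:R - (grid_idx (Ms m) x)%:R) / (Ms m)%:R @[m --> \oo] --> u - x.
  have h : (grid_idx (Ms m) u)%:R / (Ms m)%:R + (Ms m)%:R^-1 - (grid_idx (Ms m) x)%:R / (Ms m)%:R
      @[m --> \oo] --> u + 0 - x by apply: cvgB => //; exact: cvgD.
  rewrite addr0 in h.
  by under eq_fun do rewrite -[_.+1%:R]natr1 mulrBl mulrDl mul1r.
have ux0 : 0 < u - x by rewrite subr_gt0.
have E : \forall m \near \oo, (grid_idx (Ms m) x < grid_idx (Ms m) u)%N.
  near=> m; rewrite -(ltr_nat R) -(ltr_pM2r (x := (Ms m)%:R^-1)) ?invr_gt0 ?ltr0n//.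
  apply: (@lt_trans _ _ ((x + u) / 2)).
    near: m; apply: (cvgr_lt x) => //; lra.
  near: m; apply: (cvgr_gt u) => //; lra.
have pc (f : nat -> R) (p l : R) : 0 < l -> f m @[m --> \oo] --> l -> (f m) `^ p @[m --> \oo] --> l `^ p.
  by move=> l0 fl; apply: (@cvg_comp _ _ _ f (fun y : R => y `^ p) _ _ _ fl); exact: powR_continuous.
have h : ((grid_idx (Ms m) u)%:R / (Ms m)%:R) `^ (H / 2) *
    ((grid_idx (Ms m) x).+1%:R / (Ms m)%:R) `^ (- (H / 2)) *
    (((grid_idx (Ms m) u).+1%:R - (grid_idx (Ms m) x)%:R) / (Ms m)%:R) `^ (H / 2 - 1) @[m --> \oo] -->
    u `^ (H / 2) * x `^ (- (H / 2)) * (u - x) `^ (H / 2 - 1).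
  apply: cvgM; [apply: cvgM|].
  - exact: pc.
  - exact: pc.
  exact: pc.
apply: cvg_trans h; apply: near_eq_cvg.
by near=> m; rewrite /kap ifT//; near: m.
Unshelve. all: by end_near. Qed.

(** The inner product of two rows of [kap]; it is the covariance of the discretised Wiener integrals
    at the times [p] and [p']. *)
Definition kap_cov (M p p' : nat) : R := \sum_(0 <= q < M) kap M p q * kap M p' q / M%:R.

Lemma kap_cov_ge0 M p p' : 0 <= kap_cov M p p'.
Proof. by apply: sumr_ge0 => q _; rewrite divr_ge0 ?mulr_ge0 ?kap_ge0. Qed.

Lemma kap_covC M p p' : kap_cov M p p' = kap_cov M p' p.
Proof. by apply: eq_bigr => q _; rewrite (mulrC (kap M p q)). Qed.

Lemma kap_covE M p p' : (0 < M)%N ->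
  (\int[mu]_(x in `]0%R, 1%R]) (kap M p (grid_idx M x) * kap M p' (grid_idx M x))%:E =
   (kap_cov M p p')%:E)%E.
Proof.
move=> M0; have := @integral_grid R M 0 M (fun q => kap M p q * kap M p' q) M0 (leq0n _).
rewrite mul0r divff ?gt_eqF ?ltr0n// => -> // q.
by rewrite mulr_ge0 ?kap_ge0.
Qed.

Lemma kap_cov_le M (u v : R) : (0 < M)%N -> 0 < u -> 0 < v ->
  ((kap_cov M (grid_idx M u) (grid_idx M v))%:E <= kernel_cov H u v)%E.
Proof.
move=> M0 u0 v0; rewrite -kap_covE//; apply: ge0_le_integral => //.
- by move=> x _; rewrite lee_fin mulr_ge0 ?kap_ge0.
- apply: (@measurable_grid _ _ _ M _ (fun q => (kap M _ q * kap M _ q)%:E)) => //.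
(* The product of kernels is measurable as a pointwise limit of grid functions. *)
- apply: (@emeasurable_fun_cvg _ _ _ _ (fun m x => (kap (Ms m) (grid_idx (Ms m) u) (grid_idx (Ms m) x) *
     kap (Ms m) (grid_idx (Ms m) v) (grid_idx (Ms m) x))%:E)).
    by move=> m; apply: (@measurable_grid _ _ _ _ _ (fun q => (kap (Ms m) _ q * kap (Ms m) _ q)%:E)).
  move=> x; rewrite /= in_itv/= => /andP[x0 _].
  by apply: cvg_EFin; [exact: nearW|apply: cvgM; exact: kap_cvg].
move=> x; rewrite /= in_itv/= => /andP[x0 _].
by rewrite lee_fin ler_pM ?kap_ge0 ?kap_le.
Qed.

Lemma kap_cov_cvg (u v : R) : 0 < u -> 0 < v ->
  ((kap_cov (Ms m) (grid_idx (Ms m) u) (grid_idx (Ms m) v))%:E @[m --> \oo] --> kernel_cov H u v)%E.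
Proof.
move=> u0 v0; under eq_fun do rewrite -kap_covE//.
apply: sandwich_integral => //.
- by move=> m; apply: (@measurable_grid _ _ _ _ _ (fun q => (kap (Ms m) _ q * kap (Ms m) _ q)%:E)).
- by move=> m x _; rewrite lee_fin mulr_ge0 ?kap_ge0.
- move=> m x; rewrite /= in_itv/= => /andP[x0 _].
  by rewrite lee_fin ler_pM ?kap_ge0 ?kap_le.
move=> x; rewrite /= in_itv/= => /andP[x0 _].
by apply: cvg_EFin; [exact: nearW|apply: cvgM; exact: kap_cvg].
Qed.

(* The kernel of the Rosenblatt variable at time [t], without its constant. *)
Definition cross_kernel (t x y : R) : \bar R :=
  (\int[mu]_(u in `]0%R, t]) (fkernel H u x * fkernel H u y)%:E)%E.

(** The inner product of two columns of [kap] over the times below [b]: the discrete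
    [cross_kernel]. *)
Definition kap_cross (M b q q' : nat) : R := \sum_(0 <= p < b) kap M p q * kap M p q' / M%:R.

Lemma kap_cross_ge0 M b q q' : 0 <= kap_cross M b q q'.
Proof. by apply: sumr_ge0 => p _; rewrite divr_ge0 ?mulr_ge0 ?kap_ge0. Qed.

Lemma kap_crossE M b q q' : (0 < M)%N ->
  (\int[mu]_(u in `]0%R, (b%:R / M%:R)%R]) (kap M (grid_idx M u) q * kap M (grid_idx M u) q')%:E =
   (kap_cross M b q q')%:E)%E.
Proof.
move=> M0; have := @integral_grid R M 0 b (fun p => kap M p q * kap M p q') M0 (leq0n _).
rewrite mul0r => -> // p.
by rewrite mulr_ge0 ?kap_ge0.
Qed.

Lemma cross_kernel_cvg (b : nat -> nat) (t x y : R) : (forall m, (b m)%:R / (Ms m)%:R = t) -> 0 < x -> 0 < y ->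
  (forall m, ((kap_cross (Ms m) (b m) (grid_idx (Ms m) x) (grid_idx (Ms m) y))%:E <= cross_kernel t x y)%E) /\
  ((kap_cross (Ms m) (b m) (grid_idx (Ms m) x) (grid_idx (Ms m) y))%:E @[m --> \oo] --> cross_kernel t x y)%E.
Proof.
move=> bt x0 y0.
have e m : (kap_cross (Ms m) (b m) (grid_idx (Ms m) x) (grid_idx (Ms m) y))%:E =
  (\int[mu]_(u in `]0%R, t]) (kap (Ms m) (grid_idx (Ms m) u) (grid_idx (Ms m) x) *
     kap (Ms m) (grid_idx (Ms m) u) (grid_idx (Ms m) y))%:E)%E.
  by rewrite -kap_crossE// bt.
have mk m : measurable_fun `]0%R, t] (fun u : R => (kap (Ms m) (grid_idx (Ms m) u) (grid_idx (Ms m) x) *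
     kap (Ms m) (grid_idx (Ms m) u) (grid_idx (Ms m) y))%:E).
  by apply: (@measurable_grid _ _ _ _ _ (fun p => (kap (Ms m) p _ * kap (Ms m) p _)%:E)).
have kc u : 0 < u -> ((kap (Ms m) (grid_idx (Ms m) u) (grid_idx (Ms m) x) *
     kap (Ms m) (grid_idx (Ms m) u) (grid_idx (Ms m) y))%:E @[m --> \oo] -->
     (fkernel H u x * fkernel H u y)%:E)%E.
  by move=> u0; apply: cvg_EFin; [exact: nearW|apply: cvgM; exact: kap_cvg].
have kl m u : 0 < u -> ((kap (Ms m) (grid_idx (Ms m) u) (grid_idx (Ms m) x) *
     kap (Ms m) (grid_idx (Ms m) u) (grid_idx (Ms m) y))%:E <= (fkernel H u x * fkernel H u y)%:E)%E.
  by move=> u0; rewrite lee_fin ler_pM ?kap_ge0 ?kap_le.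
split=> [m|]; rewrite ?e.
  apply: ge0_le_integral => //.
  - by move=> u _; rewrite lee_fin mulr_ge0 ?kap_ge0.
  - exact: mk.
  - apply: (@emeasurable_fun_cvg _ _ _ _ (fun m u => (kap (Ms m) (grid_idx (Ms m) u) (grid_idx (Ms m) x) *
     kap (Ms m) (grid_idx (Ms m) u) (grid_idx (Ms m) y))%:E)) => //.
    by move=> u; rewrite /= in_itv/= => /andP[u0 _]; exact: kc.
  - by move=> u; rewrite /= in_itv/= => /andP[u0 _]; exact: kl.
under eq_fun do rewrite e.
apply: sandwich_integral => //.
- by move=> m u _; rewrite lee_fin mulr_ge0 ?kap_ge0.
- by move=> m u; rewrite /= in_itv/= => /andP[u0 _]; exact: kl.
- by move=> u; rewrite /= in_itv/= => /andP[u0 _]; exact: kc.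
Qed.

End grid_kernel.

Section power_integrals.
Context (R : realType).
Notation mu := (@lebesgue_measure R).
Local Open Scope ereal_scope.

Lemma measurable_abs_powR (p u : R) (D : set R) : measurable D ->
  measurable_fun D (fun v => `|u - v|%R `^ p)%R.
Proof.
move=> mD; apply: (measurable_funS measurableT) => //.
apply: (@measurableT_comp _ _ _ _ _ _ (@powR R ^~ p)); first exact: measurable_powR.
by apply: measurableT_comp => //; exact: measurable_funB.
Qed.

Lemma integral_abs_powR (p u a b : R) : (- 1 < p)%R -> (a <= u <= b)%R ->
  \int[mu]_(v in `]a, b]) (`|u - v| `^ p)%:E =
  (((u - a) `^ (p + 1) + (b - u) `^ (p + 1)) / (p + 1))%:E.
Proof.
move=> p1 /andP[au ub]; have p0 : (p + 1 != 0)%R by rewrite gt_eqF//; lra.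
have m D : measurable D -> measurable_fun D (fun v : R => (`|u - v| `^ p)%:E).
  by move=> mD; apply/measurable_EFinP; exact: measurable_abs_powR.
have left : \int[mu]_(v in `]a, u]) (`|u - v| `^ p)%:E = ((u - a) `^ (p + 1) / (p + 1))%:E.
  move: au; rewrite le_eqVlt => /orP[/eqP <-|au].
    by rewrite subrr powR0// mul0r set_itv_ge ?integral_set0// bnd_simp ltxx.
  rewrite -integral_itv_bndo_bndc; last exact: m.
  rewrite -(integral_powR_rev au p1); apply: eq_integral => v /set_mem/=; rewrite in_itv/= => /andP[_ vu].
  by rewrite gtr0_norm// subr_gt0.
have right : \int[mu]_(v in `]u, b]) (`|u - v| `^ p)%:E = ((b - u) `^ (p + 1) / (p + 1))%:E.
  move: ub; rewrite le_eqVlt => /orP[/eqP <-|ub].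
    by rewrite subrr powR0// mul0r set_itv_ge ?integral_set0// bnd_simp ltxx.
  rewrite -integral_itv_bndo_bndc; last exact: m.
  rewrite -(integral_powR_shift ub p1); apply: eq_integral => v /set_mem/=; rewrite in_itv/= => /andP[uv _].
  by rewrite distrC gtr0_norm// subr_gt0.
rewrite (@itv_bndbnd_setU _ _ _ (BRight u)) ?bnd_simp//.
rewrite ge0_integral_setU//=; first by rewrite left right -EFinD mulrDl.
- by apply: m; exact: measurableU.
- apply/disj_setPS => x [] /=; rewrite !in_itv/= => /andP[_ h1] /andP[h2 _].
  by have := lt_le_trans h2 h1; rewrite ltxx.
Qed.

(** Replacing [u] by the nearest point [u'] of [[a, b]] brings it closer to every [v] and increases
    the integrand; each of the two pieces then has length at most [b - a]. *)
Lemma integral_abs_powR_le (p u a b : R) : (- 1 < p)%R -> (p <= 0)%R -> (a <= b)%R ->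
  \int[mu]_(v in `]a, b]) (`|u - v| `^ p)%:E <= (2 * (b - a) `^ (p + 1) / (p + 1))%:E.
Proof.
move=> p1 p0 ab; pose u' := Num.max a (Num.min u b).
have u'ab : (a <= u' <= b)%R by rewrite /u' le_max lexx/= ge_max ab ge_min lexx orbT.
have /andP[au' ub'] := u'ab.
have m q : measurable_fun `]a, b] (fun v : R => (`|q - v| `^ p)%:E).
  by apply/measurable_EFinP; exact: measurable_abs_powR.
apply: (@le_trans _ _ (\int[mu]_(v in `]a, b]) (`|u' - v| `^ p)%:E)).
  apply: ae_ge0_le_integral => //.
  - exact: m.
  - exact: m.
  (* At [v = u'] the default value of a negative power of 0 is 0, which spoils the comparison at
     this single point. *)
  exists [set u']; split => //; first exact: lebesgue_measure_set1.
  move=> v /= /not_implyP[]; rewrite in_itv/= => /andP[av vb] h; apply: contrapT => /eqP vu; apply: h.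
  rewrite lee_fin; apply: powR_anti => //; first by rewrite normr_gt0 subr_eq0 eq_sym.
  rewrite /u' /Num.max /Num.min; case: (ltP u b) => ub; case: ltP => // ua.
  - rewrite distrC (gtr0_norm (_ : 0 < v - a)%R) ?subr_gt0//.
    by apply: le_trans (_ : v - u <= _)%R; [lra|rewrite distrC ler_norm].
  - rewrite (ger0_norm (_ : 0 <= b - v)%R) ?subr_ge0//.
    by apply: le_trans (_ : u - v <= _)%R; [lra|rewrite ler_norm].
  - lra.
rewrite integral_abs_powR// lee_fin ler_pM2r ?invr_gt0; last lra.
have h q : (0 <= q)%R -> (q <= b - a)%R -> (q `^ (p + 1) <= (b - a) `^ (p + 1))%R.
  by move=> q0 qb; apply: ge0_ler_powR; rewrite ?nnegrE; lra.
by have := h (u' - a)%R; have := h (b - u')%R; lra.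
Qed.

End power_integrals.

(** * Row and block sums of the grid covariance *)

Section grid_covariance_bounds.
Context (R : realType) (H : R).
Notation mu := (@lebesgue_measure R).
Hypothesis H12 : 2^-1 < H < 1.
Notation B := (beta_real H).
Notation c := (kap_cov H).

Let B0 : 0 <= B. Proof. by apply: le_trans (beta_real_ge1 H12). Qed.

Lemma kap_cov_abs_le M (u v : R) : (0 < M)%N -> 0 < u <= 1 -> 0 < v <= 1 -> u != v ->
  c M (grid_idx M u) (grid_idx M v) <= B * `|u - v| `^ (H - 1).
Proof.
move=> M0 /andP[u0 u1] /andP[v0 v1] uv; rewrite -lee_fin -kernel_cov_neq ?u0 ?v0//.
by apply: (kap_cov_le H12 (Ms := succn)) => //; exact: cvg_harmonic.
Qed.

(** The row sum is the integral of a step function, dominated by the true covariance off the point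
    [v = u], where the library value of the power is 0. *)
Lemma kap_cov_row_le M n a b (u : R) : (0 < M)%N -> (a <= b <= M)%N -> 0 < u <= 1 ->
  ((\sum_(a <= q < b) c M (grid_idx M u) q ^+ n / M%:R)%:E <=
   \int[mu]_(v in `](a%:R / M%:R)%R, (b%:R / M%:R)%R]) ((B * `|u - v| `^ (H - 1)) ^+ n)%:E)%E.
Proof.
move=> M0 /andP[ab bM] u01; have M0' : 0 < M%:R :> R by rewrite ltr0n.
rewrite -(@integral_grid R M a b (fun q => c M (grid_idx M u) q ^+ n))//; last first.
  by move=> q; rewrite exprn_ge0// kap_cov_ge0.
apply: ae_ge0_le_integral => //.
- by move=> v _; rewrite lee_fin exprn_ge0// kap_cov_ge0.
- by apply: (@measurable_grid _ _ _ _ _ (fun q => (c M _ q ^+ n)%:E)).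
- by move=> v _; rewrite lee_fin exprn_ge0// mulr_ge0// powR_ge0.
- apply/measurable_EFinP; apply: measurable_funX; apply: measurable_funM => //.
  exact: measurable_abs_powR.
exists [set u]; split => //; first exact: lebesgue_measure_set1.
move=> v /= /not_implyP[]; rewrite in_itv/= => /andP[av vb] h; apply: contrapT => /eqP vu; apply: h.
rewrite lee_fin; apply: lerXn2r; rewrite ?nnegrE ?kap_cov_ge0 ?mulr_ge0 ?powR_ge0//.
apply: kap_cov_abs_le => //; last by rewrite eq_sym.
rewrite (le_lt_trans _ av) ?divr_ge0//=; apply: le_trans vb _.
by rewrite ler_pdivrMr// mul1r ler_nat.
Qed.

Let node_itv M p : (p < M)%N -> 0 < (p.+1%:R / M%:R : R) <= 1.
Proof.
move=> pM; have M0 : (0 < M)%N by case: M pM.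
by rewrite divr_gt0 ?ltr0n//= ler_pdivrMr ?ltr0n// mul1r ler_nat.
Qed.

(** Cells are closed on the right, so the right end point of cell [p] has index [p]; it serves as
    the sample point that turns pointwise bounds into bounds on rows. *)
Let node_idx M p : (0 < M)%N -> grid_idx M (p.+1%:R / M%:R : R) = p.
Proof. by move=> M0; apply: grid_idxE => //; rewrite lexx andbT ltr_pM2r ?invr_gt0 ?ltr0n// ltr_nat. Qed.

(** The squared covariance is at most [B^2 |u - v|^(2H-2)], which is integrable in [v] because
    [H > 1/2] makes the exponent larger than -1. *)
Lemma kap_cov_sqr_row_le M a b p : (p < M)%N -> (a <= b <= M)%N ->
  \sum_(a <= q < b) c M p q ^+ 2 / M%:R <= 2 * B ^+ 2 * ((b - a)%:R / M%:R) `^ (2 * H - 1) / (2 * H - 1).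
Proof.
move=> pM abM; have M0 : (0 < M)%N by case: M pM {abM}.
have /andP[h1 h2] := H12; have /andP[ab bM] := abM.
have M0' : 0 < M%:R :> R by rewrite ltr0n.
rewrite -lee_fin; apply: le_trans (_ : (\int[mu]_(v in `](a%:R / M%:R)%R, (b%:R / M%:R)%R])
  ((B ^+ 2)%:E * (`|p.+1%:R / M%:R - v| `^ (2 * H - 2))%:E) <= _)%E).
  have := kap_cov_row_le 2 M0 abM (node_itv pM); rewrite node_idx// => h; apply: (le_trans h).
  rewrite le_eqVlt; apply/orP; left; apply/eqP; apply: eq_integral => v _; rewrite exprMn -EFinM; congr (_ * _)%:E.
  by rewrite -powR_mulrn ?powR_ge0// -powRrM; congr (_ `^ _); ring.
rewrite ge0_integralZl//; last 2 first.
- by apply/measurable_EFinP; exact: measurable_abs_powR.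
- by rewrite lee_fin exprn_ge0.
apply: le_trans (lee_wpmul2l _ (@integral_abs_powR_le R (2 * H - 2) _ _ _ _ _ _)) _; [|lra|lra| |].
- by rewrite lee_fin exprn_ge0.
- by rewrite ler_pM2r ?invr_gt0// ler_nat.
rewrite -EFinM lee_fin le_eqVlt; apply/orP; left; apply/eqP.
rewrite natrB// mulrBl (_ : 2 * H - 2 + 1 = 2 * H - 1); last ring.
by rewrite !mulrA; congr (_ / _); ring.
Qed.

(** The integral of [B |u - v|^(H-1)] over a square of side [l]. *)
Definition block_mass (l : R) := 2 * B * l `^ (H + 1) / (H * (H + 1)).

(** The integrand is the inner integral of [B |u - v|^(H-1)] over [v] in []al, be]], already
    evaluated. *)
Lemma integral_block_mass (al be : R) : al <= be ->
  (\int[mu]_(u in `]al, be]) (B / H * `|al - u| `^ H + B / H * `|be - u| `^ H)%:E =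
   (block_mass (be - al))%:E)%E.
Proof.
move=> albe; have /andP[h1 h2] := H12.
have m w : measurable_fun `]al, be] (fun v : R => (`|w - v| `^ H)%:E).
  by apply/measurable_EFinP; exact: measurable_abs_powR.
have p0 (w x : R) : (0 <= (`|w - x| `^ H)%:E)%E by rewrite lee_fin powR_ge0.
have BH : (0 <= (B / H)%:E)%E by rewrite lee_fin divr_ge0//; lra.
have [K KE] : exists K, K = B / H by exists (B / H).
rewrite -KE in BH *.
under eq_integral do rewrite EFinD !EFinM.
rewrite ge0_integralD//; last 4 first.
- by move=> x _; rewrite mule_ge0.
- by apply: emeasurable_funM => //; exact: m.
- by move=> x _; rewrite mule_ge0.
- by apply: emeasurable_funM => //; exact: m.
rewrite !ge0_integralZl//; try exact: m.
have H1 : -1 < H by lra.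
have ea : al <= al <= be by rewrite lexx.
have eb : al <= be <= be by rewrite lexx andbT.
rewrite (integral_abs_powR H1 ea) (integral_abs_powR H1 eb).
rewrite !subrr powR0; last by rewrite gt_eqF//; lra.
rewrite -!EFinM -EFinD /block_mass; congr EFin; rewrite KE.
by field; rewrite !gt_eqF//; lra.
Qed.

Lemma kap_cov_block_le M a b : (0 < M)%N -> (a <= b <= M)%N ->
  \sum_(a <= p < b) (\sum_(a <= q < b) c M p q / M%:R) / M%:R <= block_mass ((b - a)%:R / M%:R).
Proof.
move=> M0 abM; have /andP[h1 h2] := H12; have /andP[ab bM] := abM.
have M0' : 0 < M%:R :> R by rewrite ltr0n.
pose al : R := a%:R / M%:R; pose be : R := b%:R / M%:R.
have albe : al <= be by rewrite ler_pM2r ?invr_gt0// ler_nat.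
have E := integral_block_mass albe.
rewrite (_ : be - al = (b - a)%:R / M%:R) in E; last by rewrite /be /al -mulrBl -natrB.
rewrite -lee_fin -E -(@integral_grid R M a b (fun p => \sum_(a <= q < b) c M p q / M%:R))//; last first.
  by move=> p; apply: sumr_ge0 => q _; rewrite divr_ge0 ?kap_cov_ge0.
have B0H : 0 <= B / H by rewrite divr_ge0//; lra.
apply: ge0_le_integral => //.
- by move=> x _; rewrite lee_fin; apply: sumr_ge0 => q _; rewrite divr_ge0 ?kap_cov_ge0.
- by apply: (@measurable_grid _ _ _ _ _ (fun p => (\sum_(a <= q < b) c M p q / M%:R)%:E)).
- apply/measurable_EFinP; apply: measurable_funD; apply: measurable_funM => //; exact: measurable_abs_powR.
move=> u; rewrite /= in_itv/= => /andP[au ub].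
have u01 : 0 < u <= 1.
  rewrite (le_lt_trans _ au) ?divr_ge0//=; apply: le_trans ub _.
  by rewrite ler_pdivrMr// mul1r ler_nat.
apply: (le_trans (kap_cov_row_le 1 M0 abM u01)).
rewrite (_ : (\int[mu]_(v in _) _)%E = (B%:E * \int[mu]_(v in `](a%:R / M%:R)%R, (b%:R / M%:R)%R]) (`|u - v| `^ (H - 1))%:E)%E); last first.
  rewrite -ge0_integralZl//.
  by apply/measurable_EFinP; exact: measurable_abs_powR.
rewrite integral_abs_powR ?(ltW au)//; last lra.
rewrite -EFinM lee_fin le_eqVlt; apply/orP; left; apply/eqP.
rewrite (_ : H - 1 + 1 = H); last ring.
rewrite distrC !ger0_norm ?subr_ge0 ?(ltW au)// /al /be.
by field; rewrite !gt_eqF//; lra.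
Qed.

End grid_covariance_bounds.

Section product_lebesgue.
Context (R : realType).
Notation mu := (@lebesgue_measure R).
Local Open Scope ereal_scope.

Lemma diagonal_negligible : (mu \x mu)%E.-negligible [set z : R * R | z.1 = z.2].
Proof.
have mD : measurable [set z : R * R | z.1 = z.2].
  have mf : measurable_fun [set: R * R] (fun z => z.1 - z.2)%R by exact: measurable_funB.
  have := mf measurableT _ (measurable_set1 0%R); rewrite setTI; congr measurable.
  by apply/seteqP; split => z /= /eqP; rewrite ?subr_eq0 => /eqP // ->; rewrite subrr.
exists [set z : R * R | z.1 = z.2]; split => //.
rewrite /product_measure1/= integral0_eq// => x _.
rewrite (_ : xsection _ x = [set x]) ?lebesgue_measure_set1//.
by apply/seteqP; split => y; rewrite /xsection/= inE/=.
Qed.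

Lemma integral_grid2 M (f : nat -> nat -> R) : (0 < M)%N -> (forall p q, 0 <= f p q)%R ->
  \int[(mu \x mu)%E]_(z in `]0%R, 1%R] `*` `]0%R, 1%R]) (f (grid_idx M z.1) (grid_idx M z.2))%:E =
  (\sum_(0 <= p < M) (\sum_(0 <= q < M) f p q / M%:R) / M%:R)%:E.
Proof.
move=> M0 f0; pose D : set R := `]0%R, 1%R]%classic.
have mD : measurable D by exact: measurable_itv.
have e01 : D = `](0%:R / M%:R)%R, (M%:R / M%:R)%R]%classic.
  by rewrite /D mul0r divff// gt_eqF// ltr0n.
rewrite integral_mkcond/=.
rewrite (_ : _ \_ _ = fun z : R * R => (f (grid_idx M z.1) (grid_idx M z.2))%:E * (\1_D z.1 * \1_D z.2)%:E); last first.
  apply/funext => -[x y]; rewrite patchE !indicE in_setX/=.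
  by case: (x \in D); case: (y \in D); rewrite ?mulr1 ?mulr0 ?mul0r ?mule1 ?mule0.
have mF : measurable_fun [set: R * R]
    (fun z : R * R => (f (grid_idx M z.1) (grid_idx M z.2))%:E * (\1_D z.1 * \1_D z.2)%:E).
  apply: emeasurable_funM; first exact: (@measurable_grid2 _ _ _ _ _ (fun p q => (f p q)%:E)).
  apply/measurable_EFinP; apply: measurable_funM.
    exact: (measurableT_comp (measurable_indic mD) measurable_fst).
  exact: (measurableT_comp (measurable_indic mD) measurable_snd).
rewrite fubini_tonelli1//; last first.
  by move=> z; rewrite mule_ge0// lee_fin ?f0// mulr_ge0.
rewrite -(@integral_grid R M 0 M (fun p => \sum_(0 <= q < M) f p q / M%:R)%R)//; last first.
  by move=> p; apply: sumr_ge0 => q _; rewrite divr_ge0.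
rewrite -e01 [RHS]integral_mkcond; apply: eq_integral => x _.
rewrite /fubini_F patchE; case: ifPn => xD; last first.
  by apply: integral0_eq => y _; rewrite !indicE/= (negbTE xD) mul0r mule0.
rewrite -(@integral_grid R M 0 M (fun q => f (grid_idx M x) q))// -e01 [RHS]integral_mkcond.
apply: eq_integral => y _; rewrite patchE !indicE/= xD mul1r.
by case: ifPn => _; rewrite ?mule1 ?mule0.
Qed.

End product_lebesgue.

(** A matrix times its transpose, in either order, has the same Hilbert-Schmidt norm. This trades
    the L2 norm of the kernel for the sum of squared covariances in time. *)
Lemma sum_gram_sqr (R : comPzRingType) (A : nat -> nat -> R) (b M : nat) :
  \sum_(0 <= q < M) \sum_(0 <= q' < M) (\sum_(0 <= p < b) A p q * A p q') ^+ 2 =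
  \sum_(0 <= p < b) \sum_(0 <= p' < b) (\sum_(0 <= q < M) A p q * A p' q) ^+ 2.
Proof.
transitivity (\sum_(0 <= q < M) \sum_(0 <= q' < M) \sum_(0 <= p < b) \sum_(0 <= p' < b)
    A p q * A p q' * (A p' q * A p' q')).
  by apply: eq_bigr => q _; apply: eq_bigr => q' _; rewrite expr2 big_distrlr.
under eq_bigr do rewrite exchange_big/=.
rewrite exchange_big/=; apply: eq_bigr => p _.
under eq_bigr do rewrite exchange_big/=.
rewrite exchange_big/=; apply: eq_bigr => p' _.
rewrite expr2 big_distrlr/=; apply: eq_bigr => q _; apply: eq_bigr => q' _.
by ring.
Qed.

(** * Square integrability of the kernel and its approximation in L2 *)

Section kernel_approximation.
Context (R : realType) (H : R).
Notation mu := (@lebesgue_measure R).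
Notation mu2 := (mu \x mu)%E.
Hypothesis H12 : 2^-1 < H < 1.
Notation kap := (kap H).
Notation kap_cov := (kap_cov H).
Notation kap_cross := (kap_cross H).
Notation cross_kernel := (cross_kernel H).

Lemma measurable_fkernel (x : R) (D : set R) : measurable D -> (forall u, D u -> 0 < u) -> 0 < x ->
  measurable_fun D (fun u => fkernel H u x).
Proof.
move=> mD D0 x0.
apply: (@measurable_fun_cvg _ _ _ _ (fun m u => kap m.+1 (grid_idx m.+1 u) (grid_idx m.+1 x))).
  by move=> m; apply: (@measurable_grid _ _ _ _ _ (fun p => kap m.+1 p _)).
move=> u Du; have h := @kap_cvg R H succn (fun _ => isT) (@cvg_harmonic R) u x (D0 _ Du) x0.
exact: h.
Qed.

Lemma rosenblatt_kernelE (t x y : R) : 0 < x -> 0 < y ->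
  rosenblatt_kernel H t (x, y) = rosenblatt_constant H * fine (cross_kernel t x y).
Proof.
move=> x0 y0; rewrite /rosenblatt_kernel /=; move: (rosenblatt_constant H) => K.
rewrite -!mulrA; congr (_ * _).
have [/andP[xt yt]|] := boolP ((x < t) && (y < t)); last first.
  move=> h; rewrite (_ : \1_ _ _ = 0); last first.
    rewrite indicE; case: (boolP (_ \in _)) => // /set_mem/= [] /=.
    by rewrite !in_itv/= => /andP[_ xt] /andP[_ yt]; rewrite xt yt in h.
  rewrite !mulr0 /cross_kernel integral0_eq//.
  move=> u; rewrite /= in_itv/= => /andP[_ ut].
  have [xu|xu] := ltP x u; last by rewrite /fkernel ltNge xu mul0r.
  have [yu|yu] := ltP y u; last by rewrite [fkernel H u y]/fkernel ltNge yu mulr0.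
  by move: h; rewrite (lt_le_trans xu ut) (lt_le_trans yu ut).
rewrite (_ : \1_ _ _ = 1); last first.
  by rewrite indicE mem_set//= !in_itv/= x0 xt y0 yt.
rewrite mulr1 mulrA.
pose k := x `^ (- (H / 2)) * y `^ (- (H / 2)).
have k0 : 0 < k by rewrite mulr_gt0// powR_gt0.
pose D : set R := `]Num.max x y, t[%classic.
pose G u := u `^ H * (u - x) `^ (H / 2 - 1) * (u - y) `^ (H / 2 - 1).
have G0 u : 0 <= G u by rewrite !mulr_ge0 ?powR_ge0.
have mfk : measurable_fun `]0, t] (fun u => (fkernel H u x * fkernel H u y)%:E).
  apply/measurable_EFinP; apply: measurable_funM; apply: measurable_fkernel => // u;
    by rewrite /= in_itv/= => /andP[].
have t0 : 0 < t by exact: lt_trans xt.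
have FD u : D u -> fkernel H u x * fkernel H u y = k * G u.
  rewrite /D /= in_itv/= gt_max => /andP[/andP[xu yu] ut].
  have u0 := lt_trans x0 xu.
  have uH : u `^ H = u `^ (H / 2) * u `^ (H / 2).
    by rewrite -powRD ?(gt_eqF u0) ?implybT// -splitr.
  by rewrite /fkernel xu yu /k /G uH; ring.
have mDF : measurable_fun D (fun u => (fkernel H u x * fkernel H u y)%:E).
  apply: measurable_funS mfk => // u; rewrite /D /= !in_itv/= gt_max => /andP[/andP[xu _] ut].
  by rewrite (lt_trans x0 xu) ltW.
have mDG : measurable_fun D (fun u => (G u)%:E).
  apply: (@eq_measurable_fun _ _ _ _ D (fun u => (k^-1)%:E * (fkernel H u x * fkernel H u y)%:E)%E).
    by move=> u /set_mem Du; rewrite FD// -EFinM mulKf// gt_eqF.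
  exact: emeasurable_funM.
have -> : cross_kernel t x y = (\int[mu]_(u in D) (k%:E * (G u)%:E))%E.
  rewrite /cross_kernel -integral_itv_bndo_bndc; last first.
    by apply: measurable_funS mfk => //; exact: subset_itv_oo_oc.
  rewrite integral_mkcond [RHS]integral_mkcond; apply: eq_integral => u _.
  rewrite !patchE; case: (boolP (u \in D)) => uD.
    rewrite ifT; first by rewrite (FD _ (set_mem uD)) EFinM.
    move/set_mem: uD; rewrite /D /= in_itv/= gt_max => /andP[/andP[xu _] ut].
    by apply/mem_set; rewrite /= in_itv/= ut (lt_trans x0 xu).
  case: ifPn => // /set_mem/=; rewrite in_itv/= => /andP[u0 ut].
  have [xu|xu] := ltP x u; last by rewrite /fkernel ltNge xu mul0r.
  have [yu|yu] := ltP y u; last by rewrite [fkernel H u y]/fkernel ltNge yu mulr0.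
  by exfalso; move/negP: uD; apply; apply/mem_set; rewrite /D /= in_itv/= gt_max xu yu ut.
rewrite ge0_integralZl//; [|exact: measurable_itv|by move=> u _; rewrite lee_fin|by rewrite lee_fin ltW].
rewrite /Rintegral -/k.
have I0 : (0 <= \int[mu]_(u in D) (G u)%:E)%E by apply: integral_ge0 => u _; rewrite lee_fin.
rewrite -/k -/D (_ : (\int[mu]_(x0 in D) _)%E = (\int[mu]_(u in D) (G u)%:E)%E)//.
(* An infinite integral yields 0 on both sides, through [fine] and through the real-valued
   integral. *)
case: (\int[mu]_(u in D) (G u)%:E)%E I0 => [r||]//= _.
by rewrite mulr0 gt0_muley.
Qed.

Variables (Ms b : nat -> nat) (t : R).
Hypothesis Ms_gt0 : forall m, (0 < Ms m)%N.
Hypothesis Ms_cvg : (Ms m)%:R^-1 @[m --> \oo] --> (0 : R).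
Hypothesis bM : forall m, (b m <= Ms m)%N.
Hypothesis bt : forall m, (b m)%:R / (Ms m)%:R = t.

Notation D2 := (`]0%R, 1%R] `*` `]0%R, 1%R] : set (R * R)).
Let ix m := @grid_idx R (Ms m).
Let bc m (z : R * R) := kap_cross (Ms m) (b m) (ix m z.1) (ix m z.2).

Let mD2 : measurable D2.
Proof. by apply: measurableX; exact: measurable_itv. Qed.

Let D2P z : D2 z -> (0 < z.1) /\ (0 < z.2).
Proof. by move=> [] /=; rewrite !in_itv/= => /andP[? _] /andP[? _]. Qed.

Let bc_ge0 m z : 0 <= bc m z. Proof. exact: kap_cross_ge0. Qed.

Let bc_le m z : D2 z -> ((bc m z)%:E <= cross_kernel t z.1 z.2)%E.
Proof. by move=> /D2P[z1 z2]; have [h _] := cross_kernel_cvg H12 Ms_gt0 Ms_cvg bt z1 z2; exact: h. Qed.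

Let bc_cvg z : D2 z -> ((bc m z)%:E @[m --> \oo] --> cross_kernel t z.1 z.2)%E.
Proof. by move=> /D2P[z1 z2]; have [_ h] := cross_kernel_cvg H12 Ms_gt0 Ms_cvg bt z1 z2; exact: h. Qed.

Lemma kap_cov_sqr_sum_le M n : (0 < M)%N -> (n <= M)%N ->
  \sum_(0 <= p < n) (\sum_(0 <= p' < n) kap_cov M p p' ^+ 2 / M%:R) / M%:R <=
  2 * beta_real H ^+ 2 / (2 * H - 1).
Proof.
move=> M0 nM; have M0' : 0 < M%:R :> R by rewrite ltr0n.
have /andP[h1 h2] := H12.
pose K : R := 2 * beta_real H ^+ 2 / (2 * H - 1).
have B0 : 0 <= beta_real H by exact: le_trans (beta_real_ge1 H12).
have HH : 0 < 2 * H - 1 by lra.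
have K0 : 0 <= K by rewrite /K divr_ge0 ?(ltW HH)// mulr_ge0// exprn_ge0.
have h p : (p < n)%N -> \sum_(0 <= p' < n) kap_cov M p p' ^+ 2 / M%:R <= K.
  move=> pn; apply: le_trans (kap_cov_sqr_row_le H12 (leq_trans pn nM) (_ : 0 <= n <= M)%N) _ => //.
  rewrite subn0 /K mulrAC ler_piMr//.
  rewrite -[leRHS](_ : 1 `^ (2 * H - 1) = 1); last by rewrite powR1.
  apply: ge0_ler_powR; rewrite ?nnegrE ?divr_ge0//; first lra.
  by rewrite ler_pdivrMr// mul1r ler_nat.
apply: (@le_trans _ _ (\sum_(0 <= p < n) K / M%:R)).
  rewrite !big_mkord; apply: ler_sum => p _; rewrite ler_pM2r ?invr_gt0//.
  by have := h p (ltn_ord p); rewrite big_mkord.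
rewrite sumr_const_nat subn0 -[(K / _) *+ _]mulr_natr -[leRHS]/K (_ : K / M%:R * n%:R = K * (n%:R / M%:R)); last by ring.
by rewrite -[leRHS]mulr1 ler_wpM2l// ler_pdivrMr// mul1r ler_nat.
Qed.

(** By [sum_gram_sqr] the squared norm of the discrete kernel is a sum of squared covariances over
    pairs of times, bounded uniformly in the mesh. *)
Let bc_sqr_le m : (\int[mu2]_(z in D2) ((bc m z) ^+ 2)%:E <= (2 * beta_real H ^+ 2 / (2 * H - 1))%:E)%E.
Proof.
have M0 := Ms_gt0 m; set M := Ms m.
rewrite (@integral_grid2 R M (fun p q => kap_cross M (b m) p q ^+ 2)) //; last first.
  by move=> p q; rewrite sqr_ge0.
rewrite lee_fin; apply: le_trans (kap_cov_sqr_sum_le M0 (bM m)).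
rewrite le_eqVlt; apply/orP; left; apply/eqP.
have e n (f : nat -> nat -> R) :
    \sum_(0 <= p < n) (\sum_(0 <= q < n) (f p q / M%:R) ^+ 2 / M%:R) / M%:R =
    (\sum_(0 <= p < n) \sum_(0 <= q < n) f p q ^+ 2) / M%:R ^+ 4.
  rewrite mulr_suml; apply: eq_bigr => p _; rewrite !mulr_suml; apply: eq_bigr => q _.
  by field; rewrite pnatr_eq0 -lt0n.
have d n (f : nat -> R) : \sum_(0 <= p < n) f p / M%:R = (\sum_(0 <= p < n) f p) / M%:R.
  by rewrite mulr_suml.
rewrite /kap_cross /kap_cov.
under eq_bigr do under eq_bigr do rewrite d.
under [RHS]eq_bigr do under eq_bigr do rewrite d.
rewrite (e M (fun q q' => \sum_(0 <= p < b m) kap M p q * kap M p q')).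
rewrite (e (b m) (fun p p' => \sum_(0 <= q < M) kap M p q * kap M p' q)).
by rewrite (sum_gram_sqr (fun p q => kap M p q)).
Qed.

Let mbc m : measurable_fun D2 (fun z => (bc m z)%:E).
Proof. exact: (@measurable_grid2 _ _ _ _ _ (fun p q => (kap_cross (Ms m) (b m) p q)%:E)). Qed.

Let cross_ge0 x y : (0 <= cross_kernel t x y)%E.
Proof. by apply: integral_ge0 => u _; rewrite lee_fin mulr_ge0 ?fkernel_ge0. Qed.

Lemma measurable_cross_kernel : measurable_fun D2 (fun z => cross_kernel t z.1 z.2).
Proof. by apply: (@emeasurable_fun_cvg _ _ _ _ (fun m z => (bc m z)%:E)) => // z; exact: bc_cvg. Qed.

Let mcross := measurable_cross_kernel.

Let mcross2 : measurable_fun D2 (fun z => cross_kernel t z.1 z.2 * cross_kernel t z.1 z.2)%E.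
Proof. exact: emeasurable_funM. Qed.

(** The discrete kernels lie below the kernel and converge to it pointwise, so their squared norms
    converge; the uniform bound [bc_sqr_le] passes to the limit. *)
Lemma cross_kernel_sqr_integrable :
  mu2.-integrable D2 (fun z => cross_kernel t z.1 z.2 * cross_kernel t z.1 z.2)%E.
Proof.
apply/integrableP; split => //.
under eq_integral do rewrite gee0_abs ?mule_ge0//.
have h : (\int[mu2]_(z in D2) ((bc m z) ^+ 2)%:E @[m --> \oo] -->
    \int[mu2]_(z in D2) (cross_kernel t z.1 z.2 * cross_kernel t z.1 z.2))%E.
  apply: sandwich_integral => //.
  - by move=> m; apply: (@measurable_grid2 _ _ _ _ _ (fun p q => (kap_cross (Ms m) (b m) p q ^+ 2)%:E)).
  - by move=> m z _; rewrite lee_fin sqr_ge0.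
  - by move=> m z Dz; rewrite expr2 EFinM lee_pmul ?lee_fin// bc_le.
  move=> z Dz; under eq_fun do rewrite expr2 EFinM.
  apply: cvgeM; [|exact: bc_cvg|exact: bc_cvg].
  have := cross_ge0 z.1 z.2; case: (cross_kernel t z.1 z.2) => [r||]//= _.
apply: (@le_lt_trans _ _ (2 * beta_real H ^+ 2 / (2 * H - 1))%:E); last exact: ltry.
rewrite -(cvg_lim _ h)//; apply: lime_le; first by apply/cvg_ex; eexists; exact: h.
by apply: nearW => m; exact: bc_sqr_le.
Qed.

(** A step kernel vanishes on diagonal cells, so the discrete kernel is split into the part that a
    step kernel carries and a diagonal remainder. *)
Definition off_kernel m (z : R * R) : R := if ix m z.1 != ix m z.2 then bc m z else 0.
Definition diag_kernel m (z : R * R) : R := if ix m z.1 == ix m z.2 then bc m z else 0.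

(** Dominated convergence with twice the squared kernel as majorant. Off the diagonal the two cell
    indices are eventually different, so the remainder vanishes and the rest converges. *)
Lemma cross_kernel_L2 :
  (\int[mu2]_(z in D2) ((off_kernel m z - fine (cross_kernel t z.1 z.2)) ^+ 2 + diag_kernel m z ^+ 2)%:E
    @[m --> \oo] --> 0)%E.
Proof.
have moff m : measurable_fun D2 (off_kernel m).
  exact: (@measurable_grid2 _ _ _ _ _ (fun p q => if p != q then kap_cross (Ms m) (b m) p q else 0)).
have mdiag m : measurable_fun D2 (diag_kernel m).
  exact: (@measurable_grid2 _ _ _ _ _ (fun p q => if p == q then kap_cross (Ms m) (b m) p q else 0)).
have mfine : measurable_fun D2 (fun z => fine (cross_kernel t z.1 z.2)).
  by apply: (@measurableT_comp _ _ _ _ _ _ (@fine R)); [exact: fine_measurable|exact: mcross].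
have mF m : measurable_fun D2
    (fun z => ((off_kernel m z - fine (cross_kernel t z.1 z.2)) ^+ 2 + diag_kernel m z ^+ 2)%:E).
  have h1 := measurable_funX 2 (measurable_funB (moff m) mfine).
  have h2 := measurable_funX 2 (mdiag m).
  by apply/measurable_EFinP; exact: (measurable_funD h1 h2).
have [|||||_ _] := @dominated_convergence _ _ _ mu2 D2 mD2
  (fun m z => ((off_kernel m z - fine (cross_kernel t z.1 z.2)) ^+ 2 + diag_kernel m z ^+ 2)%:E)
  (cst 0%E) (fun z => 2%:E * (cross_kernel t z.1 z.2 * cross_kernel t z.1 z.2))%E.
- exact: mF.
- exact: measurable_cst.
- have [N1 [mN1 N10 sN1]] := @diagonal_negligible R.
  have [N2 [mN2 N20 sN2]] := @integrable_ae _ _ _ mu2 D2 mD2 _ cross_kernel_sqr_integrable.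
  exists (N1 `|` N2); split; first exact: measurableU.
    exact: null_set_setU.
  move=> z /= /not_implyP[Dz h]; apply: contrapT => /not_orP[zN1 zN2]; apply: h.
  have z12 : z.1 != z.2 by apply/eqP => e; apply: zN1; exact: sN1.
  have fz : (cross_kernel t z.1 z.2 * cross_kernel t z.1 z.2)%E \is a fin_num.
    by apply: contrapT => f; apply: zN2; apply: sN2 => /= /(_ Dz).
  have [r rE] : exists r, cross_kernel t z.1 z.2 = r%:E.
    move: fz (cross_ge0 z.1 z.2); move: (cross_kernel t z.1 z.2) => [r _ _|h _|_ h].
    - by exists r.
    - by exfalso; rewrite mulyy in h.
    - by exfalso; move: h; rewrite leNgt ltNy0.
  have [z1 z2] := D2P Dz.
  have E : \forall m \near \oo, ix m z.1 != ix m z.2.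
    have c1 := grid_idx_cvg Ms_gt0 Ms_cvg z1; have c2 := grid_idx_cvg Ms_gt0 Ms_cvg z2.
    have c12 : (ix m z.1)%:R / (Ms m)%:R - (ix m z.2)%:R / (Ms m)%:R @[m --> \oo] --> z.1 - z.2.
      exact: cvgB.
    have zz : 0 < `|z.1 - z.2| by rewrite normr_gt0 subr_eq0.
    near=> m; apply/eqP => e.
    have : `|z.1 - z.2 - ((ix m z.1)%:R / (Ms m)%:R - (ix m z.2)%:R / (Ms m)%:R)| < `|z.1 - z.2|.
      by near: m; exact: cvgr_dist_lt.
    by rewrite e subrr subr0 ltxx.
  have bcr : bc m z @[m --> \oo] --> r.
    by have := bc_cvg Dz; rewrite rE => /fine_cvgP[].
  apply: cvg_EFin; first exact: nearW.
  have c0 : (bc m z - r) ^+ 2 @[m --> \oo] --> (0 : R).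
    have -> : 0 = (r - r) * (r - r) :> R by rewrite subrr mulr0.
    under eq_fun do rewrite expr2.
    by apply: cvgM; apply: cvgB => //; exact: cvg_cst.
  apply: cvg_trans c0; apply: near_eq_cvg; apply: filterS E => m E.
  by rewrite /= /off_kernel /diag_kernel rE E (negbTE E) expr0n addr0.
- by have := @integrableZl _ _ _ mu2 D2 mD2 2 _ cross_kernel_sqr_integrable.
- apply: aeW => z m Dz.
  rewrite gee0_abs ?lee_fin ?addr_ge0 ?sqr_ge0//.
  have := bc_le m Dz; have b0 := bc_ge0 m z; have := cross_ge0 z.1 z.2.
  case: (cross_kernel t z.1 z.2) => [r||]; [|by move=> _ _; rewrite mulyy gt0_muley ?lte_fin// leey|by rewrite leNgt ltNy0].
  rewrite !lee_fin /off_kernel /diag_kernel /= => r0 br.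
  by move: (bc m z) b0 br => c b0 br; case: (ix m z.1 == ix m z.2) => /=; rewrite ?lee_fin; nra.
by rewrite integral0.
Unshelve. all: by end_near. Qed.

End kernel_approximation.

(** * Quadratic forms in the increments on a grid *)

Section grid_nodes.
Context (R : realType).

Lemma grid_node_subproof (M i : nat) : Num.min 1 (i%:R / M%:R : R) \in [set` (`[0%R, 1%R] : interval R)].
Proof. by apply/mem_set; rewrite /= in_itv/= le_min ler01 divr_ge0//= ge_min lexx. Qed.

(** The minimum with 1 gives a point of [[0, 1]] for every index and keeps the sequence
    nondecreasing. *)
Definition grid_node (M i : nat) : I01 R :=
  exist (fun x => x \in [set` (`[0%R, 1%R] : interval R)]) (Num.min 1 (i%:R / M%:R)) (grid_node_subproof M i).

Lemma grid_nodeE M i : (0 < M)%N -> (i <= M)%N -> \val (grid_node M i) = i%:R / M%:R.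
Proof.
by move=> M0 iM /=; apply/min_idPr; rewrite ler_pdivrMr ?ltr0n// mul1r ler_nat.
Qed.

Lemma grid_node_le M i j : (i <= j)%N -> \val (grid_node M i) <= \val (grid_node M j).
Proof.
move=> ij /=; rewrite le_min ge_min lexx/= ge_min; apply/orP; right.
by rewrite ler_wpM2r ?invr_ge0// ler_nat.
Qed.

Lemma dt_grid M i : (i < M)%N -> dt (grid_node M) i = M%:R^-1.
Proof.
move=> iM; have M0 : (0 < M)%N by case: M iM.
by rewrite /dt !grid_nodeE// 1?ltnW// -mulrBl -natrB// subSnn mul1r.
Qed.

End grid_nodes.

(** * Mixed moments of the grid forms *)

Section quadratic_forms.
Context d (T : measurableType d) (R : realType) (P : probability T R).
Variables (W : I01 R -> T -> R).
Hypothesis wW : standard_wiener_process P W.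
Variables (H : R) (M : nat).
Hypothesis M0 : (0 < M)%N.
Notation c := (kap_cov H M).
Notation h := (M%:R^-1 : R).

Let xi (q : nat) := dW W (grid_node R M) q.

(** Discretises the Wiener integral of [fkernel u] at the time of cell [p]; [grid_square] is its
    centered square and [grid_form] a Riemann sum in time. Exchanging the integrals in time and in
    [W] makes the latter approximate the Rosenblatt process divided by its constant. *)
Definition grid_gauss (p : nat) (w : T) : R := \sum_(q < M) kap H M p q * xi q w.
Definition grid_square (p : nat) (w : T) : R := grid_gauss p w ^+ 2 - c p p.
Definition grid_form (r : seq nat) (w : T) : R := \sum_(p <- r) grid_square p w * h.

Local Notation psi := grid_square.
Local Notation Q := grid_form.

Let fxi q : finite_moments P (xi q).
Proof. by apply: (finite_moments_dW wW); exact: grid_node_le. Qed.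

Lemma finite_moments_grid_square p : finite_moments P (psi p).
Proof.
apply: finite_momentsB; last exact: finite_moments_cst.
by apply: finite_momentsX; apply: finite_moments_sum => q; exact: finite_momentsZ.
Qed.

Let fpsi := finite_moments_grid_square.

Lemma finite_moments_grid_form r : finite_moments P (Q r).
Proof.
apply: finite_moments_sum => p; rewrite (_ : (fun w => _) = (fun w => h * psi p w)); last first.
  by apply/funext => w; rewrite mulrC.
exact: finite_momentsZ.
Qed.

Let indxi (B : nat -> set R) : (forall i, measurable (B i)) ->
  (P (\bigcap_(i < M) (xi i @^-1` B i)) = \prod_(i < M) P (xi i @^-1` B i))%E.
Proof. by apply: (indep_dW wW); exact: grid_node_le. Qed.
Let momxi (i : 'I_M) m : Ex P (fun w => xi i w ^+ m) = gaussian_moment h m.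
Proof. by rewrite (Ex_dW wW _ i) ?dt_grid//; exact: grid_node_le. Qed.

Let G (l : seq nat) (k : nat) (q : 'I_M) : R := kap H M (nth 0%N l k) q.
Let GE l k w : lin xi (G l k) w = grid_gauss (nth 0%N l k) w. Proof. by []. Qed.
Let cE l i j : \sum_(k < M) h * G l i k * G l j k = c (nth 0%N l i) (nth 0%N l j).
Proof. by rewrite /kap_cov big_mkord; apply: eq_bigr => k _; rewrite /G; ring. Qed.

Lemma Ex_square2 p q : Ex P (fun w => psi p w * psi q w) = 2 * c p q ^+ 2.
Proof.
have := @Ex_wick2 _ _ _ P _ M (fun=> h) fxi indxi momxi (G [:: p; q]).
by rewrite !cE/= => <-; apply: eq_Ex => w; rewrite !GE.
Qed.

Lemma Ex_square3 p q r : Ex P (fun w => psi p w * psi q w * psi r w) = 8 * c p q * c q r * c r p.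
Proof.
have := @Ex_wick3 _ _ _ P _ M (fun=> h) fxi indxi momxi (G [:: p; q; r]).
by rewrite !cE/= => <-; apply: eq_Ex => w; rewrite !GE.
Qed.

Lemma Ex_square4 p q r s : Ex P (fun w => psi p w * psi q w * psi r w * psi s w) =
  4 * (c p q ^+ 2 * c r s ^+ 2 + c p r ^+ 2 * c q s ^+ 2 + c p s ^+ 2 * c q r ^+ 2) +
  16 * (c p q * c q r * c r s * c s p + c p q * c q s * c s r * c r p + c p r * c r q * c q s * c s p).
Proof.
have := @Ex_wick4 _ _ _ P _ M (fun=> h) fxi indxi momxi (G [:: p; q; r; s]).
by rewrite !cE/= => <-; apply: eq_Ex => w; rewrite !GE.
Qed.

(** The cycles occurring in the moments: [form_V] has two covariances, [form_Y] three, with two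
    vertices in [r]. With four covariances, [form_X] is the cycle whose two vertices in [r] are
    adjacent and [form_X'] the one alternating between [r] and [s]. *)
Definition form_V (r s : seq nat) : R := \sum_(p <- r) \sum_(q <- s) h ^+ 2 * c p q ^+ 2.
Definition form_Y (r s : seq nat) : R :=
  \sum_(p <- r) \sum_(p' <- r) \sum_(q <- s) h ^+ 3 * (c p p' * c p' q * c q p).
Definition form_X (r s : seq nat) : R :=
  \sum_(p <- r) \sum_(p' <- r) \sum_(q <- s) \sum_(q' <- s) h ^+ 4 * (c p p' * c p' q' * c q' q * c q p).
Definition form_X' (r s : seq nat) : R :=
  \sum_(p <- r) \sum_(p' <- r) \sum_(q <- s) \sum_(q' <- s) h ^+ 4 * (c p q * c q p' * c p' q' * c q' p).

Let Ex_sum2 r s (f : nat -> nat -> T -> R) : (forall p q, finite_moments P (f p q)) ->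
  Ex P (fun w => \sum_(p <- r) \sum_(q <- s) f p q w) = \sum_(p <- r) \sum_(q <- s) Ex P (f p q).
Proof.
move=> ff; rewrite Ex_sum; last by move=> p; exact: finite_moments_sum.
by apply: eq_bigr => p _; rewrite Ex_sum.
Qed.

Lemma Ex_form r : Ex P (Q r) = 0.
Proof.
rewrite /Q Ex_sum; last first.
  by move=> p; apply: finite_momentsM => //; exact: finite_moments_cst.
rewrite big1// => p _; rewrite (@eq_Ex _ _ _ P _ (fun w => h * psi p w)); last by move=> w; rewrite mulrC.
rewrite ExZ//; suff -> : Ex P (psi p) = 0 by rewrite mulr0.
rewrite /grid_square ExB; [|by apply: finite_momentsX; apply: finite_moments_sum => q; exact: finite_momentsZ|exact: finite_moments_cst].
rewrite Ex_cst.
have := @Ex_isserlis _ _ _ P _ M (fun=> h) fxi indxi momxi (G [:: p; p]) [:: 0; 1]%N.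
rewrite /= !cE/= => e; apply/eqP; rewrite subr_eq0; apply/eqP.
transitivity (Ex P (fun w => \prod_(i <- [:: 0; 1]%N) lin xi (G [:: p; p] i) w)).
  by apply: eq_Ex => w; rewrite !big_cons big_nil !GE/= mulr1 expr2.
by rewrite e; rewrite /rem_at/=; ring.
Qed.

Lemma Ex_form2 r s : Ex P (fun w => Q r w * Q s w) = 2 * form_V r s.
Proof.
rewrite (@eq_Ex _ _ _ P _ (fun w => \sum_(p <- r) \sum_(q <- s) h ^+ 2 * (psi p w * psi q w))); last first.
  by move=> w; rewrite /Q big_distrlr/=; apply: eq_bigr => p _; apply: eq_bigr => q _; ring.
rewrite Ex_sum2; last by move=> p q; apply: finite_momentsZ; exact: finite_momentsM.
rewrite /form_V mulr_sumr; apply: eq_bigr => p _; rewrite mulr_sumr; apply: eq_bigr => q _.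
rewrite ExZ; last exact: finite_momentsM.
by rewrite Ex_square2; ring.
Qed.

Lemma Ex_form3 r s : Ex P (fun w => Q r w ^+ 2 * Q s w) = 8 * form_Y r s.
Proof.
rewrite (@eq_Ex _ _ _ P _ (fun w => \sum_(p <- r) \sum_(p' <- r) \sum_(q <- s)
    h ^+ 3 * (psi p w * psi p' w * psi q w))); last first.
  move=> w; rewrite expr2 /Q big_distrlr/= mulr_suml; apply: eq_bigr => p _.
  rewrite mulr_suml; apply: eq_bigr => p' _; rewrite mulr_sumr; apply: eq_bigr => q _; ring.
have fm p p' q : finite_moments P (fun w => psi p w * psi p' w * psi q w).
  by apply: finite_momentsM => //; exact: finite_momentsM.
rewrite Ex_sum2; last by move=> p p'; apply: finite_moments_sum => q; exact: finite_momentsZ.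
rewrite /form_Y mulr_sumr; apply: eq_bigr => p _; rewrite mulr_sumr; apply: eq_bigr => p' _.
rewrite mulr_sumr Ex_sum; last by move=> q; exact: finite_momentsZ.
by apply: eq_bigr => q _; rewrite ExZ// Ex_square3; ring.
Qed.

(** Of the three pairs of two-cycles one stays inside [r] and [s] and two join them, giving
    [4 V V + 8 V^2]; of the three four-cycles two are of type [form_X] and one of type [form_X'],
    each with weight 16. *)
Lemma Ex_form4 r s : Ex P (fun w => Q r w ^+ 2 * Q s w ^+ 2) =
  4 * form_V r r * form_V s s + 8 * form_V r s ^+ 2 + 32 * form_X r s + 16 * form_X' r s.
Proof.
rewrite (@eq_Ex _ _ _ P _ (fun w => \sum_(p <- r) \sum_(p' <- r) \sum_(q <- s) \sum_(q' <- s)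
    h ^+ 4 * (psi p w * psi p' w * psi q w * psi q' w))); last first.
  move=> w; have e u : Q u w ^+ 2 = \sum_(p <- u) \sum_(p' <- u) psi p w * h * (psi p' w * h).
    by rewrite expr2 /Q big_distrlr.
  rewrite !e mulr_suml; apply: eq_bigr => p _.
  rewrite mulr_suml; apply: eq_bigr => p' _; rewrite mulr_sumr; apply: eq_bigr => q _.
  rewrite mulr_sumr; apply: eq_bigr => q' _; ring.
have fm p p' q q' : finite_moments P (fun w => psi p w * psi p' w * psi q w * psi q' w).
  by apply: finite_momentsM => //; apply: finite_momentsM => //; exact: finite_momentsM.
rewrite Ex_sum2; last first.
  by move=> p p'; apply: finite_moments_sum => q; apply: finite_moments_sum => q'; exact: finite_momentsZ.
pose f p p' q q' := h ^+ 4 * (4 * (c p p' ^+ 2 * c q q' ^+ 2) + 4 * (c p q ^+ 2 * c p' q' ^+ 2) +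
   4 * (c p q' ^+ 2 * c p' q ^+ 2) + 16 * (c p p' * c p' q * c q q' * c q' p) +
   16 * (c p p' * c p' q' * c q' q * c q p) + 16 * (c p q * c q p' * c p' q' * c q' p)).
transitivity (\sum_(p <- r) \sum_(p' <- r) \sum_(q <- s) \sum_(q' <- s) f p p' q q').
  apply: eq_bigr => p _; apply: eq_bigr => p' _.
  rewrite Ex_sum2; last by move=> q q'; exact: finite_momentsZ.
  by apply: eq_bigr => q _; apply: eq_bigr => q' _; rewrite ExZ// Ex_square4 /f; ring.
have S4 (g : nat -> nat -> nat -> nat -> R) k :
    \sum_(p <- r) \sum_(p' <- r) \sum_(q <- s) \sum_(q' <- s) k * g p p' q q' =
    k * \sum_(p <- r) \sum_(p' <- r) \sum_(q <- s) \sum_(q' <- s) g p p' q q'.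
  rewrite mulr_sumr; apply: eq_bigr => p _; rewrite mulr_sumr; apply: eq_bigr => p' _.
  by rewrite mulr_sumr; apply: eq_bigr => q _; rewrite mulr_sumr.
have e1 : \sum_(p <- r) \sum_(p' <- r) \sum_(q <- s) \sum_(q' <- s) h ^+ 4 * (c p p' ^+ 2 * c q q' ^+ 2) =
    form_V r r * form_V s s.
  rewrite /form_V mulr_suml; apply: eq_bigr => p _; rewrite mulr_suml; apply: eq_bigr => p' _.
  by rewrite mulr_sumr; apply: eq_bigr => q _; rewrite mulr_sumr; apply: eq_bigr => q' _; ring.
have e2 : \sum_(p <- r) \sum_(p' <- r) \sum_(q <- s) \sum_(q' <- s) h ^+ 4 * (c p q ^+ 2 * c p' q' ^+ 2) =
    form_V r s ^+ 2.
  rewrite /form_V expr2 big_distrlr/=; apply: eq_bigr => p _; apply: eq_bigr => p' _.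
  by rewrite big_distrlr/=; apply: eq_bigr => q _; apply: eq_bigr => q' _; ring.
have e3 : \sum_(p <- r) \sum_(p' <- r) \sum_(q <- s) \sum_(q' <- s) h ^+ 4 * (c p q' ^+ 2 * c p' q ^+ 2) =
    form_V r s ^+ 2.
  by rewrite -e2; apply: eq_bigr => p _; apply: eq_bigr => p' _; rewrite exchange_big.
have e4 : \sum_(p <- r) \sum_(p' <- r) \sum_(q <- s) \sum_(q' <- s)
    h ^+ 4 * (c p p' * c p' q * c q q' * c q' p) = form_X r s.
  by apply: eq_bigr => p _; apply: eq_bigr => p' _; rewrite exchange_big.
transitivity (4 * form_V r r * form_V s s + 4 * form_V r s ^+ 2 + 4 * form_V r s ^+ 2 +
   16 * form_X r s + 16 * form_X r s + 16 * form_X' r s); last by ring.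
rewrite -mulrA -e1 -{1}e2 -e3 -{1}e4 /form_X /form_X' -!S4.
rewrite -!big_split/=; apply: eq_bigr => p _; rewrite -!big_split/=; apply: eq_bigr => p' _.
rewrite -!big_split/=; apply: eq_bigr => q _; rewrite -!big_split/=; apply: eq_bigr => q' _.
by rewrite /f; ring.
Qed.

(* With [b = stat_coef N] the linear correction cancels the leading term of the variance of the
   quadratic part. *)
Definition form_stat (I : nat) (r : nat -> seq nat) (b : R) (w : T) : R :=
  \sum_(i < I) (b * (Q (r i) w ^+ 2 - 2 * form_V (r i) (r i)) - 4 * Q (r i) w).

(** Centering cancels the terms [4 V (r i) (r i) V (r j) (r j)]. The cross moments contribute
    [-64 b Y] and the linear ones [32 V], so with the coefficient 4 the terms in [X], [Y], [V] share
    the factor 32. *)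
Lemma Ex_form_stat_sqr I (r : nat -> seq nat) b :
  Ex P (fun w => form_stat I r b w ^+ 2) =
  \sum_(i < I) \sum_(j < I) (b ^+ 2 * (8 * form_V (r i) (r j) ^+ 2 + 16 * form_X' (r i) (r j)) +
    32 * (b ^+ 2 * form_X (r i) (r j) - 2 * b * form_Y (r i) (r j) + form_V (r i) (r j))).
Proof.
have fQ := finite_moments_grid_form.
pose tau i w := b * (Q (r i) w ^+ 2 - 2 * form_V (r i) (r i)) - 4 * Q (r i) w.
have ft i : finite_moments P (tau i).
  apply: finite_momentsB; last exact: finite_momentsZ.
  apply: finite_momentsZ; apply: finite_momentsB; last exact: finite_moments_cst.
  exact: finite_momentsX.
rewrite (@eq_Ex _ _ _ P _ (fun w => \sum_(i < I) \sum_(j < I) tau i w * tau j w)); last first.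
  by move=> w; rewrite expr2 /form_stat big_distrlr.
rewrite Ex_sum; last by move=> i; apply: finite_moments_sum => j; exact: finite_momentsM.
transitivity (\sum_(i < I) \sum_(j < I) (b ^+ 2 * (8 * form_V (r i) (r j) ^+ 2 + 32 * form_X (r i) (r j) +
   16 * form_X' (r i) (r j)) - 32 * b * form_Y (r i) (r j) + 32 * form_V (r i) (r j) - 32 * b * form_Y (r j) (r i))).
  apply: eq_bigr => i _; rewrite Ex_sum; last by move=> j; exact: finite_momentsM.
  apply: eq_bigr => j _.
  pose v1 := 2 * form_V (r i) (r i); pose v2 := 2 * form_V (r j) (r j).
  pose q1 := Q (r i); pose q2 := Q (r j).
  (* The nine monomials of the product of [tau i] and [tau j], each with its coefficient. *)
  pose l := [:: (b ^+ 2, fun w => q1 w ^+ 2 * q2 w ^+ 2); (- b ^+ 2 * v2, fun w => q1 w * q1 w);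
    (- b ^+ 2 * v1, fun w => q2 w * q2 w); (b ^+ 2 * v1 * v2, cst 1); (- 4 * b, fun w => q1 w ^+ 2 * q2 w);
    (4 * b * v1, q2); (- 4 * b, fun w => q2 w ^+ 2 * q1 w); (4 * b * v2, q1); (16, fun w => q1 w * q2 w)].
  have fl k : finite_moments P (nth (0, cst 0) l k).2.
    have f1 : finite_moments P q1 by exact: fQ.
    have f2 : finite_moments P q2 by exact: fQ.
    have f11 := finite_momentsX 2 f1; have f22 := finite_momentsX 2 f2.
    move: k => [|[|[|[|[|[|[|[|[|k]]]]]]]]] /=.
    - exact: (finite_momentsM f11 f22).
    - exact: (finite_momentsM f1 f1).
    - exact: (finite_momentsM f2 f2).
    - exact: finite_moments_cst.
    - exact: (finite_momentsM f11 f2).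
    - exact: f2.
    - exact: (finite_momentsM f22 f1).
    - exact: f1.
    - exact: (finite_momentsM f1 f2).
    - by rewrite nth_nil; exact: finite_moments_cst.
  transitivity (Ex P (fun w => \sum_(k < 9) (nth (0, cst 0) l k).1 * (nth (0, cst 0) l k).2 w)).
    by apply: eq_Ex => w; rewrite !big_ord_recl big_ord0/= /tau -/v1 -/v2 -/q1 -/q2; ring.
  rewrite Ex_sum; last by move=> k; exact: finite_momentsZ.
  rewrite (eq_bigr (fun k : 'I_9 => (nth (0, cst 0) l k).1 * Ex P (nth (0, cst 0) l k).2)); last first.
    by move=> k _; rewrite ExZ.
  rewrite !big_ord_recl big_ord0/= !Ex_form4 !Ex_form3 !Ex_form2 !Ex_form Ex_cst /v1 /v2; ring.
rewrite -[LHS]addr0.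
(* [form_Y] is not symmetric in its two arguments; only its double sum is. *)
have e : \sum_(i < I) \sum_(j < I) (32 * b * form_Y (r j) (r i)) =
    \sum_(i < I) \sum_(j < I) (32 * b * form_Y (r i) (r j)) by rewrite exchange_big.
transitivity (\sum_(i < I) \sum_(j < I) (b ^+ 2 * (8 * form_V (r i) (r j) ^+ 2 + 32 * form_X (r i) (r j) +
   16 * form_X' (r i) (r j)) - 32 * b * form_Y (r i) (r j) + 32 * form_V (r i) (r j)) -
   \sum_(i < I) \sum_(j < I) (32 * b * form_Y (r j) (r i))).
  rewrite addr0 -sumrB; apply: eq_bigr => i _; rewrite -sumrB; apply: eq_bigr => j _; ring.
rewrite e -sumrB; apply: eq_bigr => i _; rewrite -sumrB; apply: eq_bigr => j _; ring.
Qed.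

End quadratic_forms.

Section integral_sqr.
Context d (T : measurableType d) (R : realType) (mu : {measure set T -> \bar R}) (D : set T).
Hypothesis mD : measurable D.
Local Open Scope ereal_scope.

Lemma integral_sqrD_le (f g : T -> R) : measurable_fun D f -> measurable_fun D g ->
  \int[mu]_(x in D) ((f x + g x) ^+ 2)%:E <=
  2%:E * (\int[mu]_(x in D) (f x ^+ 2)%:E + \int[mu]_(x in D) (g x ^+ 2)%:E).
Proof.
move=> mf mg.
have m2 (u : T -> R) : measurable_fun D u -> measurable_fun D (fun x => (u x ^+ 2)%:E).
  by move=> mu'; apply/measurable_EFinP; exact: measurable_funX.
have p2 (u : T -> R) x : 0 <= (u x ^+ 2)%:E by rewrite lee_fin sqr_ge0.
rewrite -ge0_integralD//; [|exact: m2|exact: m2].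
rewrite -ge0_integralZl//; [|by apply: emeasurable_funD; exact: m2|by move=> x _; rewrite adde_ge0].
apply: ge0_le_integral => //.
- by move=> x _; rewrite lee_fin sqr_ge0.
- by apply/measurable_EFinP; apply: measurable_funX; exact: measurable_funD.
- by apply: emeasurable_funM => //; apply: emeasurable_funD; exact: m2.
move=> x _; rewrite -EFinD -EFinM lee_fin; move: (f x) (g x) => a b.
by have := sqr_ge0 (a - b); nra.
Qed.

Lemma integral_sqrD_le_fin (f g : T -> R) (a b : R) : measurable_fun D f -> measurable_fun D g ->
  \int[mu]_(x in D) (f x ^+ 2)%:E <= a%:E -> \int[mu]_(x in D) (g x ^+ 2)%:E <= b%:E ->
  \int[mu]_(x in D) ((f x + g x) ^+ 2)%:E <= (2 * (a + b))%:E.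
Proof.
move=> mf mg fa gb; apply: le_trans (integral_sqrD_le mf mg) _.
by rewrite EFinM [(a + b)%:E]EFinD lee_wpmul2l// leeD.
Qed.

End integral_sqr.

Lemma cvge0P (R : realType) (u : nat -> \bar R) : (forall n, (0 <= u n)%E) ->
  (u n @[n --> \oo] --> 0%E) <-> (forall e : R, 0 < e -> \forall n \near \oo, (u n <= e%:E)%E).
Proof.
move=> u0; split=> [/fine_cvgP[fu /cvgrPdist_le h] e e0|h].
  near=> n; have fn : u n \is a fin_num by near: n.
  rewrite -(fineK fn) lee_fin; apply: le_trans (ler_norm _) _.
  by rewrite -normrN -sub0r; near: n; exact: h.
apply/fine_cvgP; split.
  near=> n; rewrite ge0_fin_numE//; apply: (@le_lt_trans _ _ 1%:E); last exact: ltry.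
  by near: n; exact: h.
apply/cvgrPdist_le => e e0; near=> n.
rewrite sub0r normrN ger0_norm ?fine_ge0//=.
have : (u n <= e%:E)%E by near: n; exact: h.
by have := u0 n; case: (u n).
Unshelve. all: by end_near. Qed.

Section grid_step.
Context (R : realType).
Notation mu := (@lebesgue_measure R).
Notation D1 := (`[0%R, 1%R] `*` `[0%R, 1%R] : set (R * R)).
Notation D2 := (`]0%R, 1%R] `*` `]0%R, 1%R] : set (R * R)).

Definition grid_step (M : nat) (B : nat -> nat -> R) : step_kernel R :=
  @StepKernel R M (grid_node R M) B (@grid_node_le R M).

Lemma step_fun_grid M B z : (0 < M)%N -> D2 z ->
  step_fun (grid_step M B) z =
  if grid_idx M z.1 != grid_idx M z.2 then B (grid_idx M z.1) (grid_idx M z.2) else 0.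
Proof.
move=> M0 [/=]; rewrite !in_itv/= => /andP[x0 x1] /andP[y0 y1].
have cellE x i : 0 < x <= 1 -> (i < M)%N -> \1_(sk_cell (grid_step M B) i) x = (i == grid_idx M x)%:R :> R.
  move=> /andP[u0 u1] iM; rewrite indicE mem_sk_cell.
  rewrite -[sk_node _ i]/(grid_node R M i) -[sk_node _ i.+1]/(grid_node R M i.+1).
  rewrite (grid_nodeE R M0 iM) (grid_nodeE R M0 (ltnW iM)).
  congr (_%:R); congr nat_of_bool; apply/idP/eqP => [h|->]; first by rewrite (grid_idxE M0 h).
  by rewrite grid_idx_gt// grid_idx_le.
have M1 : 1 = M%:R / M%:R :> R by rewrite divff// gt_eqF// ltr0n.
have xM : (grid_idx M z.1 < M)%N by apply: grid_idx_lt => //; rewrite -M1.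
have yM : (grid_idx M z.2 < M)%N by apply: grid_idx_lt => //; rewrite -M1.
rewrite /step_fun /= (bigD1 (Ordinal xM))//= [X in _ + X]big1 ?addr0; last first.
  move=> i ix; rewrite big1// => j _; rewrite cellE ?x0//.
  by rewrite (_ : (i == _ :> nat) = false) ?mulr0 ?mul0r//; apply/negbTE.
rewrite cellE ?x0// eqxx.
case: ifPn => [xy|/negPn/eqP xy].
  rewrite (bigD1 (Ordinal yM))/=; last by rewrite -(inj_eq val_inj)/= eq_sym.
  rewrite cellE ?y0// eqxx !mulr1 big1 ?addr0// => j /andP[_ jy].
  by rewrite cellE ?y0// (_ : (j == _ :> nat) = false) ?mulr0//; apply/negbTE.
rewrite big1// => j jx; rewrite cellE ?y0// (_ : (j == _ :> nat) = false) ?mulr0//.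
by apply/negbTE; rewrite -xy; exact: jx.
Qed.

Lemma step_fun_boundary (s : step_kernel R) z : z.1 <= 0 \/ z.2 <= 0 -> step_fun s z = 0.
Proof.
have c0 i x : x <= 0 -> \1_(sk_cell s i) x = 0 :> R.
  move=> x0; rewrite indicE mem_sk_cell (_ : _ < x = false)//; apply/negbTE.
  rewrite -leNgt; apply: le_trans x0 _.
  by have := set_mem (valP (sk_node s i)); rewrite /= in_itv/= => /andP[].
move=> h; rewrite /step_fun big1// => i _; rewrite big1// => j _.
by case: h => h; rewrite (c0 _ _ h) ?mulr0 ?mul0r.
Qed.

(** The double integral is defined with the closed square, while grid cells cover the square that is
    open at 0. All functions compared vanish on the difference. *)
Lemma integral_boundary (f : R * R -> R) : (forall z, z.1 <= 0 \/ z.2 <= 0 -> f z = 0) ->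
  (\int[(mu \x mu)%E]_(z in D1) (f z ^+ 2)%:E = \int[(mu \x mu)%E]_(z in D2) (f z ^+ 2)%:E)%E.
Proof.
move=> f0; rewrite integral_mkcond [RHS]integral_mkcond; apply: eq_integral => z _.
rewrite !patchE; case: (boolP (z \in D2)) => [/set_mem zD|zD].
  rewrite ifT//; apply/mem_set; case: zD => /=; rewrite !in_itv/= => /andP[? ->] /andP[? ->].
  by rewrite !ltW.
case: ifPn => // /set_mem[/=]; rewrite !in_itv/= => /andP[x0 x1] /andP[y0 y1].
rewrite f0 ?expr0n//.
have [x0'|] := leP z.1 0; first by left.
have [y0'|] := leP z.2 0; first by right.
move=> y x; exfalso; move/negP: zD; apply; apply/mem_set; split => /=; rewrite in_itv/=.
  by rewrite x x1.
by rewrite y y1.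
Qed.

End grid_step.

(** * The Rosenblatt process as an L2 limit of grid forms *)

Section form_approximation.
Context d (T : measurableType d) (R : realType) (P : probability T R).
Variables (W : I01 R -> T -> R).
Hypothesis wW : standard_wiener_process P W.
Variables (H : R) (H12 : 2^-1 < H < 1).
Notation mu := (@lebesgue_measure R).
Notation D2 := (`]0%R, 1%R] `*` `]0%R, 1%R] : set (R * R)).

Section fixed_grid.
Variables (M b : nat).
Hypothesis M0 : (0 < M)%N.
Notation h := (M%:R^-1 : R).
Notation B := (kap_cross H M b).
Let xi (q : nat) := dW W (grid_node R M) q.

Definition diag_form (w : T) : R := \sum_(q < M) B q q * (xi q w ^+ 2 - h).

(** Expanding the squares of [grid_gauss], the products of distinct increments form a step integral;
    the squares of increments, centered by the covariances [c p p], form [diag_form]. *)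
Lemma grid_form_split w :
  grid_form W H M (index_iota 0 b) w = step_integral W (grid_step M B) w + diag_form w.
Proof.
rewrite /grid_form /grid_square.
have e1 : \sum_(0 <= p < b) (grid_gauss W H M p w ^+ 2) * h =
    \sum_(q < M) \sum_(q' < M) B q q' * xi q w * xi q' w.
  transitivity (\sum_(0 <= p < b) \sum_(q < M) \sum_(q' < M)
      kap H M p q * kap H M p q' * h * (xi q w * xi q' w)).
    apply: eq_bigr => p _; rewrite expr2 /grid_gauss big_distrlr/= mulr_suml; apply: eq_bigr => q _.
    by rewrite mulr_suml; apply: eq_bigr => q' _; rewrite /xi; ring.
  rewrite exchange_big/=; apply: eq_bigr => q _; rewrite exchange_big/=; apply: eq_bigr => q' _.
  by rewrite -mulr_suml mulrA.
have e2 : \sum_(0 <= p < b) kap_cov H M p p * h = \sum_(q < M) B q q * h.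
  transitivity (\sum_(0 <= p < b) \sum_(q < M) kap H M p q * kap H M p q * h * h).
    by apply: eq_bigr => p _; rewrite /kap_cov big_mkord mulr_suml.
  by rewrite exchange_big/=; apply: eq_bigr => q _; rewrite mulr_suml.
under eq_bigr do rewrite mulrBl.
rewrite sumrB e1 e2 /step_integral /diag_form/=.
under [X in _ = _ + X]eq_bigr do rewrite mulrBr.
rewrite sumrB addrA; congr (_ - _); rewrite -big_split/=; apply: eq_bigr => q _.
by rewrite (bigD1 q)//= addrC; congr (_ + _); rewrite expr2 mulrA.
Qed.

Let fxi q : finite_moments P (xi q).
Proof. by apply: (finite_moments_dW wW); exact: grid_node_le. Qed.

Let indxi (C : nat -> set R) : (forall i, measurable (C i)) ->
  (P (\bigcap_(i < M) (xi i @^-1` C i)) = \prod_(i < M) P (xi i @^-1` C i))%E.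
Proof. by apply: (indep_dW wW); exact: grid_node_le. Qed.

Let momxi (i : 'I_M) m : Ex P (fun w => xi i w ^+ m) = gaussian_moment h m.
Proof. by rewrite (Ex_dW wW _ i) ?dt_grid//; exact: grid_node_le. Qed.

Let fsq q : finite_moments P (fun w => xi q w ^+ 2 - h).
Proof. by apply: finite_momentsB; [exact: finite_momentsX|exact: finite_moments_cst]. Qed.

Lemma finite_moments_diag_form : finite_moments P diag_form.
Proof. by apply: finite_moments_sum => q; exact: finite_momentsZ. Qed.

Lemma Ex_diag_form_sqr : Ex P (fun w => diag_form w ^+ 2) = 2 * \sum_(q < M) B q q ^+ 2 * h ^+ 2.
Proof.
have E2 (q q' : 'I_M) : Ex P (fun w => (xi q w ^+ 2 - h) * (xi q' w ^+ 2 - h)) = 2 * (h * (q == q')%:R) ^+ 2.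
  pose G (k : nat) (j : 'I_M) : R := (j == nth q [:: q; q'] k)%:R.
  have lG k w : lin xi (G k) w = xi (nth q [:: q; q'] k) w.
    rewrite /lin (bigD1 (nth q [:: q; q'] k))//= /G eqxx mul1r big1 ?addr0// => j jk.
    by rewrite (negbTE jk) mul0r.
  have cG k l : \sum_(j < M) h * G k j * G l j = h * (nth q [:: q; q'] k == nth q [:: q; q'] l)%:R.
    rewrite (bigD1 (nth q [:: q; q'] k))//= /G eqxx mulr1 big1 ?addr0// => j jk.
    by rewrite (negbTE jk) mulr0 mul0r.
  have := @Ex_wick2 _ _ _ P _ M (fun=> h) fxi indxi momxi G.
  by rewrite !cG/= !eqxx !mulr1 => <-; apply: eq_Ex => w; rewrite !lG.
rewrite (@eq_Ex _ _ _ P _ (fun w => \sum_(q < M) \sum_(q' < M)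
    B q q * B q' q' * ((xi q w ^+ 2 - h) * (xi q' w ^+ 2 - h)))); last first.
  move=> w; rewrite expr2 /diag_form big_distrlr/=; apply: eq_bigr => q _; apply: eq_bigr => q' _; ring.
rewrite Ex_sum; last by move=> q; apply: finite_moments_sum => q'; apply: finite_momentsZ; exact: finite_momentsM.
rewrite mulr_sumr; apply: eq_bigr => q _; rewrite Ex_sum; last first.
  by move=> q'; apply: finite_momentsZ; exact: finite_momentsM.
rewrite (bigD1 q)//= ExZ; last exact: finite_momentsM.
rewrite E2 eqxx mulr1 big1 ?addr0 => [|q' q'q]; first ring.
by rewrite ExZ; [rewrite E2 eq_sym (negbTE q'q) mulr0 expr0n !mulr0|exact: finite_momentsM].
Qed.

Lemma measurable_step_integral (s : step_kernel R) : measurable_fun setT (step_integral W s).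
Proof.
apply: measurable_sum => i; under eq_fun do rewrite big_mkcond/=.
apply: measurable_sum => j; case: (j != i) => //.
by apply: measurable_funM; [apply: measurable_funM => //|]; exact: (measurable_incr wW).
Qed.

End fixed_grid.

Variables (Ms b : nat -> nat) (t : R).
Hypothesis Ms_gt0 : forall m, (0 < Ms m)%N.
Hypothesis Ms_cvg : (Ms m)%:R^-1 @[m --> \oo] --> (0 : R).
Hypothesis bM : forall m, (b m <= Ms m)%N.
Hypothesis bt : forall m, (b m)%:R / (Ms m)%:R = t.
Notation C := (rosenblatt_constant H).

Let Kerr m := (\int[(mu \x mu)%E]_(z in D2)
  ((off_kernel H Ms b m z - fine (cross_kernel H t z.1 z.2)) ^+ 2 + diag_kernel H Ms b m z ^+ 2)%:E)%E.

(** The step kernels [s n] supplied by the definition of the double integral are compared with the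
    grid step kernels [s' m] through the L2 bound for step integrals; what then separates [s' m]
    from the grid form is the diagonal form. *)
Lemma grid_form_L2 (Y : T -> R) : is_double_integral P W (rosenblatt_kernel H t) Y ->
  (\int[P]_w ((Y w - C * grid_form W H (Ms m) (index_iota 0 (b m)) w) ^+ 2)%:E @[m --> \oo] --> 0)%E.
Proof.
move=> [mY [s [fs Ys]]].
pose f := rosenblatt_kernel H t.
pose s' m := grid_step (Ms m) (fun q q' => C * kap_cross H (Ms m) (b m) q q').
have mD2 : measurable D2 by apply: measurableX; exact: measurable_itv.
have D2P z : D2 z -> 0 < z.1 /\ 0 < z.2.
  by move=> [] /=; rewrite !in_itv/= => /andP[? _] /andP[? _].
have fE z : D2 z -> f z = C * fine (cross_kernel H t z.1 z.2).
  by case: z => x y /D2P[x0 y0]; exact: rosenblatt_kernelE.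
have mcr := measurable_cross_kernel H12 Ms_gt0 Ms_cvg bt.
have mfine : measurable_fun D2 (fun z => fine (cross_kernel H t z.1 z.2)).
  by apply: (@measurableT_comp _ _ _ _ _ _ (@fine R)); [exact: fine_measurable|exact: mcr].
have mf : measurable_fun D2 f.
  apply: (@eq_measurable_fun _ _ _ _ D2 (fun z => C * fine (cross_kernel H t z.1 z.2))).
    by move=> z /set_mem zD; rewrite fE.
  exact: measurable_funM.
have f0 z : z.1 <= 0 \/ z.2 <= 0 -> f z = 0.
  case: z => x y /= h; rewrite /f /rosenblatt_kernel indicE (_ : _ \in _ = false) ?mulr0//.
  apply/negbTE/negP => /set_mem[/=]; rewrite !in_itv/= => /andP[x0 _] /andP[y0 _].
  by case: h => h; [have := lt_le_trans x0 h|have := lt_le_trans y0 h]; rewrite ltxx.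
have moff m : measurable_fun D2 (off_kernel H Ms b m).
  exact: (@measurable_grid2 _ _ _ _ _ (fun p q => if p != q then kap_cross H (Ms m) (b m) p q else 0)).
have mdiag m : measurable_fun D2 (diag_kernel H Ms b m).
  exact: (@measurable_grid2 _ _ _ _ _ (fun p q => if p == q then kap_cross H (Ms m) (b m) p q else 0)).
have mE m : measurable_fun D2
    (fun z => ((off_kernel H Ms b m z - fine (cross_kernel H t z.1 z.2)) ^+ 2 + diag_kernel H Ms b m z ^+ 2)%:E).
  have h1 := measurable_funX 2 (measurable_funB (moff m) mfine).
  have h2 := measurable_funX 2 (mdiag m).
  by apply/measurable_EFinP; exact: (measurable_funD h1 h2).
have C2 : 0 <= C ^+ 2 by exact: sqr_ge0.
have offK m (dl : R) : (Kerr m <= dl%:E)%E ->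
    (\int[(mu \x mu)%E]_(z in D2) ((f z - step_fun (s' m) z) ^+ 2)%:E <= (C ^+ 2 * dl)%:E)%E.
  move=> Kd; apply: (@le_trans _ _ ((C ^+ 2)%:E * Kerr m)%E); last first.
    by rewrite [leRHS]EFinM lee_wpmul2l.
  rewrite /Kerr -ge0_integralZl//; [|exact: mE|by move=> z _; rewrite lee_fin addr_ge0 ?sqr_ge0].
  apply: ge0_le_integral => //.
  - by move=> z _; rewrite lee_fin sqr_ge0.
  - apply/measurable_EFinP; apply: measurable_funX; apply: measurable_funB; first exact: mf.
    exact: measurable_funS (measurable_step_fun _).
  - by apply: emeasurable_funM => //; exact: mE.
  move=> z zD; rewrite fE// step_fun_grid// -EFinM lee_fin.
  rewrite (_ : (if _ then _ else 0) = C * off_kernel H Ms b m z); last first.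
    by rewrite /off_kernel; case: ifP => _; rewrite ?mulr0.
  rewrite -mulrBr exprMn ler_wpM2l// -sqrrN opprB lerDl sqr_ge0//.
have diagK m (dl : R) : (Kerr m <= dl%:E)%E ->
    (\int[P]_w ((C * diag_form (Ms m) (b m) w) ^+ 2)%:E <= (C ^+ 2 * (2 * dl))%:E)%E.
  move=> Kd; have fD : finite_moments P (diag_form (Ms m) (b m)) by exact: finite_moments_diag_form.
  rewrite (_ : (fun w => _) = (fun w => (C ^+ 2 * diag_form (Ms m) (b m) w ^+ 2)%:E)); last first.
    by apply/funext => w; rewrite exprMn.
  rewrite ExE; last by apply: finite_momentsZ; exact: finite_momentsX.
  rewrite ExZ; last exact: finite_momentsX.
  rewrite Ex_diag_form_sqr// lee_fin ler_wpM2l// ler_pM2l// -lee_fin.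
  apply: le_trans Kd; apply: (@le_trans _ _ (\int[(mu \x mu)%E]_(z in D2) (diag_kernel H Ms b m z ^+ 2)%:E)%E); last first.
    apply: ge0_le_integral => //.
    - by move=> z _; rewrite lee_fin sqr_ge0.
    - by apply/measurable_EFinP; apply: measurable_funX; exact: mdiag.
    - exact: mE.
    - by move=> z _; rewrite lee_fin lerDr sqr_ge0.
  apply: (@le_trans _ _ (\int[(mu \x mu)%E]_(z in D2)
    ((fun p q => if p == q then kap_cross H (Ms m) (b m) p q ^+ 2 else 0) (grid_idx (Ms m) z.1) (grid_idx (Ms m) z.2))%:E)%E); last first.
    rewrite le_eqVlt; apply/orP; left; apply/eqP.
    by apply: eq_integral => z _; rewrite /diag_kernel; case: ifP => _; rewrite ?expr0n.
  rewrite (@integral_grid2 R (Ms m) (fun p q => if p == q then kap_cross H (Ms m) (b m) p q ^+ 2 else 0))//;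
    last by move=> p q; case: ifP => _; rewrite ?sqr_ge0.
  rewrite lee_fin le_eqVlt; apply/orP; left; apply/eqP; rewrite big_mkord; apply: eq_bigr => q _.
  rewrite big_mkord (bigD1 q)//= eqxx big1 ?addr0 => [|q' q'q]; first by rewrite expr2 mulrA.
  by rewrite ifN ?mul0r// eq_sym.
have mI s0 : measurable_fun setT (step_integral W s0) by exact: measurable_step_integral.
have mQ m : measurable_fun setT (diag_form (Ms m) (b m)).
  by have [] : finite_moments P (diag_form (Ms m) (b m)) by exact: finite_moments_diag_form.
apply/cvge0P => [m|e e0]; first by apply: integral_ge0 => w _; rewrite lee_fin sqr_ge0.
(* The nested bounds [E1] to [E4] add up to [(18 + 24 C^2) dl], which is at most [e]. *)
pose dl := e / (36 + 24 * C ^+ 2).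
have den0 : 0 < 36 + 24 * C ^+ 2 by lra.
have dl0 : 0 < dl by rewrite divr_gt0.
have [n [an en]] : exists n,
    (\int[P]_w ((step_integral W (s n) w - Y w) ^+ 2)%:E <= dl%:E)%E /\
    (\int[(mu \x mu)%E]_(z in `[0%R, 1%R] `*` `[0%R, 1%R]) ((step_fun (s n) z - f z) ^+ 2)%:E <= dl%:E)%E.
  have h1 : \forall n \near \oo, (\int[P]_w ((step_integral W (s n) w - Y w) ^+ 2)%:E <= dl%:E)%E.
    by move/cvge0P : Ys; apply => // n; apply: integral_ge0 => w _; rewrite lee_fin sqr_ge0.
  have h2 : \forall n \near \oo, (\int[(mu \x mu)%E]_(z in `[0%R, 1%R] `*` `[0%R, 1%R])
      ((step_fun (s n) z - f z) ^+ 2)%:E <= dl%:E)%E.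
    by move/cvge0P : fs; apply => // n; apply: integral_ge0 => w _; rewrite lee_fin sqr_ge0.
  have [N _ hN] := filterI h1 h2; exists N; exact: (hN N (leqnn N)).
have Kcv := cross_kernel_L2 H12 Ms_gt0 Ms_cvg bM bt.
have : \forall m \near \oo, (Kerr m <= dl%:E)%E.
  by move/cvge0P : Kcv; apply => // m; apply: integral_ge0 => w _; rewrite lee_fin addr_ge0 ?sqr_ge0.
apply: filterS => m Km.
have E1 : (\int[(mu \x mu)%E]_(z in D2) ((step_fun (s n) z - step_fun (s' m) z) ^+ 2)%:E <=
    (2 * (dl + C ^+ 2 * dl))%:E)%E.
  under eq_integral => z _ do rewrite -(subrKA (f z)).
  apply: integral_sqrD_le_fin => //.
  - by apply: measurable_funB => //; exact: measurable_funS (measurable_step_fun _).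
  - by apply: measurable_funB => //; exact: measurable_funS (measurable_step_fun _).
  - rewrite -integral_boundary// => z h.
    by rewrite f0// step_fun_boundary// subrr.
  - exact: offK.
have E2 : (\int[P]_w ((step_integral W (s n) w - step_integral W (s' m) w) ^+ 2)%:E <=
    (2 * (2 * (dl + C ^+ 2 * dl)))%:E)%E.
  apply: le_trans (step_isometry (s n) (s' m) wW) _.
  rewrite integral_boundary; first by rewrite [leRHS]EFinM lee_wpmul2l.
  by move=> z h; rewrite !step_fun_boundary// subrr.
have E3 : (\int[P]_w ((step_integral W (s n) w - step_integral W (s' m) w +
    - (C * diag_form (Ms m) (b m) w)) ^+ 2)%:E <=
    (2 * (2 * (2 * (dl + C ^+ 2 * dl)) + C ^+ 2 * (2 * dl)))%:E)%E.
  apply: integral_sqrD_le_fin => //; first exact: measurable_funB.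
    by apply: measurableT_comp => //; exact: measurable_funM.
  by under eq_integral do rewrite sqrrN; exact: diagK.
have E4 : (\int[P]_w ((Y w - step_integral W (s n) w + (step_integral W (s n) w - step_integral W (s' m) w +
    - (C * diag_form (Ms m) (b m) w))) ^+ 2)%:E <=
    (2 * (dl + 2 * (2 * (2 * (dl + C ^+ 2 * dl)) + C ^+ 2 * (2 * dl))))%:E)%E.
  apply: integral_sqrD_le_fin => //; first exact: measurable_funB.
    apply: measurable_funD; first exact: measurable_funB.
    by apply: measurableT_comp => //; exact: measurable_funM.
  by under eq_integral do rewrite -sqrrN opprB.
rewrite (_ : (fun w => _) = (fun w => ((Y w - step_integral W (s n) w +
    (step_integral W (s n) w - step_integral W (s' m) w + - (C * diag_form (Ms m) (b m) w))) ^+ 2)%:E)); last first.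
  apply/funext => w; congr (_ ^+ 2)%:E; rewrite grid_form_split.
  have -> : step_integral W (s' m) w = C * step_integral W (grid_step (Ms m) (kap_cross H (Ms m) (b m))) w.
    rewrite /step_integral mulr_sumr; apply: eq_bigr => i _; rewrite mulr_sumr; apply: eq_bigr => j _ /=.
    by rewrite !mulrA.
  by ring.
apply: le_trans E4 _; rewrite lee_fin (_ : e = dl * (36 + 24 * C ^+ 2)); last first.
  by rewrite /dl divfK// gt_eqF.
by nra.
Qed.

End form_approximation.

(** * The second moment of the statistic *)

Definition block (k i : nat) : seq nat := index_iota (i * k) (i.+1 * k).

Definition ndist (i j : nat) : nat := ((i - j) + (j - i))%N.

Lemma sum_blocks (R : zmodType) (k N : nat) (f : nat -> R) :
  \sum_(i < N) \sum_(p <- block k i) f p = \sum_(0 <= p < N * k) f p.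
Proof.
elim: N => [|N IH]; first by rewrite big_ord0 mul0n big_geq.
rewrite big_ord_recr/= IH [RHS](@big_cat_nat _ _ _ (N * k))//=.
by rewrite leq_mul2r leqnSn orbT.
Qed.

Lemma mem_block k i p : (p \in block k i) = (i * k <= p < i.+1 * k)%N.
Proof. by rewrite mem_index_iota. Qed.

Section near_far_sums.
Context (R : realType).

(** In each of the [N] rows every distance occurs at most twice. *)
Lemma ler_sum_ndist (g : nat -> R) N : (forall k, 0 <= g k) ->
  \sum_(i < N) \sum_(j < N) g (ndist i j) <= 2 * N%:R * \sum_(0 <= k < N) g k.
Proof.
move=> g0; set S := \sum_(0 <= k < N) g k.
have row i : (i < N)%N -> \sum_(0 <= j < N) g (ndist i j) <= 2 * S.
  move=> iN; rewrite (@big_cat_nat _ _ _ i)//= ?(ltnW iN)//.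
  have h1 : \sum_(0 <= j < i) g (ndist i j) <= S.
    have -> : S = \sum_(0 <= k < i) g k.+1 + (g 0%N + \sum_(i.+1 <= k < N) g k).
      by rewrite /S (@big_cat_nat _ _ _ i.+1)//= big_nat_recl//; ring.
    rewrite big_nat_rev/= add0n -[leLHS]addr0; apply: lerD; last by rewrite addr_ge0// sumr_ge0.
    rewrite le_eqVlt; apply/orP; left; apply/eqP; apply: eq_big_nat => j /andP[_ ji].
    by congr g; rewrite /ndist; lia.
  have h2 : \sum_(i <= j < N) g (ndist i j) <= S.
    have -> : S = \sum_(0 <= k < N - i) g k + \sum_(N - i <= k < N) g k.
      by rewrite /S (@big_cat_nat _ _ _ (N - i))//= leq_subr.
    rewrite -{1}(add0n i) big_addn -[leLHS]addr0; apply: lerD; last by rewrite sumr_ge0.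
    rewrite le_eqVlt; apply/orP; left; apply/eqP; apply: eq_big_nat => j /andP[_ ji].
    by congr g; rewrite /ndist; lia.
  by rewrite [leRHS](_ : _ = S + S) ?lerD//; ring.
apply: (@le_trans _ _ (\sum_(i < N) 2 * S)).
  by apply: ler_sum => i _; have := row i (ltn_ord i); rewrite big_mkord.
by rewrite sumr_const card_ord -[_ *+ N]mulr_natr le_eqVlt; apply/orP; left; apply/eqP; ring.
Qed.

(* Bounds, up to a factor N^(-2H), the contribution of two blocks at distance [k]. *)
Definition gap_weight (p : R) (k : nat) : R :=
  if (k <= 1)%N then 1 else (k.-1%:R : R) `^ p - (k.+1%:R : R) `^ p.

Lemma gap_weight_ge0 p k : p <= 0 -> 0 <= gap_weight p k.
Proof.
move=> p0; rewrite /gap_weight; case: ifPn => //; rewrite -ltnNge => k1.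
rewrite subr_ge0; apply: powR_anti => //; first by rewrite ltr0n; lia.
by rewrite ler_nat; lia.
Qed.

(** The weights telescope with step two to [3 + 2^p - (m+1)^p - (m+2)^p]. The bound is uniform in
    [n], although [k^p] itself is not summable for the exponent [2H - 2 > -1] in use. *)
Lemma gap_weight_sum p n : p <= 0 -> \sum_(0 <= k < n) gap_weight p k <= 4.
Proof.
move=> p0.
have le1 k : (0 < k)%N -> (k%:R : R) `^ p <= 1.
  move=> k0; rewrite -[leRHS](_ : 1 `^ p = 1); last by rewrite powR1.
  by apply: powR_anti; rewrite ?ler1n.
have E m : \sum_(0 <= k < m.+2) gap_weight p k =
    3 + (2%:R : R) `^ p - (m.+1%:R : R) `^ p - (m.+2%:R : R) `^ p.
  elim: m => [|m IH].
    by rewrite !big_nat_recr//= big_geq// /gap_weight/= powR1; ring.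
  by rewrite big_nat_recr//= IH /gap_weight/=; ring.
case: n => [|[|n]].
- by rewrite big_geq.
- by rewrite big_nat1 /gap_weight/=; lra.
rewrite E; have := le1 2%N isT; have := powR_ge0 n.+1%:R p; have := powR_ge0 n.+2%:R p; lra.
Qed.

End near_far_sums.

(** * Bounds for pairs of blocks *)

Section block_bounds.
Context (R : realType) (H : R).
Hypothesis H12 : 2^-1 < H < 1.
Variables (N k : nat).
Hypotheses (N0 : (0 < N)%N) (k0 : (0 < k)%N).
Notation M := (N * k)%N.
Notation c := (kap_cov H M).
Notation h := (M%:R^-1 : R).
Notation B := (beta_real H).
Notation V := (form_V H M).
Notation X := (form_X H M).
Notation X' := (form_X' H M).
Notation Y := (form_Y H M).
Notation bl := (block k).

Let M0 : (0 < M)%N. Proof. by rewrite muln_gt0 N0. Qed.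
Let h0 : 0 <= h. Proof. by rewrite invr_ge0. Qed.
Let B0 : 0 <= B. Proof. by apply: le_trans (beta_real_ge1 H12). Qed.
Let c0 p q : 0 <= c p q. Proof. exact: kap_cov_ge0. Qed.

Let ihalf : 2^-1 < H. Proof. by case/andP: H12. Qed.
Let iH1 : H < 1. Proof. by case/andP: H12. Qed.

Let K1 := 2 * B ^+ 2 / (2 * H - 1).

Lemma block_ratio i : (i * k)%:R / M%:R = i%:R / N%:R :> R.
Proof. by rewrite !natrM; field; rewrite !pnatr_eq0 -!lt0n N0 k0. Qed.

Let block_itv i : (i < N)%N -> (i * k <= i.+1 * k <= M)%N.
Proof. by move=> iN; rewrite !leq_mul2r leqnSn iN !orbT. Qed.

Let block_len i : (i.+1 * k - i * k)%:R / M%:R = N%:R^-1 :> R.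
Proof. by rewrite -mulnBl subSnn mul1n -[k in k%:R]mul1n block_ratio mul1r. Qed.

Let block_lt i p : (i < N)%N -> p \in bl i -> (p < M)%N.
Proof. by move=> iN; rewrite mem_block => /andP[_ h']; apply: leq_trans h' _; rewrite leq_mul2r iN orbT. Qed.

Let sum_block_const i (x : R) : \sum_(p <- bl i) x * h = x / N%:R.
Proof.
rewrite /block big_const_seq count_predT size_iota -Monoid.iteropE.
rewrite -[iterop _ _ _ _]/((x * h) *+ _) -mulr_natr -mulrA [h * _]mulrC.
by rewrite block_len.
Qed.

Lemma form_V_ge0 r s : 0 <= V r s.
Proof. by apply: sumr_ge0 => p _; apply: sumr_ge0 => q _; rewrite mulr_ge0 ?exprn_ge0. Qed.

Lemma form_Y_ge0 r s : 0 <= Y r s.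
Proof.
apply: sumr_ge0 => p _; apply: sumr_ge0 => p' _; apply: sumr_ge0 => q _.
by rewrite mulr_ge0 ?exprn_ge0// !mulr_ge0.
Qed.

Lemma form_V_le i j : (i < N)%N -> (j < N)%N -> V (bl i) (bl j) <= K1 * (N%:R : R) `^ (- (2 * H)).
Proof.
move=> iN jN.
have row p : p \in bl i -> \sum_(q <- bl j) h ^+ 2 * c p q ^+ 2 <= K1 * N%:R^-1 `^ (2 * H - 1) * h.
  move=> pi; have := kap_cov_sqr_row_le H12 (block_lt iN pi) (block_itv jN).
  rewrite block_len => h1; rewrite (_ : \sum_(_ <- _) _ = (\sum_(q <- bl j) c p q ^+ 2 / M%:R) * h); last first.
    by rewrite mulr_suml; apply: eq_bigr => q _; rewrite expr2; ring.
  by rewrite ler_wpM2r//; apply: le_trans h1 _; rewrite /K1 mulrAC.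
rewrite /form_V big_seq; apply: (@le_trans _ _ (\sum_(p <- bl i | p \in bl i) K1 * N%:R^-1 `^ (2 * H - 1) * h)).
  exact: ler_sum.
rewrite -big_seq sum_block_const -mulrA le_eqVlt; apply/orP; left; apply/eqP; congr (_ * _).
have Nn : N%:R != 0 :> R by rewrite pnatr_eq0 -lt0n.
rewrite -{2}[_^-1]powRr1 ?invr_ge0// -powRD; last by rewrite invr_eq0 Nn implybT.
by rewrite -powR_inv1// -powRrM; congr (_ `^ _); ring.
Qed.

Lemma form_V_sum_le : \sum_(i < N) \sum_(j < N) V (bl i) (bl j) <= K1.
Proof.
apply: le_trans (kap_cov_sqr_sum_le H12 M0 (leqnn M)).
rewrite le_eqVlt; apply/orP; left; apply/eqP.
under eq_bigr do rewrite /form_V exchange_big/=.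
transitivity (\sum_(i < N) \sum_(p <- bl i) \sum_(0 <= q < M) h ^+ 2 * c p q ^+ 2).
  apply: eq_bigr => i _; apply: eq_bigr => p _.
  exact: (sum_blocks k N (fun q => h ^+ 2 * c p q ^+ 2)).
rewrite (sum_blocks k N (fun p => \sum_(0 <= q < M) h ^+ 2 * c p q ^+ 2)).
apply: eq_bigr => p _; rewrite mulr_suml; apply: eq_bigr => q _; ring.
Qed.

Definition far_cov (l : nat) : R := B * (l%:R / N%:R) `^ (H - 1).

Lemma far_cov_ge0 l : 0 <= far_cov l. Proof. by rewrite mulr_ge0 ?powR_ge0. Qed.

(** Sample points of two blocks at distance [k >= 2] are at least [(k-1)/N] apart, and the
    covariance decreases with the distance. *)
Lemma kap_cov_far i j p q : (i < N)%N -> (j < N)%N -> (2 <= ndist i j)%N ->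
  p \in bl i -> q \in bl j -> c p q <= far_cov (ndist i j).-1.
Proof.
move=> iN jN; wlog ij : i j p q iN jN / (i <= j)%N => [wh d pi qj|].
  case: (leqP i j) => [ij|/ltnW ji]; first exact: wh.
  have e : ndist i j = ndist j i by rewrite /ndist addnC.
  by rewrite kap_covC e; apply: wh => //; rewrite -e.
move=> d pi qj.
have [pM qM] := (block_lt iN pi, block_lt jN qj).
move: pi qj; rewrite !mem_block => /andP[p1 p2] /andP[q1 q2].
have M0' : 0 < M%:R :> R by rewrite ltr0n.
have nd : ndist i j = (j - i)%N by rewrite /ndist; lia.
have node r : (r < M)%N -> 0 < (r.+1%:R / M%:R : R) <= 1.
  by move=> rM; rewrite divr_gt0 ?ltr0n//= ler_pdivrMr ?ltr0n// mul1r ler_nat.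
have idx r : grid_idx M (r.+1%:R / M%:R : R) = r.
  by apply: grid_idxE => //; rewrite lexx andbT ltr_pM2r ?invr_gt0// ltr_nat.
have far : ((ndist i j).-1%:R / N%:R : R) <= q.+1%:R / M%:R - p.+1%:R / M%:R.
  rewrite -(block_ratio (ndist i j).-1) -mulrBl ler_pM2r ?invr_gt0//.
  rewrite -natrB; last by nia.
  by rewrite ler_nat nd; nia.
have pos : 0 < ((ndist i j).-1%:R / N%:R : R) by rewrite divr_gt0// ltr0n; lia.
have := @kap_cov_abs_le R H H12 M _ _ M0 (node p pM) (node q qM); rewrite !idx.
move=> h1; apply: le_trans (h1 _) _.
  by rewrite -subr_eq0 -normr_gt0 distrC; apply: lt_le_trans (ler_norm _); apply: lt_le_trans pos far.
rewrite /far_cov ler_wpM2l//; apply: powR_anti => //; first by rewrite subr_le0 ltW.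
by rewrite distrC; apply: le_trans (ler_norm _).
Qed.

Lemma form_V_far i j : (i < N)%N -> (j < N)%N -> (2 <= ndist i j)%N ->
  V (bl i) (bl j) <= far_cov (ndist i j).-1 ^+ 2 / N%:R ^+ 2.
Proof.
move=> iN jN d; set rho := far_cov _.
apply: (@le_trans _ _ (\sum_(p <- bl i) \sum_(q <- bl j) rho ^+ 2 * h * h)).
  rewrite /form_V big_seq [leRHS]big_seq; apply: ler_sum => p pi.
  rewrite big_seq [leRHS]big_seq; apply: ler_sum => q qj.
  rewrite (_ : rho ^+ 2 * h * h = h ^+ 2 * rho ^+ 2); last by ring.
  rewrite ler_wpM2l ?exprn_ge0// lerXn2r ?nnegrE ?far_cov_ge0//.
  exact: kap_cov_far.
under eq_bigr do rewrite (sum_block_const j (rho ^+ 2 * h)) [rho ^+ 2 * h / _]mulrAC.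
by rewrite (sum_block_const i (rho ^+ 2 / N%:R)) -mulrA -invfM -expr2.
Qed.

(** Two of the four covariances join the blocks and are at most [rho] each; the other two stay
    inside a block and sum to at most the block masses. *)
Lemma form_X_far i j : (i < N)%N -> (j < N)%N -> (2 <= ndist i j)%N ->
  X (bl i) (bl j) <= far_cov (ndist i j).-1 ^+ 2 * block_mass H N%:R^-1 ^+ 2.
Proof.
move=> iN jN d; set rho := far_cov _.
have r0 : 0 <= rho by exact: far_cov_ge0.
pose S l := \sum_(p <- bl l) (\sum_(q <- bl l) c p q / M%:R) / M%:R.
have SE l : (l < N)%N -> 0 <= S l <= block_mass H N%:R^-1.
  move=> lN; rewrite sumr_ge0/=; last by move=> p _; rewrite divr_ge0// sumr_ge0// => q _; rewrite divr_ge0.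
  by have := kap_cov_block_le H12 M0 (block_itv lN); rewrite block_len.
have /andP[Si0 Si] := SE i iN; have /andP[Sj0 Sj] := SE j jN.
apply: (@le_trans _ _ (rho ^+ 2 * (S i * S j))); last first.
  by rewrite ler_wpM2l ?exprn_ge0// [leRHS]expr2 ler_pM.
have -> : rho ^+ 2 * (S i * S j) = \sum_(p <- bl i) \sum_(p' <- bl i) \sum_(q <- bl j) \sum_(q' <- bl j)
    h ^+ 4 * (rho ^+ 2 * (c p p' * c q q')).
  rewrite /S mulr_suml mulr_sumr; apply: eq_bigr => p _.
  rewrite !mulr_suml mulr_sumr; apply: eq_bigr => p' _.
  rewrite mulr_sumr mulr_sumr; apply: eq_bigr => q _.
  by rewrite mulr_suml !mulr_sumr; apply: eq_bigr => q' _; ring.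
rewrite /form_X big_seq [leRHS]big_seq; apply: ler_sum => p pi.
rewrite big_seq [leRHS]big_seq; apply: ler_sum => p' p'i.
rewrite big_seq [leRHS]big_seq; apply: ler_sum => q qj.
rewrite big_seq [leRHS]big_seq; apply: ler_sum => q' q'j.
rewrite ler_wpM2l ?exprn_ge0// (kap_covC _ _ q').
have a1 : c p' q' <= rho by exact: kap_cov_far.
have a2 : c q p <= rho by rewrite kap_covC; exact: kap_cov_far.
have a3 : c p' q' * c q p <= rho ^+ 2 by rewrite expr2 ler_pM.
rewrite (_ : _ * _ * _ * _ = c p' q' * c q p * (c p p' * c q q')); last by ring.
by rewrite ler_wpM2r// mulr_ge0.
Qed.

Let sum4 r s (f : nat -> nat -> nat -> nat -> R) (g : nat -> nat -> nat -> nat -> R) :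
  (forall p p' q q', f p p' q q' <= g p p' q q') ->
  \sum_(p <- r) \sum_(p' <- r) \sum_(q <- s) \sum_(q' <- s) f p p' q q' <=
  \sum_(p <- r) \sum_(p' <- r) \sum_(q <- s) \sum_(q' <- s) g p p' q q'.
Proof. by move=> fg; do 4 (apply: ler_sum => ? _). Qed.

(** The four-cycle is a product of two pairs of opposite covariances; the mean inequality for the
    two pairs gives the two terms. *)
Lemma form_X_le r s : X r s <= (V r r * V s s + V r s ^+ 2) / 2.
Proof.
have -> : (V r r * V s s + V r s ^+ 2) / 2 = \sum_(p <- r) \sum_(p' <- r) \sum_(q <- s) \sum_(q' <- s)
    h ^+ 4 * ((c p p' ^+ 2 * c q q' ^+ 2 + c p q ^+ 2 * c p' q' ^+ 2) / 2).
  have e1 : V r r * V s s = \sum_(p <- r) \sum_(p' <- r) \sum_(q <- s) \sum_(q' <- s)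
      h ^+ 4 * (c p p' ^+ 2 * c q q' ^+ 2).
    rewrite /form_V mulr_suml; apply: eq_bigr => p _; rewrite mulr_suml; apply: eq_bigr => p' _.
    by rewrite mulr_sumr; apply: eq_bigr => q _; rewrite mulr_sumr; apply: eq_bigr => q' _; ring.
  have e2 : V r s ^+ 2 = \sum_(p <- r) \sum_(p' <- r) \sum_(q <- s) \sum_(q' <- s)
      h ^+ 4 * (c p q ^+ 2 * c p' q' ^+ 2).
    rewrite /form_V expr2 big_distrlr/=; apply: eq_bigr => p _; apply: eq_bigr => p' _.
    by rewrite big_distrlr/=; apply: eq_bigr => q _; apply: eq_bigr => q' _; ring.
  rewrite e1 e2 -big_split/= mulr_suml; apply: eq_bigr => p _.
  rewrite -big_split/= mulr_suml; apply: eq_bigr => p' _.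
  rewrite -big_split/= mulr_suml; apply: eq_bigr => q _.
  by rewrite -big_split/= mulr_suml; apply: eq_bigr => q' _; ring.
apply: sum4 => p p' q q'; rewrite ler_wpM2l ?exprn_ge0// (kap_covC H M q' q) (kap_covC H M q p).
have := sqr_ge0 (c p p' * c q q' - c p q * c p' q').
rewrite sqrrB !exprMn; set a := c p p'; set b := c q q'; set e := c p q; set f := c p' q'.
by move=> ?; lra.
Qed.

(** Opposite covariances are paired as for [form_X]; in the alternating cycle all of them join [r]
    to [s], so both resulting terms are [V r s ^+ 2]. *)
Lemma form_X'_le r s : X' r s <= V r s ^+ 2.
Proof.
have -> : V r s ^+ 2 = \sum_(p <- r) \sum_(p' <- r) \sum_(q <- s) \sum_(q' <- s)
    h ^+ 4 * ((c p q ^+ 2 * c p' q' ^+ 2 + c p q' ^+ 2 * c p' q ^+ 2) / 2).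
  have e1 : V r s ^+ 2 = \sum_(p <- r) \sum_(p' <- r) \sum_(q <- s) \sum_(q' <- s)
      h ^+ 4 * (c p q ^+ 2 * c p' q' ^+ 2).
    rewrite /form_V expr2 big_distrlr/=; apply: eq_bigr => p _; apply: eq_bigr => p' _.
    by rewrite big_distrlr/=; apply: eq_bigr => q _; apply: eq_bigr => q' _; ring.
  have e2 : V r s ^+ 2 = \sum_(p <- r) \sum_(p' <- r) \sum_(q <- s) \sum_(q' <- s)
      h ^+ 4 * (c p q' ^+ 2 * c p' q ^+ 2).
    by rewrite e1; apply: eq_bigr => p _; apply: eq_bigr => p' _; rewrite exchange_big.
  rewrite -[LHS](@mulfK _ 2)// mulr_natr mulr2n {1}e1 e2.
  rewrite -big_split/= mulr_suml; apply: eq_bigr => p _.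
  rewrite -big_split/= mulr_suml; apply: eq_bigr => p' _.
  rewrite -big_split/= mulr_suml; apply: eq_bigr => q _.
  by rewrite -big_split/= mulr_suml; apply: eq_bigr => q' _; ring.
apply: sum4 => p p' q q'; rewrite ler_wpM2l ?exprn_ge0// (kap_covC H M q p') (kap_covC H M q' p).
have := sqr_ge0 (c p q * c p' q' - c p q' * c p' q).
rewrite sqrrB !exprMn; set a := c p q; set b := c p' q'; set e := c p q'; set f := c p' q.
by move=> ?; lra.
Qed.

End block_bounds.

Section liminf.
Context (R : realType).
Local Open Scope ereal_scope.

Lemma limn_einf_near (u : nat -> \bar R) (x e : R) : x%:E <= limn_einf u -> (0 < e)%R ->
  \forall n \near \oo, (x - e)%:E <= u n.
Proof.
move=> xu e0; have : (x - e)%:E < ereal_sup (range (einfs u)).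
  apply: (@lt_le_trans _ _ x%:E); first by rewrite lte_fin; lra.
  have e1 : limn (einfs u) = ereal_sup (range (einfs u)) by apply/cvg_lim => //; exact: cvg_einfs_sup.
  by rewrite -e1 -limn_einf_lim.
move=> /ereal_sup_gt[_ [n _ <-] xn]; exists n => // m /= nm.
by apply: le_trans (ltW xn) _; apply: ereal_inf_lbound; exists m.
Qed.

Lemma limn_einf_ge (u : nat -> \bar R) (x : \bar R) : (forall n, x <= u n) -> x <= limn_einf u.
Proof.
move=> xu; rewrite limn_einf_lim; apply: lime_ge; first exact: is_cvg_einfs.
by apply: nearW => n; apply: le_ereal_inf_tmp => _ [m _ <-].
Qed.

End liminf.

Lemma ndist_far i j : (2 <= ndist i j)%N ->
  ((i.+2 <= j) /\ ((ndist i j).+1 + i = j.+1) \/ (j.+2 <= i) /\ ((ndist i j).+1 + j = i.+1))%N.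
Proof. by rewrite /ndist; lia. Qed.

(** * Lower bound for the mixed form of two distant blocks *)

Section mixed_form.
Context (R : realType) (H : R).
Notation mu := (@lebesgue_measure R).
Hypothesis H12 : 2^-1 < H < 1.
Variables (N i j : nat).
Hypotheses (N0 : (0 < N)%N) (iN : (i < N)%N) (jN : (j < N)%N) (ijd : (2 <= ndist i j)%N).
Notation B := (beta_real H).
Let M m := (N * m.+1)%N.
Let M0 m : (0 < M m)%N. Proof. by rewrite muln_gt0 N0. Qed.
Let N0' : 0 < N%:R :> R. Proof. by rewrite ltr0n. Qed.
Let c m := kap_cov H (M m).
Let ix m := @grid_idx R (M m).
Let I l : set R := `](l%:R / N%:R)%R, (l.+1%:R / N%:R)%R]%classic.
Let rho := far_cov H N (ndist i j).+1.
Let B0 : 0 <= B. Proof. by apply: le_trans (beta_real_ge1 H12). Qed.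
Let c0 m p q : 0 <= c m p q. Proof. exact: kap_cov_ge0. Qed.
Let rho0 : 0 <= rho. Proof. exact: far_cov_ge0. Qed.
Let ihalf : 2^-1 < H. Proof. by case/andP: H12. Qed.
Let iH1 : H < 1. Proof. by case/andP: H12. Qed.
Let H0 : 0 < H. Proof. by apply: lt_trans ihalf; rewrite invr_gt0. Qed.

Lemma grid_mesh_cvg : (M m)%:R^-1 @[m --> \oo] --> (0 : R).
Proof.
rewrite (_ : (fun m => _) = (fun m => (N%:R^-1 : R) * m.+1%:R^-1)); last first.
  by apply/funext => m; rewrite natrM invfM.
rewrite -[X in _ --> X](mulr0 (N%:R^-1 : R)); apply: cvgM; first exact: cvg_cst.
exact: cvg_harmonic.
Qed.

Let mI l : measurable (I l). Proof. exact: measurable_itv. Qed.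

Let integral_block m l (f : nat -> R) : (forall p, 0 <= f p) ->
  (\int[mu]_(u in I l) (f (ix m u))%:E = (\sum_(p <- block m.+1 l) f p / (M m)%:R)%:E)%E.
Proof.
move=> f0; rewrite -integral_grid// ?leq_mul2r ?leqnSn ?orbT//.
by rewrite !block_ratio.
Qed.

Let I_pos l u : (l < N)%N -> I l u -> 0 < u <= 1.
Proof.
move=> lN; rewrite /I /= in_itv/= => /andP[u1 u2]; apply/andP; split.
  by apply: le_lt_trans u1; rewrite divr_ge0.
by apply: le_trans u2 _; rewrite ler_pdivrMr// mul1r ler_nat.
Qed.

Let far_points u v : I i u -> I j v -> u != v /\ `|u - v| <= (ndist i j).+1%:R / N%:R.
Proof.
rewrite /I /= !in_itv/= !ltr_pdivrMr// !ler_pdivlMr// => /andP[u1 u2] /andP[v1 v2].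
have uv : `|u - v| * N%:R <= (ndist i j).+1%:R /\ u * N%:R != v * N%:R.
  rewrite -[X in _ * X]gtr0_norm// -normrM mulrBl.
  rewrite -!natr1 in u2 v2.
  case: (ndist_far ijd) => -[]; rewrite -(ler_nat R) => ij /(congr1 (fun n => n%:R : R)).
    rewrite natrD -[j.+1%:R]natr1 => e; rewrite -2!natr1 in ij; split; last by rewrite lt_eqF//; lra.
    by rewrite ler_norml; lra.
  rewrite natrD -[i.+1%:R]natr1 => e; rewrite -2!natr1 in ij; split; last by rewrite gt_eqF//; lra.
  by rewrite ler_norml; lra.
case: uv => uv1 uv2; split => //.
by apply: contra uv2 => /eqP ->.
Qed.

Let cov_cvg u v : 0 < u <= 1 -> 0 < v <= 1 -> u != v ->
  c m (ix m u) (ix m v) @[m --> \oo] --> B * `|u - v| `^ (H - 1).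
Proof.
move=> u01 v01 uv; have /andP[u0 _] := u01; have /andP[v0 _] := v01.
have := kap_cov_cvg H12 M0 grid_mesh_cvg u0 v0.
by rewrite kernel_cov_neq// => /fine_cvgP[].
Qed.

Let far_cov_le u v : I i u -> I j v -> rho <= B * `|u - v| `^ (H - 1).
Proof.
move=> uI vJ; have [uv d] := far_points uI vJ.
rewrite /rho /far_cov ler_wpM2l//; apply: powR_anti => //; first by rewrite subr_le0 ltW.
by rewrite normr_gt0 subr_eq0.
Qed.

(** The first of three applications of Fatou's lemma, over the variable [u'] of [p'], with [u] and
    [v] fixed. Points of the two blocks are at most [(k+1)/N] apart, so both covariances joining the
    blocks are at least [rho] in the limit. *)
Let step1 v u : I j v -> I i u ->
  ((rho ^+ 2 * (B / H * `|i%:R / N%:R - u| `^ H + B / H * `|i.+1%:R / N%:R - u| `^ H))%:E <=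
   limn_einf (fun m => (\sum_(p' <- block m.+1 i)
     (c m (ix m u) p' * c m p' (ix m v) * c m (ix m v) (ix m u)) / (M m)%:R)%:E))%E.
Proof.
move=> vJ uI; have u01 := I_pos iN uI; have v01 := I_pos jN vJ.
have c30 m p p' q : 0 <= c m p p' * c m p' q * c m q p by rewrite !mulr_ge0.
rewrite (_ : (fun m => _) = (fun m => \int[mu]_(u' in I i)
    (c m (ix m u) (ix m u') * c m (ix m u') (ix m v) * c m (ix m v) (ix m u))%:E)%E); last first.
  apply/funext => m; rewrite -(integral_block m i (f := fun p' => c m (ix m u) p' * c m p' (ix m v) * c m (ix m v) (ix m u)))//.
have mabs : measurable_fun (I i) (fun u' : R => `|u - u'| `^ (H - 1)) by exact: measurable_abs_powR.
apply: (@le_trans _ _ (\int[mu]_(u' in I i) (rho ^+ 2 * (B * `|u - u'| `^ (H - 1)))%:E)%E).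
  have iu : i%:R / N%:R <= u <= i.+1%:R / N%:R.
    by move: uI; rewrite /I /= in_itv/= => /andP[/ltW -> ->].
  under eq_integral do rewrite mulrA EFinM.
  rewrite ge0_integralZl//; try exact: mI; try exact/measurable_EFinP;
    try (by move=> x _; rewrite lee_fin powR_ge0); try (by rewrite lee_fin mulr_ge0 ?exprn_ge0).
  have H1 : -1 < H - 1 by rewrite -subr_gt0 opprK subrK.
  rewrite (integral_abs_powR H1 iu).
  rewrite -EFinM lee_fin le_eqVlt; apply/orP; left; apply/eqP.
  have -> : H - 1 + 1 = H by ring.
  have /andP[iu1 iu2] := iu; rewrite distrC !ger0_norm ?subr_ge0//.
  by field; rewrite gt_eqF.
apply: le_liminf_integral => //; try exact: mI.
- by move=> m; apply: (@measurable_grid _ _ _ _ _ (fun p' => (c m (ix m u) p' * c m p' (ix m v) * c m (ix m v) (ix m u))%:E)).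
- by apply/measurable_EFinP; apply: measurable_funM => //; exact: measurable_funM.
- by move=> m u' _; rewrite lee_fin.
- by move=> u' _; rewrite lee_fin !mulr_ge0 ?exprn_ge0 ?powR_ge0.
move=> u' u'I; have u'01 := I_pos iN u'I.
(* At [u' = u] the power of 0 has the default value 0, and the lower bound is trivial. *)
have [->|uu'] := eqVneq u' u.
  rewrite subrr normr0 powR0 ?mulr0; last by rewrite lt_eqF// subr_lt0.
  by apply: limn_einf_ge => m; rewrite lee_fin.
have [u'v _] := far_points u'I vJ; have [uv _] := far_points uI vJ.
have cv : (c m (ix m u) (ix m u') * c m (ix m u') (ix m v) * c m (ix m v) (ix m u))%:E @[m --> \oo] -->
    (B * `|u - u'| `^ (H - 1) * (B * `|u' - v| `^ (H - 1)) * (B * `|v - u| `^ (H - 1)))%:E.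
  apply: cvg_EFin; first exact: nearW.
  apply: cvgM; [apply: cvgM|]; apply: cov_cvg => //; by rewrite eq_sym.
have [-> _] := cvg_limn_einf_sup cv.
rewrite lee_fin [`|v - u|]distrC.
have r1 := far_cov_le u'I vJ; have r2 := far_cov_le uI vJ.
rewrite -[leRHS]mulrA [leRHS]mulrC ler_wpM2r ?mulr_ge0 ?powR_ge0//.
by rewrite expr2 ler_pM.
Qed.

Let s := block_mass H N%:R^-1.

Let iNle : i%:R / N%:R <= i.+1%:R / N%:R :> R.
Proof. by rewrite ler_pM2r ?invr_gt0// ler_nat. Qed.

Let step2 v : I j v ->
  ((rho ^+ 2 * s)%:E <= limn_einf (fun m => (\sum_(p <- block m.+1 i) (\sum_(p' <- block m.+1 i)
     (c m p p' * c m p' (ix m v) * c m (ix m v) p) / (M m)%:R) / (M m)%:R)%:E))%E.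
Proof.
move=> vJ.
have c30 m p p' q : 0 <= c m p p' * c m p' q * c m q p by rewrite !mulr_ge0.
have f0 m p : 0 <= \sum_(p' <- block m.+1 i) (c m p p' * c m p' (ix m v) * c m (ix m v) p) / (M m)%:R.
  by apply: sumr_ge0 => p' _; rewrite divr_ge0.
rewrite (_ : (fun m => _) = (fun m => \int[mu]_(u in I i)
    (\sum_(p' <- block m.+1 i) (c m (ix m u) p' * c m p' (ix m v) * c m (ix m v) (ix m u)) / (M m)%:R)%:E)%E); last first.
  apply/funext => m; rewrite -(integral_block m i (f := fun p => \sum_(p' <- block m.+1 i) (c m p p' * c m p' (ix m v) * c m (ix m v) p) / (M m)%:R))//.
have BH : 0 <= B / H by rewrite divr_ge0// ltW.
pose G (u : R) := B / H * `|i%:R / N%:R - u| `^ H + B / H * `|i.+1%:R / N%:R - u| `^ H.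
have mG : measurable_fun (I i) G.
  by apply: measurable_funD; apply: measurable_funM => //; exact: measurable_abs_powR.
have G0 u : 0 <= G u by rewrite /G addr_ge0// mulr_ge0// powR_ge0.
apply: (@le_trans _ _ (\int[mu]_(u in I i) (rho ^+ 2 * G u)%:E)%E).
  under eq_integral do rewrite EFinM.
  rewrite ge0_integralZl//; try exact: mI; try exact/measurable_EFinP;
    try (by move=> x _; rewrite lee_fin); try (by rewrite lee_fin exprn_ge0).
  rewrite /G (integral_block_mass H12 iNle) -EFinM lee_fin /s.
  by rewrite -mulrBl -natrB// subSnn mul1r.
apply: le_liminf_integral => //; try exact: mI.
- by move=> m; apply: (@measurable_grid _ _ _ _ _ (fun p => (\sum_(p' <- block m.+1 i) (c m p p' * c m p' (ix m v) * c m (ix m v) p) / (M m)%:R)%:E)).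
- by apply/measurable_EFinP; exact: measurable_funM.
- by move=> m u _; rewrite lee_fin.
- by move=> u _; rewrite lee_fin mulr_ge0 ?exprn_ge0.
by move=> u uI; exact: step1.
Qed.

(** Sums over a block are integrals of step functions, and Fatou's lemma is applied to them in one
    variable at a time: two covariances contribute [rho], the third integrates to the block mass
    [s], and the last variable contributes the length [1/N]. *)
Lemma form_Y_near (e : R) : 0 < e -> \forall m \near \oo,
  rho ^+ 2 * s / N%:R - e <= form_Y H (M m) (block m.+1 i) (block m.+1 j).
Proof.
move=> e0.
pose f m q := \sum_(p <- block m.+1 i) (\sum_(p' <- block m.+1 i)
     (c m p p' * c m p' q * c m q p) / (M m)%:R) / (M m)%:R.
have f0 m q : 0 <= f m q.
  by apply: sumr_ge0 => p _; rewrite divr_ge0// sumr_ge0// => p' _; rewrite divr_ge0// !mulr_ge0.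
have YE m : form_Y H (M m) (block m.+1 i) (block m.+1 j) = \sum_(q <- block m.+1 j) f m q / (M m)%:R.
  rewrite /form_Y; under eq_bigr do rewrite exchange_big/=.
  rewrite exchange_big/=; apply: eq_bigr => q _.
  rewrite mulr_suml; apply: eq_bigr => p _; rewrite !mulr_suml; apply: eq_bigr => p' _.
  by rewrite /c; ring.
have s0 : 0 <= s.
  rewrite /s /block_mass divr_ge0 ?mulr_ge0 ?powR_ge0 ?addr_ge0 ?(ltW H0)//.
have h : ((rho ^+ 2 * s / N%:R)%:E <= limn_einf (fun m => (form_Y H (M m) (block m.+1 i) (block m.+1 j))%:E))%E.
  rewrite (_ : (fun m => _) = (fun m => \int[mu]_(v in I j) (f m (ix m v))%:E)%E); last first.
    by apply/funext => m; rewrite YE -integral_block.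
  apply: (@le_trans _ _ (\int[mu]_(v in I j) cst (rho ^+ 2 * s)%:E v)%E).
    rewrite integral_cst ?/I /=; last exact: mI.
    rewrite lebesgue_measure_itv/= lte_fin ltr_pM2r ?invr_gt0// ltr_nat ltnSn.
    by rewrite -EFinB -EFinM lee_fin -mulrBl -natrB// subSnn mul1r.
  apply: le_liminf_integral => //; try exact: mI.
  - by move=> m; apply: (@measurable_grid _ _ _ _ _ (fun q => (f m q)%:E)).
  - by move=> m v _; rewrite lee_fin.
  - by move=> v _; rewrite lee_fin mulr_ge0 ?exprn_ge0.
by have := limn_einf_near h e0; apply: filterS => m; rewrite lee_fin.
Qed.

End mixed_form.

(** * Summation over all pairs of blocks *)

Section stat_bound.
Context (R : realType) (H : R).
Hypothesis H12 : 2^-1 < H < 1.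
Notation B := (beta_real H).

(* The normalisation that makes the far-field part of the second moment telescope. *)
Definition stat_coef (N : nat) : R := (N%:R * block_mass H N%:R^-1)^-1.

Let ihalf : 2^-1 < H. Proof. by case/andP: H12. Qed.
Let iH1 : H < 1. Proof. by case/andP: H12. Qed.
Let H0 : 0 < H. Proof. by apply: lt_trans ihalf; rewrite invr_gt0. Qed.
Let B0 : 0 < B. Proof. by apply: lt_le_trans (beta_real_ge1 H12). Qed.
Let HH : 0 < 2 * H - 1. Proof. by rewrite subr_gt0 mulrC -ltr_pdivrMr// div1r. Qed.
Let kp := H * (H + 1) / (2 * B).
Let K1 := 2 * B ^+ 2 / (2 * H - 1).
Let kp0 : 0 < kp. Proof. by rewrite divr_gt0 ?mulr_gt0// addr_gt0. Qed.
Let K10 : 0 < K1. Proof. by rewrite divr_gt0 ?mulr_gt0 ?exprn_gt0. Qed.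

Lemma stat_coefE N : (0 < N)%N -> stat_coef N = kp * N%:R `^ H.
Proof.
move=> N0; have N0' : 0 < N%:R :> R by rewrite ltr0n.
rewrite /stat_coef /block_mass /kp.
have -> : N%:R^-1 `^ (H + 1) = (N%:R `^ H)^-1 / N%:R :> R.
  have Ni : N%:R^-1 != 0 :> R by rewrite invr_eq0 gt_eqF.
  rewrite powRD; last by rewrite Ni implybT.
  by rewrite [X in _ * X]powRr1 ?invr_ge0// -{1}powR_inv1 ?ler0n// -powRrM mulN1r powRN.
have NH : 0 < N%:R `^ H :> R by rewrite powR_gt0.
by field; rewrite !gt_eqF// addr_gt0.
Qed.

Lemma stat_coef_gt0 N : (0 < N)%N -> 0 < stat_coef N.
Proof. by move=> N0; rewrite stat_coefE// mulr_gt0// powR_gt0// ltr0n. Qed.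

Let sqr_pow N : (0 < N)%N -> (N%:R `^ H) ^+ 2 = (N%:R `^ (- (2 * H)))^-1 :> R.
Proof.
move=> N0; rewrite -powR_mulrn ?powR_ge0// -powRrM powRN invrK.
by congr (_ `^ _); ring.
Qed.

Let far_sqr N l : (0 < N)%N -> (0 < l)%N ->
  far_cov H N l ^+ 2 / N%:R ^+ 2 = B ^+ 2 * (l%:R : R) `^ (2 * H - 2) * N%:R `^ (- (2 * H)).
Proof.
move=> N0 l0; have N0' : 0 < N%:R :> R by rewrite ltr0n.
rewrite /far_cov exprMn -[(_ `^ _) ^+ 2]powR_mulrn ?powR_ge0// -powRrM powRM ?invr_ge0//.
have -> : (H - 1) * 2%:R = 2 * H - 2 by ring.
have e : N%:R^-1 `^ (2 * H - 2) / N%:R ^+ 2 = N%:R `^ (- (2 * H)) :> R.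
  rewrite -{1}powR_inv1 ?ler0n// -powRrM -[X in _ / X]powR_mulrn ?ler0n// -powRN -powRD.
    by congr (_ `^ _); ring.
  by rewrite (gt_eqF N0') implybT.
by rewrite mulrA -[LHS]mulrA e.
Qed.

Definition stat_second_moment (N m : nat) : R :=
  \sum_(i < N) \sum_(j < N) (stat_coef N ^+ 2 *
     (8 * form_V H (N * m.+1) (block m.+1 i) (block m.+1 j) ^+ 2 +
     16 * form_X' H (N * m.+1) (block m.+1 i) (block m.+1 j)) +
    32 * (stat_coef N ^+ 2 * form_X H (N * m.+1) (block m.+1 i) (block m.+1 j) -
     2 * stat_coef N * form_Y H (N * m.+1) (block m.+1 i) (block m.+1 j) +
     form_V H (N * m.+1) (block m.+1 i) (block m.+1 j))).

(** The fourth-chaos part is split at distance [L]: at most [2 N (L+1)] pairs are nearer, each of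
    order [N^(-2H)]; for the farther ones one factor [V] absorbs [b^2] into [L^(2H-2)] and the other
    is summed. The second-chaos part is of order [N^(1-2H)] by the gap weights, and [1/N] pays for
    the error in [form_Y_near]. The mesh is chosen before [L]. *)
Lemma stat_second_moment_le : exists2 A : R, 0 < A & forall N, (0 < N)%N ->
  \forall m \near \oo, forall L, (0 < L)%N ->
  stat_second_moment N m <= A * (L.+1%:R * N%:R `^ (1 - 2 * H) + L%:R `^ (2 * H - 2)) + N%:R^-1.
Proof.
(* Constants are introduced through equations, so that they remain atoms for the arithmetic
   tactics. *)
have [k0 k0E] : exists k, k = kp by eexists.
have [k1 k1E] : exists k, k = K1 by eexists.
have k00 : 0 < k0 by rewrite k0E.
have k10 : 0 < k1 by rewrite k1E.
have [A1 A1E] : exists A, A = k0 ^+ 2 * k1 ^+ 2 by eexists.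
have [A2 A2E] : exists A, A = k0 ^+ 2 * B ^+ 2 by eexists.
have [A3 A3E] : exists A, A = A1 + k1 + 2 * B ^+ 2 by eexists.
have A10 : 0 < A1 by rewrite A1E mulr_gt0// exprn_gt0.
have A20 : 0 < A2 by rewrite A2E mulr_gt0// exprn_gt0.
have A30 : 0 < A3 by rewrite A3E !addr_gt0// mulr_gt0// exprn_gt0.
exists (48 * A1 + 24 * A2 * k1 + 256 * A3).
  by apply: addr_gt0; [apply: addr_gt0; [apply: mulr_gt0|apply: mulr_gt0 => //; apply: mulr_gt0]|apply: mulr_gt0].
move=> N N0; have N0' : 0 < N%:R :> R by rewrite ltr0n.
pose b := stat_coef N; have b0 : 0 < b by exact: stat_coef_gt0.
pose n : R := N%:R `^ (- (2 * H)); have n0 : 0 < n by rewrite powR_gt0.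
have b2 : b ^+ 2 = k0 ^+ 2 / n by rewrite /b stat_coefE// -k0E exprMn sqr_pow.
pose s := block_mass H N%:R^-1.
have bs : b * s = N%:R^-1.
  have : N%:R * s != 0 by move: b0; rewrite /b /stat_coef invr_gt0 => /gt_eqF ->.
  rewrite mulf_eq0 negb_or => /andP[Nn sn].
  by rewrite /b /stat_coef -/s; field; rewrite Nn sn.
(* Chosen so that [32 * 2 b e = N^(-3)], which sums to [1/N] over the [N^2] pairs. *)
pose e : R := (64 * b * N%:R ^+ 3)^-1.
have e0 : 0 < e by rewrite invr_gt0 !mulr_gt0// exprn_gt0.
have A1p := ltW A10; have A2p := ltW A20; have A3p := ltW A30; have K1p := ltW k10.
have kpp := ltW k00; have Bp := ltW B0; have np := ltW n0; have bp := ltW b0; have ep := ltW e0.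
have Yn : \forall m \near \oo, forall ij : 'I_N * 'I_N, (2 <= ndist ij.1 ij.2)%N ->
    far_cov H N (ndist ij.1 ij.2).+1 ^+ 2 * s / N%:R - e <=
    form_Y H (N * m.+1) (block m.+1 ij.1) (block m.+1 ij.2).
  apply: filter_forall => -[i j] /=.
  have [d|d] := leqP 2 (ndist i j); last by apply: nearW.
  by have := form_Y_near H12 N0 (ltn_ord i) (ltn_ord j) d e0; apply: filterS.
apply: filterS Yn => m Ym L L0.
pose r i := block m.+1 i; pose M := (N * m.+1)%N.
pose V i j := form_V H M (r i) (r j).
have V0 i j : 0 <= V i j by exact: form_V_ge0.
have Vn i j : (i < N)%N -> (j < N)%N -> V i j <= k1 * n.
  by move=> iN jN; rewrite k1E; exact: form_V_le.
have Vs : \sum_(i < N) \sum_(j < N) V i j <= k1 by rewrite k1E; exact: form_V_sum_le.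
have pairV (i j : 'I_N) : b ^+ 2 * V i j ^+ 2 <=
    A1 * n * (ndist i j <= L)%N%:R + A2 * L%:R `^ (2 * H - 2) * V i j.
  have [d|d] := leqP (ndist i j) L.
    rewrite mulr1 -[leLHS]addr0; apply: lerD; last by rewrite !mulr_ge0 ?powR_ge0 //.
    rewrite b2 A1E.
    have -> : k0 ^+ 2 * k1 ^+ 2 * n = k0 ^+ 2 / n * (k1 * n) ^+ 2 by field; rewrite gt_eqF.
    rewrite ler_wpM2l ?divr_ge0 ?exprn_ge0 // lerXn2r ?nnegrE ?mulr_ge0//.
    exact: Vn.
  have d2 := leq_ltn_trans L0 d; have d1 := ltn_trans (ltn0Sn 0) d2.
  have dp : (0 < (ndist i j).-1)%N by rewrite -subn1 subn_gt0.
  have dL : (L <= (ndist i j).-1)%N by rewrite -ltnS prednK.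
  rewrite mulr0 add0r [V i j ^+ 2]expr2 mulrA ler_wpM2r//.
  apply: (@le_trans _ _ (b ^+ 2 * (far_cov H N (ndist i j).-1 ^+ 2 / N%:R ^+ 2))).
    rewrite ler_wpM2l ?exprn_ge0 //; exact: form_V_far.
  rewrite far_sqr//.
  rewrite b2 -/n.
  have -> : k0 ^+ 2 / n * (B ^+ 2 * (ndist i j).-1%:R `^ (2 * H - 2) * n) =
    A2 * (ndist i j).-1%:R `^ (2 * H - 2) by rewrite A2E; field; rewrite gt_eqF.
  rewrite ler_wpM2l //; apply: powR_anti; rewrite ?ltr0n// ?ler_nat//.
  by rewrite (_ : 2 * H - 2 = 2 * (H - 1)) ?pmulr_rle0 ?subr_le0 ?ltW//; ring.
(* For distant blocks [b s = 1/N] reduces [b^2 X] and [V] to at most [B^2 (k-1)^(2H-2) n] each, and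
   [2 b Y] to at least [2 B^2 (k+1)^(2H-2) n] up to [2 b e]; the difference is a gap weight. Near
   blocks only use the crude bounds and [Y >= 0]. *)
have pairW (i j : 'I_N) : b ^+ 2 * form_X H M (r i) (r j) - 2 * b * form_Y H M (r i) (r j) + V i j <=
    A3 * n * gap_weight (2 * H - 2) (ndist i j) + (32 * N%:R ^+ 3)^-1.
  have e32 : 2 * b * e = (32 * N%:R ^+ 3)^-1 by rewrite /e; field; rewrite !gt_eqF.
  have e320 : 0 <= (32 * N%:R ^+ 3)^-1 :> R by rewrite -e32 !mulr_ge0 //.
  have [d|d] := leqP (ndist i j) 1.
    rewrite /gap_weight d mulr1.
    have X1 : b ^+ 2 * form_X H M (r i) (r j) <= A1 * n.
      apply: (@le_trans _ _ (b ^+ 2 * ((k1 * n) ^+ 2))).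
        rewrite ler_wpM2l ?exprn_ge0 //; apply: (le_trans (@form_X_le R H N m.+1 (r i) (r j))).
        rewrite ler_pdivrMr// mulr_natr mulr2n lerD//; first by rewrite expr2 ler_pM// ?V0// Vn.
        by rewrite -/M -/(V i j) lerXn2r ?nnegrE ?V0 ?mulr_ge0// Vn.
      by rewrite b2 A1E le_eqVlt; apply/orP; left; apply/eqP; field; rewrite gt_eqF.
    have Y0 : 0 <= 2 * b * form_Y H M (r i) (r j) by rewrite !mulr_ge0 //; exact: form_Y_ge0.
    have V1 := Vn i j (ltn_ord i) (ltn_ord j).
    have B1 : 0 <= B ^+ 2 * n by rewrite mulr_ge0 ?exprn_ge0 //.
    have -> : A3 * n = A1 * n + k1 * n + 2 * (B ^+ 2 * n) by rewrite A3E; ring.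
    move: X1 Y0 V1 B1 e320; move: (b ^+ 2 * _) (2 * b * _) (V i j) (A1 * n) (k1 * n) (B ^+ 2 * n) (_^-1).
    by move=> *; lra.
  have Y1 := Ym (i, j) d; rewrite /= in Y1.
  have X1 := form_X_far H12 N0 (ltn0Sn m) (ltn_ord i) (ltn_ord j) d.
  have V1 := form_V_far H12 N0 (ltn0Sn m) (ltn_ord i) (ltn_ord j) d.
  set l := ndist i j in d Y1 X1 V1 *.
  have l1 : (0 < l.-1)%N by rewrite -subn1 subn_gt0.
  have f1 := far_sqr N0 l1; have f2 := far_sqr N0 (ltn0Sn l); rewrite -/n in f1 f2.
  have X2 : b ^+ 2 * form_X H M (r i) (r j) <= far_cov H N l.-1 ^+ 2 / N%:R ^+ 2.
    apply: (@le_trans _ _ (b ^+ 2 * (far_cov H N l.-1 ^+ 2 * s ^+ 2))).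
      by rewrite ler_wpM2l// exprn_ge0.
    rewrite [b ^+ 2 * _]mulrCA -exprMn bs exprVn//.
  have Y2 : 2 * (far_cov H N l.+1 ^+ 2 / N%:R ^+ 2) - 2 * b * e <= 2 * b * form_Y H M (r i) (r j).
    apply: (@le_trans _ _ (2 * b * (far_cov H N l.+1 ^+ 2 * s / N%:R - e))); last by rewrite ler_wpM2l// mulr_ge0.
    rewrite le_eqVlt; apply/orP; left; apply/eqP.
    rewrite mulrBr; congr (_ - _).
    transitivity (2 * far_cov H N l.+1 ^+ 2 * (b * s) / N%:R); last by ring.
    by rewrite bs; field; rewrite gt_eqF.
  rewrite /gap_weight leqNgt d/= -e32.
  have g0 : 0 <= l.-1%:R `^ (2 * H - 2) - l.+1%:R `^ (2 * H - 2) :> R.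
    have := @gap_weight_ge0 R (2 * H - 2) l; rewrite /gap_weight leqNgt d/=; apply.
    by rewrite (_ : 2 * H - 2 = 2 * (H - 1)) ?pmulr_rle0 ?subr_le0 ?ltW//; ring.
  have A1n : 0 <= (A1 + k1) * n * (l.-1%:R `^ (2 * H - 2) - l.+1%:R `^ (2 * H - 2)).
    by apply: mulr_ge0 => //; apply: mulr_ge0 => //; exact: addr_ge0.
  rewrite f1 in X2 V1; rewrite f2 in Y2; rewrite A3E.
  move: X2 Y2 V1 A1n; rewrite -/M -/(V i j).
  set x := l.-1%:R `^ _; set y := l.+1%:R `^ _; set bx := b ^+ 2 * _; set be := 2 * b * e; set by_ := 2 * b * _.
  move=> X2 Y2 V1 A1n.
  have -> : (A1 + k1 + 2 * B ^+ 2) * n * (x - y) =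
    (A1 + k1) * n * (x - y) + 2 * (B ^+ 2 * x * n) - 2 * (B ^+ 2 * y * n) by ring.
  have V2 : V i j <= B ^+ 2 * x * n by exact: V1.
  move: X2 Y2 V2 A1n; move: bx be by_ (V i j) ((A1 + k1) * n * (x - y)) (B ^+ 2 * x * n) (B ^+ 2 * y * n).
  by move=> *; lra.
(* [form_X' <= V^2] turns [8 V^2 + 16 X'] into [24 V^2]. *)
have S1 : stat_second_moment N m <= \sum_(i < N) \sum_(j < N)
    (24 * (A1 * n * (ndist i j <= L)%N%:R + A2 * L%:R `^ (2 * H - 2) * V i j) +
     32 * (A3 * n * gap_weight (2 * H - 2) (ndist i j) + (32 * N%:R ^+ 3)^-1)).
  apply: ler_sum => i _; apply: ler_sum => j _; apply: lerD; last by rewrite ler_wpM2l//; exact: pairW.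
  apply: (@le_trans _ _ (24 * (b ^+ 2 * V i j ^+ 2))); last by rewrite ler_wpM2l//; exact: pairV.
  rewrite [leRHS]mulrCA ler_wpM2l ?exprn_ge0//.
  by have := @form_X'_le R H N m.+1 (r i) (r j); rewrite -/(V i j) /r /M; lra.
apply: (le_trans S1).
have G1 : \sum_(i < N) \sum_(j < N) (ndist i j <= L)%N%:R <= 2 * N%:R * L.+1%:R :> R.
  apply: le_trans (@ler_sum_ndist R (fun k => (k <= L)%N%:R) N (fun _ => ler0n _ _)) _.
  rewrite ler_wpM2l ?mulr_ge0//.
  rewrite -natr_sum ler_nat -(big_mkcond (fun k => (k <= L)%N) (fun=> 1%N))/=.
  rewrite sum1_count -(size_iota 0 L.+1) -size_filter; apply: uniq_leq_size.
    by rewrite filter_uniq// iota_uniq.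
  by move=> k; rewrite mem_filter mem_iota add0n ltnS => /andP[].
have G2 : \sum_(i < N) \sum_(j < N) gap_weight (2 * H - 2) (ndist i j) <= 2 * N%:R * 4 :> R.
  have q0 : 2 * H - 2 <= 0.
    by rewrite (_ : 2 * H - 2 = 2 * (H - 1)) ?pmulr_rle0 ?subr_le0 ?ltW//; ring.
  apply: le_trans (@ler_sum_ndist R (gap_weight (2 * H - 2)) N (fun k => gap_weight_ge0 k q0)) _.
  by rewrite ler_wpM2l ?mulr_ge0// gap_weight_sum.
have -> : \sum_(i < N) \sum_(j < N)
    (24 * (A1 * n * (ndist i j <= L)%N%:R + A2 * L%:R `^ (2 * H - 2) * V i j) +
     32 * (A3 * n * gap_weight (2 * H - 2) (ndist i j) + (32 * N%:R ^+ 3)^-1)) =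
   24 * A1 * n * (\sum_(i < N) \sum_(j < N) (ndist i j <= L)%N%:R) +
   24 * A2 * L%:R `^ (2 * H - 2) * (\sum_(i < N) \sum_(j < N) V i j) +
   32 * A3 * n * (\sum_(i < N) \sum_(j < N) gap_weight (2 * H - 2) (ndist i j)) + N%:R^-1.
  have -> : N%:R^-1 = \sum_(i < N) \sum_(j < N) (N%:R ^+ 3)^-1 :> R.
    rewrite sumr_const card_ord sumr_const card_ord -mulrnA -[RHS]mulr_natr natrM.
    by field; rewrite gt_eqF.
  rewrite !mulr_sumr -!big_split/=; apply: eq_bigr => i _.
  rewrite !mulr_sumr -!big_split/=; apply: eq_bigr => j _.
  by field; rewrite gt_eqF.
have NN : n * N%:R = N%:R `^ (1 - 2 * H) :> R.
  by rewrite /n -{2}[N%:R]powRr1 ?ler0n// -powRD ?(gt_eqF N0') ?implybT//; congr (_ `^ _); ring.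
rewrite lerD2r.
set x := N%:R `^ (1 - 2 * H) in NN *; set y := L%:R `^ (2 * H - 2).
have x0 : 0 <= x by exact: powR_ge0.
have y0 : 0 <= y by exact: powR_ge0.
have L1 : 1 <= L.+1%:R :> R by rewrite ler1n.
apply: (@le_trans _ _ (24 * A1 * n * (2 * N%:R * L.+1%:R) + 24 * A2 * y * k1 + 32 * A3 * n * (2 * N%:R * 4))).
  apply: lerD; first apply: lerD.
  - by rewrite ler_wpM2l// !mulr_ge0 //.
  - by rewrite ler_wpM2l// !mulr_ge0 //.
  - by rewrite ler_wpM2l// !mulr_ge0 //.
have -> : 24 * A1 * n * (2 * N%:R * L.+1%:R) + 24 * A2 * y * k1 + 32 * A3 * n * (2 * N%:R * 4) =
  48 * A1 * (L.+1%:R * x) + 24 * A2 * k1 * y + 256 * A3 * x by rewrite -NN; ring.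
have xl : x <= L.+1%:R * x by rewrite ler_peMl.
have Lx0 : 0 <= L.+1%:R * x by rewrite mulr_ge0.
have p1 : 0 <= A1 * y by rewrite mulr_ge0 //.
have p2 : 0 <= A2 * k1 * (L.+1%:R * x) by rewrite !mulr_ge0 //.
have p3 : 0 <= A3 * y by rewrite mulr_ge0 //.
have p4 : A3 * x <= A3 * (L.+1%:R * x) by rewrite ler_wpM2l //.
rewrite -subr_ge0 in p4; rewrite -subr_ge0; move: (L.+1%:R * x) Lx0 p2 p4 => X Lx0 p2 p4.
have -> : (48 * A1 + 24 * A2 * k1 + 256 * A3) * (X + y) - (48 * A1 * X + 24 * A2 * k1 * y + 256 * A3 * x) =
  48 * (A1 * y) + 24 * (A2 * k1 * X) + 256 * (A3 * y) + 256 * (A3 * X - A3 * x) by ring.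
by apply: addr_ge0; [apply: addr_ge0; [apply: addr_ge0|]|]; exact: mulr_ge0.
Qed.

End stat_bound.

(** * Convergence of the statistic and singularity *)

Lemma powR_small (R : realType) (p e : R) : p < 0 -> 0 < e ->
  exists n, forall N, (n <= N)%N -> (0 < N)%N -> (N%:R : R) `^ p <= e.
Proof.
move=> p0 e0; pose x := e `^ p^-1; have x0 : 0 < x by exact: powR_gt0.
exists (Num.truncn x).+1 => N nN N0.
have xp : x `^ p = e by rewrite /x -powRrM mulVf ?lt_eqF// powRr1// ltW.
rewrite -xp; apply: powR_anti => //; first exact: ltW.
by apply: ltW; apply: lt_le_trans (truncnS_gt x) _; rewrite ler_nat.
Qed.

Lemma amgm2 (R : realType) (x y e : R) : 0 < e -> 2 * x * y <= e * x ^+ 2 + y ^+ 2 / e.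
Proof.
move=> e0; rewrite -subr_ge0 (_ : _ - _ = (e * x - y) ^+ 2 / e); last by field; rewrite gt_eqF.
by rewrite divr_ge0 ?sqr_ge0// ltW.
Qed.

Section probability_bound.
Context d (T : measurableType d) (R : realType) (P : probability T R).
Local Open Scope ereal_scope.

Lemma probability_le_integral (A : set T) (h : T -> R) : measurable A -> measurable_fun setT h ->
  (forall w, 0 <= h w)%R -> (forall w, A w -> 1 <= h w)%R -> P A <= \int[P]_w (h w)%:E.
Proof.
move=> mA mh h0 h1; rewrite -[P A]/(P A) -(setIT A) -integral_indic//.
apply: ge0_le_integral => //.
- by apply/measurable_EFinP; exact: measurable_indic.
- exact/measurable_EFinP.
move=> w _; rewrite lee_fin indicE; case: (boolP (w \in A)) => [/set_mem /h1//|_].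
exact: h0.
Qed.

End probability_bound.

Section observable.
Context (R : realType) (H : R).
Notation C := (rosenblatt_constant H).

(** This is [form_stat] with [C * Q i] replaced by the increment of the path [y]; [v i] stands for
    the expectation of the square of that quantity and cancels when two paths are compared. *)
Definition obs_stat (N : nat) (v : nat -> R) (y : I01 R -> R) : R :=
  \sum_(i < N) (stat_coef H N / C ^+ 2 * ((y (grid_node R N i.+1) - y (grid_node R N i)) ^+ 2 - v i) -
    4 / C * (y (grid_node R N i.+1) - y (grid_node R N i))).

(** The drift adds the same amount [l / N] to every increment, so the cross terms telescope and only
    the total increment of [y] remains. *)
Lemma obs_stat_drift N v (y : I01 R -> R) (l : R) : (0 < N)%N ->
  obs_stat N v (fun t => l * \val t + y t) - obs_stat N v y =
  2 * l * (stat_coef H N / C ^+ 2 / N%:R) * (y (grid_node R N N) - y (grid_node R N 0)) +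
  l ^+ 2 * (stat_coef H N / C ^+ 2 / N%:R) - 4 / C * l.
Proof.
move=> N0; have Nn : N%:R != 0 :> R by rewrite pnatr_eq0 -lt0n.
rewrite /obs_stat -sumrB.
pose z i := y (grid_node R N i); pose be := stat_coef H N / C ^+ 2.
transitivity (\sum_(i < N) (2 * l * (be / N%:R) * (z i.+1 - z i) + (l ^+ 2 * (be / N%:R ^+ 2) - 4 / C * l / N%:R))).
  apply: eq_bigr => i _; rewrite -/be -/(z i.+1) -/(z i).
  rewrite !grid_nodeE//; last exact: ltnW.
  rewrite -[i.+1%:R]natr1; move: (4 / C) => k; by field.
rewrite big_split/= -mulr_sumr.
have -> : \sum_(i < N) (z i.+1 - z i) = z N - z 0%N.
  by rewrite -(big_mkord xpredT (fun i => z i.+1 - z i)) telescope_sumr.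
rewrite sumr_const card_ord -[X in _ + X = _]mulr_natr -/be -/(z N) -/(z 0%N).
by move: (4 / C) be => k be; field.
Qed.

End observable.

Section statistic_limit.
Context d (T : measurableType d) (R : realType) (P : probability T R).
Variables (W : I01 R -> T -> R).
Hypothesis wW : standard_wiener_process P W.
Variables (H : R) (H12 : 2^-1 < H < 1).
Notation C := (rosenblatt_constant H).
Variable Y : I01 R -> T -> R.
Hypothesis YI : forall t, is_double_integral P W (rosenblatt_kernel H (\val t)) (Y t).

Lemma rosenblatt_constant_gt0 : 0 < C.
Proof.
have /andP[h1 h2] := H12.
rewrite /rosenblatt_constant divr_gt0//; last first.
  by rewrite Beta_beta_real mulr_gt0//; apply: lt_le_trans (beta_real_ge1 H12).
by rewrite sqrtr_gt0 mulr_gt0 ?mulr_gt0//; lra.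
Qed.

Let C0 := rosenblatt_constant_gt0.

Let mY t : measurable_fun setT (Y t). Proof. by have [] := YI t. Qed.

Lemma measurable_obs_stat N v : measurable_fun setT (fun w => obs_stat H N v (Y^~ w)).
Proof.
apply: measurable_sum => i; have mD := measurable_funB (mY (grid_node R N i.+1)) (mY (grid_node R N i)).
apply: measurable_funB; apply: measurable_funM => //.
by apply: measurable_funB => //; exact: measurable_funX.
Qed.

(** The parameters are chosen in the order [L], [N], mesh. Only an L2 bound is available for the
    distance from [Y] to the grid forms, so the deviation is estimated by a quadratic majorant and
    Markov's inequality. *)
Lemma obs_stat_small (a e : R) (n0 : nat) : 0 < a -> 0 < e ->
  exists N (v : nat -> R), [/\ (n0 <= N)%N, (0 < N)%N &
    (P [set w | (a <= `|obs_stat H N v (Y^~ w)|)%R] <= e%:E)%E].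
Proof.
move=> a0 e0; have /andP[h1 h2] := H12.
have [A A0 SA] := stat_second_moment_le H12.
(* The second moment of [F] will be at most [3 tau], and [4 / a^2 * (3 tau) = e / 3]. *)
pose tau := e * a ^+ 2 / 36; have tau0 : 0 < tau by rewrite divr_gt0 ?mulr_gt0 ?exprn_gt0.
have q1 : 2 * H - 2 < 0 by lra.
have q2 : 1 - 2 * H < 0 by lra.
have [L1 hL1] := powR_small q1 (divr_gt0 tau0 A0).
pose L := L1.+1; have hL : A * L%:R `^ (2 * H - 2) <= tau by rewrite mulrC -ler_pdivlMr// hL1.
have L0 : 0 < L.+1%:R :> R by rewrite ltr0n.
have [N1 hN1] := powR_small q2 (divr_gt0 tau0 (mulr_gt0 A0 L0)).
have [N2 hN2] := powR_small (ltrN10 R) tau0.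
have [N [n0N N1N N2N N0]] : exists N, [/\ (n0 <= N)%N, (N1 <= N)%N, (N2 <= N)%N & (0 < N)%N].
  exists (n0 + N1 + N2).+1; split => //; apply: leqW.
  - by rewrite -addnA leq_addr.
  - by rewrite -addnA addnCA leq_addr.
  - exact: leq_addl.
have N0' : 0 < N%:R :> R by rewrite ltr0n.
have hN : A * (L.+1%:R * N%:R `^ (1 - 2 * H)) <= tau.
  by rewrite mulrA mulrC -ler_pdivlMr ?mulr_gt0// hN1.
have hN' : N%:R^-1 <= tau.
  by rewrite -powR_inv1 ?ler0n//; exact: hN2.
pose b := stat_coef H N; have b0 : 0 < b by exact: stat_coef_gt0.
(* [Vb] bounds [form_V] of a block with itself and [Kb] the expectation of the sum of [b Q^2 + 2].
   Then [et] gives [2 / a * et * Kb = e / 3], [al] is the resulting coefficient of the squared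
   error, and [dl] gives [N * ga * 4 dl = e / 3]. *)
have [Vb VbE] : exists Vb, Vb = 2 * beta_real H ^+ 2 / (2 * H - 1) * N%:R `^ (- (2 * H)) by eexists.
have Vb0 : 0 <= Vb.
  have B0 : 0 <= beta_real H by exact: le_trans (beta_real_ge1 H12).
  have HH : 0 <= 2 * H - 1 by lra.
  by rewrite VbE mulr_ge0 ?powR_ge0// divr_ge0// mulr_ge0// exprn_ge0.
have [Kb KbE] : exists x, x = N%:R * (b * (2 * Vb) + 2) by eexists.
have Kb0 : 0 < Kb.
  by rewrite KbE mulr_gt0//; apply: ltr_wpDl => //; apply: mulr_ge0; [exact: ltW|exact: mulr_ge0].
have [et etE] : exists x, x = e * a / 6 / Kb by eexists.
have et0 : 0 < et by rewrite etE; do 2 apply: divr_gt0 => //; exact: mulr_gt0.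
have [al alE] : exists x, x = b + b / et + 2 / et by eexists.
have al0 : 0 < al.
  by rewrite alE; apply: addr_gt0; [apply: addr_gt0 => //|]; exact: divr_gt0.
have [ga gaE] : exists x, x = 2 / a * al / C ^+ 2 by eexists.
have ga0 : 0 < ga.
  by rewrite gaE; apply: divr_gt0; [apply: mulr_gt0 => //; exact: divr_gt0|exact: exprn_gt0].
have [dl dlE] : exists x, x = e / 12 / (N%:R * ga) by eexists.
have dl0 : 0 < dl.
  by rewrite dlE; apply: divr_gt0; [exact: divr_gt0|exact: mulr_gt0].
pose M m := (N * m.+1)%N.
pose Q0 m i := grid_form W H (M m) (index_iota 0 (i * m.+1)).
have a0p := ltW a0; have b0p := ltW b0; have et0p := ltW et0; have al0p := ltW al0.
have ga0p := ltW ga0; have dl0p := ltW dl0; have e0p := ltW e0; have Kb0p := ltW Kb0.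
have QL2 : \forall m \near \oo, forall i : 'I_N.+1,
    (\int[P]_w ((Y (grid_node R N i) w - C * Q0 m i w) ^+ 2)%:E <= dl%:E)%E.
  apply: filter_forall => i.
  have M0 m : (0 < M m)%N by rewrite muln_gt0 N0.
  have bM m : (i * m.+1 <= M m)%N by rewrite leq_mul2r -ltnS ltn_ord orbT.
  have bt m : (i * m.+1)%:R / (M m)%:R = \val (grid_node R N i) :> R.
    by rewrite grid_nodeE// ?block_ratio// -ltnS.
  have mesh : (M m)%:R^-1 @[m --> \oo] --> (0 : R) by exact: grid_mesh_cvg.
  have L2 := grid_form_L2 wW H12 M0 mesh bM bt (YI (grid_node R N i)).
  by move/cvge0P : L2; apply => // m; apply: integral_ge0 => w _; rewrite lee_fin sqr_ge0.
have [m [QLm Sm]] : exists m, (forall i : 'I_N.+1,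
    (\int[P]_w ((Y (grid_node R N i) w - C * Q0 m i w) ^+ 2)%:E <= dl%:E)%E) /\
    forall L, (0 < L)%N -> stat_second_moment H N m <=
      A * (L.+1%:R * N%:R `^ (1 - 2 * H) + L%:R `^ (2 * H - 2)) + N%:R^-1.
  by have [m _ hm] := filterI QL2 (SA N N0); exists m; exact: (hm m (leqnn m)).
pose r i := block m.+1 i.
pose Q i := grid_form W H (M m) (r i).
pose v i := C ^+ 2 * (2 * form_V H (M m) (r i) (r i)).
exists N, v; split => //.
pose F w := form_stat W H (M m) N r b w.
pose E i w := Y (grid_node R N i) w - C * Q0 m i w.
pose D i w := E i.+1 w - E i w.
have QE i w : Q i w = Q0 m i.+1 w - Q0 m i w.
  rewrite /Q0 /grid_form (@big_cat_nat _ _ _ (i * m.+1) 0 (i.+1 * m.+1))//=; last by rewrite leq_mul2r leqnSn orbT.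
  by rewrite [RHS]addrAC subrr add0r.
(* A deviation of size [a] forces [|F| >= a/2] or [G >= a/2], with [G] the error bound below, hence
   [4 F^2 / a^2 + 2 G / a >= 1]. This majorant is split into [R1], a polynomial in the increments of
   [W], and [R2], the squared approximation errors. *)
pose R1 w := 4 / a ^+ 2 * F w ^+ 2 + 2 / a * et * \sum_(i < N) (b * Q i w ^+ 2 + 2).
pose R2 w := \sum_(i < N) ga * D i w ^+ 2.
have fQ i : finite_moments P (Q i) by exact: finite_moments_grid_form.
have fF : finite_moments P F.
  apply: finite_moments_sum => i; apply: finite_momentsB; last exact: (finite_momentsZ 4 (fQ i)).
  by apply: finite_momentsZ; apply: finite_momentsB; [exact: (finite_momentsX 2 (fQ i))|exact: finite_moments_cst].
have fQ2 i : finite_moments P (fun w => b * Q i w ^+ 2 + 2).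
  by apply: finite_momentsD; [exact: (finite_momentsZ b (finite_momentsX 2 (fQ i)))|exact: finite_moments_cst].
have fR11 : finite_moments P (fun w => 4 / a ^+ 2 * F w ^+ 2).
  by apply: finite_momentsZ; exact: finite_momentsX.
have fR12 : finite_moments P (fun w => 2 / a * et * \sum_(i < N) (b * Q i w ^+ 2 + 2)).
  by apply: finite_momentsZ; exact: finite_moments_sum.
have fR1 : finite_moments P R1 by exact: finite_momentsD.
have M0 : (0 < M m)%N by rewrite muln_gt0 N0.
have R1le : Ex P R1 <= e / 3 + e / 3.
  rewrite /R1 ExD// ExZ; last exact: finite_momentsX.
  rewrite ExZ; last exact: finite_moments_sum.
  rewrite Ex_sum//; apply: lerD.
    have -> : Ex P (fun w => F w ^+ 2) = stat_second_moment H N m by rewrite /F Ex_form_stat_sqr.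
    apply: (@le_trans _ _ (4 / a ^+ 2 * (3 * tau))).
      rewrite ler_wpM2l ?divr_ge0 ?exprn_ge0  //; apply: le_trans (Sm L isT) _.
      by rewrite mulrDr; lra.
    by rewrite /tau le_eqVlt; apply/orP; left; apply/eqP; field; rewrite gt_eqF.
  apply: (@le_trans _ _ (2 / a * et * Kb)); last first.
    by rewrite etE le_eqVlt; apply/orP; left; apply/eqP; field; rewrite !gt_eqF.
  rewrite ler_wpM2l ?mulr_ge0 ?invr_ge0  //.
  apply: (@le_trans _ _ (\sum_(i < N) (b * (2 * Vb) + 2))); last first.
    by rewrite sumr_const card_ord -[leLHS]mulr_natl KbE.
  apply: ler_sum => i _.
  rewrite ExD; [|exact: (finite_momentsZ b (finite_momentsX 2 (fQ i)))|exact: finite_moments_cst].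
  rewrite Ex_cst ExZ; last exact: (finite_momentsX 2 (fQ i)).
  rewrite lerD2r ler_wpM2l  // (@eq_Ex _ _ _ P _ (fun w => Q i w * Q i w)); last by move=> w; rewrite expr2.
  rewrite Ex_form2// ler_pM2l// VbE; exact: form_V_le.
have mQ0 i : measurable_fun setT (Q0 m i).
  by have [] : finite_moments P (Q0 m i) by exact: finite_moments_grid_form.
have mE i : measurable_fun setT (E i) by apply: measurable_funB => //; exact: measurable_funM.
have mDD i : measurable_fun setT (D i) by exact: measurable_funB.
have mR2 : measurable_fun setT R2.
  by apply: measurable_sum => i; apply: measurable_funM => //; exact: measurable_funX.
have R2le : (\int[P]_w (R2 w)%:E <= (e / 3)%:E)%E.
  rewrite (_ : (fun w => (R2 w)%:E) = (fun w => \sum_(i < N) (ga%:E * (D i w ^+ 2)%:E))%E); last first.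
    by apply/funext => w; rewrite /R2 -sumEFin.
  have mD2 i : measurable_fun setT (fun w => (D i w ^+ 2)%:E).
    by apply/measurable_EFinP; exact: measurable_funX.
  rewrite ge0_integral_sum//; last 2 first.
  - by move=> i; apply: emeasurable_funM.
  - by move=> i w _; rewrite mule_ge0 ?lee_fin ?sqr_ge0.
  apply: (@le_trans _ _ (\sum_(i < N) (ga * (4 * dl))%:E)%E).
    apply: lee_sum => i _; rewrite ge0_integralZl//; try (by move=> w _; rewrite lee_fin sqr_ge0); try by rewrite lee_fin.
    rewrite EFinM lee_wpmul2l ?lee_fin ?(ltW ga0)//.
    rewrite (_ : 4 * dl = 2 * (dl + dl)); last by ring.
    apply: integral_sqrD_le_fin => //.
    - by apply: measurableT_comp => //.
    - exact: (QLm (lift ord0 i)).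
    - under eq_integral do rewrite sqrrN.
      exact: (QLm (widen_ord (leqnSn N) i)).
  rewrite sumEFin lee_fin sumr_const card_ord -[leLHS]mulr_natr.
  by rewrite dlE le_eqVlt; apply/orP; left; apply/eqP; field; rewrite !gt_eqF.
have c1 : 0 <= 4 / a ^+ 2 by rewrite divr_ge0// exprn_ge0.
have c2 : 0 <= 2 / a by rewrite divr_ge0.
have R10 w : 0 <= R1 w.
  apply: addr_ge0; first by apply: mulr_ge0 => //; exact: sqr_ge0.
  apply: mulr_ge0; first exact: mulr_ge0.
  by apply: sumr_ge0 => i _; apply: addr_ge0 => //; apply: mulr_ge0 => //; exact: sqr_ge0.
have R20 w : 0 <= R2 w.
  by apply: sumr_ge0 => i _; apply: mulr_ge0 => //; exact: sqr_ge0.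
have mObs := measurable_obs_stat N v.
have mR1 : measurable_fun setT R1 by have [] := fR1.
apply: (@le_trans _ _ (\int[P]_w (R1 w + R2 w)%:E)%E); last first.
  under eq_integral do rewrite EFinD.
  rewrite ge0_integralD//; last 4 first.
  - by move=> w _; rewrite lee_fin.
  - exact/measurable_EFinP.
  - by move=> w _; rewrite lee_fin.
  - exact/measurable_EFinP.
  rewrite ExE//; apply: (@le_trans _ _ ((e / 3 + e / 3)%:E + (e / 3)%:E)%E).
    by apply: leeD => //; rewrite lee_fin.
  by rewrite -EFinD lee_fin; lra.
apply: probability_le_integral.
- have := measurableT_comp (@normr_measurable R setT) mObs => mN.
  have := mN measurableT _ (measurable_itv `[a, +oo[); rewrite setTI; congr measurable.
  by apply/seteqP; split => w /=; rewrite in_itv/= andbT.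
- exact: measurable_funD.
- by move=> w; apply: addr_ge0.
move=> w /= aT.
pose G := \sum_(i < N) (al * (D i w / C) ^+ 2 + et * (b * Q i w ^+ 2 + 2)).
have dif : `|obs_stat H N v (Y^~ w) - F w| <= G.
  rewrite /obs_stat /F /form_stat -sumrB; apply: le_trans (ler_norm_sum _ _ _) _.
  apply: ler_sum => i _; rewrite -/(Q i) -/b.
  have zE : Y (grid_node R N i.+1) w - Y (grid_node R N i) w = C * (Q i w + D i w / C).
    by rewrite QE /D /E; field; rewrite gt_eqF.
  rewrite zE /v; set q := Q i w; set x := D i w / C.
  (* The observed increment is [C (q + x)], and the difference of the summands is
     [b x^2 + 2 b q x - 4 x]. Young's inequality with parameter [et] trades the last two terms for a
     small multiple of [b q^2 + 2] and a large one of [x^2]. *)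
  have -> : b / C ^+ 2 * ((C * (q + x)) ^+ 2 - C ^+ 2 * (2 * form_V H (M m) (r i) (r i))) -
      4 / C * (C * (q + x)) - (b * (q ^+ 2 - 2 * form_V H (M m) (r i) (r i)) - 4 * q) =
      b * x ^+ 2 + b * (2 * q * x) - 2 * (2 * 1 * x) by field; rewrite gt_eqF.
  have u1 := amgm2 q x et0; have u2 := amgm2 q (- x) et0.
  have u3 := amgm2 1 x et0; have u4 := amgm2 1 (- x) et0.
  rewrite sqrrN !mulrN in u2; rewrite sqrrN !mulrN in u4.
  have b1 : b * (2 * q * x) <= b * (et * q ^+ 2 + x ^+ 2 / et) by rewrite ler_wpM2l// ltW.
  have b2 : - (b * (2 * q * x)) <= b * (et * q ^+ 2 + x ^+ 2 / et) by rewrite -mulrN ler_wpM2l// ltW.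
  have x20 : 0 <= b * x ^+ 2 by rewrite mulr_ge0 ?sqr_ge0.
  have -> : al * x ^+ 2 + et * (b * q ^+ 2 + 2) =
    b * x ^+ 2 + b * (et * q ^+ 2 + x ^+ 2 / et) + 2 * (et * 1 ^+ 2 + x ^+ 2 / et).
    by rewrite alE; field; rewrite gt_eqF.
  move: u3 u4 b1 b2 x20; move: (b * (2 * q * x)) (b * (_ + _)) (b * x ^+ 2) (2 * 1 * x) (et * 1 ^+ 2 + _).
  by move=> *; rewrite ler_norml; lra.
have R2G : R1 w + R2 w = 4 / a ^+ 2 * F w ^+ 2 + 2 / a * G.
  rewrite /R1 /R2 -addrA; congr (_ + _); rewrite /G !mulr_sumr -big_split/=; apply: eq_bigr => i _.
  by rewrite gaE; field; rewrite !gt_eqF.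
rewrite R2G.
have G0 : 0 <= G by exact: le_trans (normr_ge0 _) dif.
have [Fa|Fa] := leP (a / 2) `|F w|.
  apply: (@le_trans _ _ (4 / a ^+ 2 * F w ^+ 2)); last by rewrite lerDl mulr_ge0.
  rewrite -[F w ^+ 2]real_normK ?num_real//.
  apply: (@le_trans _ _ (4 / a ^+ 2 * (a / 2) ^+ 2)).
    by rewrite le_eqVlt; apply/orP; left; apply/eqP; field; rewrite gt_eqF.
  by rewrite ler_wpM2l// lerXn2r ?nnegrE ?divr_ge0.
apply: (@le_trans _ _ (2 / a * G)); last by rewrite lerDr mulr_ge0// sqr_ge0.
have aG : a / 2 <= G.
  have := ler_normD (obs_stat H N v (Y^~ w) - F w) (F w); rewrite subrK; lra.
apply: (@le_trans _ _ (2 / a * (a / 2))).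
  by rewrite le_eqVlt; apply/orP; left; apply/eqP; field; rewrite gt_eqF.
by rewrite ler_wpM2l.
Qed.

End statistic_limit.

Section evaluation.
Context (R : realType).

Lemma open_C01_eval (t : I01 R) (U : set R) : open U -> open [set f : C01 R | U (C01_eval f t)].
Proof.
move=> oU; pose V : set {uniform I01 R -> R} := [set h | U (h t)].
exists V; last by [].
rewrite openE => h Vh; apply/uniform_nbhs.
have : nbhs (h t) U by apply: open_nbhs_nbhs.
rewrite -nbhs_ballE => -[e /= e0 eU].
exists [set xy : R * R | ball xy.1 e xy.2]; split.
  by rewrite -entourage_ballE; exists e.
by move=> g hg; apply: eU; exact: hg.
Qed.

Lemma measurable_C01_eval (t : I01 R) : measurable_fun setT (fun f : C01_borel R => C01_eval f t).
Proof.
apply: (measurability (@RGenOpens.G R)); first exact: RGenOpens.measurableE.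
move=> _ [_ [x [y ->]] <-]; rewrite setTI; apply: sub_sigma_algebra.
by apply: open_C01_eval; exact: interval_open.
Qed.

End evaluation.

(** The separating set consists of the paths with [|S n| >= a] for infinitely many [n]. It is null
    for [Z]; and on no sample can both paths stay outside it, since [S n (X w) - S n (Z w)] tends to
    [- k] while [2 a < |k|]. *)
Theorem mainTheorem7 (R : realType) (d : measure_display)
    (Omega : measurableType d) (P : probability Omega R)
    (W : I01 R -> Omega -> R) (H lambda : R) (Z X : {RV P >-> C01_borel R}) :
  measure_is_complete P ->
  standard_wiener_process P W ->
  generated_by P W ->
  2^-1 < H < 1 ->
  rosenblatt_process W H Z ->
  lambda != 0 ->
  (forall w t, C01_eval (X w) t = lambda * \val t + C01_eval (Z w) t) ->
  mutually_singular (distribution P Z) (distribution P X).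
Proof.
move=> _ wW _ H12 ZI l0 XZ.
have [h1 h2] := andP H12.
pose Y (t : I01 R) w := C01_eval (Z w) t.
have C0 := rosenblatt_constant_gt0 H12; set C := rosenblatt_constant H in C0.
pose k := 4 / C * lambda.
have k0 : 0 < `|k| by rewrite normr_gt0 mulf_neq0// mulf_neq0 ?invr_eq0 ?gt_eqF.
(* A third of [|k|] leaves room for the vanishing drift terms: [2 a + a / 2 < |k|]. *)
pose a := `|k| / 3; have a0 : 0 < a by rewrite divr_gt0.
have e0 n : 0 < 1 / (2 ^ n.+1)%:R :> R by rewrite divr_gt0// ltr0n expn_gt0.
have step n : exists Nv : nat * (nat -> R), [/\ (n <= Nv.1)%N, (0 < Nv.1)%N &
    (P [set w | (a <= `|obs_stat H Nv.1 Nv.2 (Y^~ w)|)%R] <= (1 / (2 ^ n.+1)%:R)%:E)%E].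
  by have [N [v hNv]] := obs_stat_small wW H12 ZI n a0 (e0 n); exists (N, v).
have [Nv hNv] := choice step.
pose S n (f : C01_borel R) := obs_stat H (Nv n).1 (Nv n).2 (C01_eval f).
have mS n : measurable_fun setT (S n).
  apply: measurable_sum => i.
  have mD := measurable_funB (@measurable_C01_eval R (grid_node R (Nv n).1 i.+1)) (@measurable_C01_eval R (grid_node R (Nv n).1 i)).
  apply: measurable_funB; apply: measurable_funM => //.
  by apply: measurable_funB => //; exact: measurable_funX.
pose E n : set (C01_borel R) := [set f | (a <= `|S n f|)%R].
have mE n : measurable (E n).
  have mN := measurableT_comp (@normr_measurable R setT) (mS n).
  have := mN measurableT _ (measurable_itv `[a, +oo[); rewrite setTI; congr measurable.
  by apply/seteqP; split => f /=; rewrite in_itv/= andbT.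
have mZ n : measurable (Z @^-1` E n).
  by rewrite -[_ @^-1` _]setTI; exact: measurable_funPT.
have mA : measurable (lim_sup_set E).
  by apply: bigcap_measurable => // n _; apply: bigcup_measurable => j _.
have ZA : P (Z @^-1` lim_sup_set E) = 0%E.
  rewrite (_ : Z @^-1` lim_sup_set E = lim_sup_set (fun n => Z @^-1` E n)); last first.
    by rewrite /lim_sup_set preimage_bigcap; apply: eq_bigcapr => n _; rewrite preimage_bigcup.
  apply: lim_sup_set_cvg0 => //.
  apply: (@le_lt_trans _ _ (\sum_(n <oo) (1 / (2 ^ n.+1)%:R)%:E)%E).
    by apply: lee_nneseries => // n _; have [_ _] := hNv n.
  by apply: (le_lt_trans (epsilon_trick0 xpredT ler01)); exact: ltry.
exists (lim_sup_set E); split => //.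
(* If [X] lies outside the set then [Z] lies inside it, so the probability of the former is at most
   that of the latter, which is 0. *)
apply/eqP; rewrite eq_le measure_ge0 andbT; rewrite /distribution /pushforward /= -ZA.
apply: le_measure; rewrite ?inE.
- by rewrite -[_ @^-1` _]setTI; apply: measurable_funPT => //; exact: measurableC.
- by rewrite -[_ @^-1` _]setTI; exact: measurable_funPT.
move=> w /= XE; apply: contrapT => ZE.
have ev (V : {RV P >-> C01_borel R}) : ~ lim_sup_set E (V w) ->
    exists n, forall j, (n <= j)%N -> `|S j (V w)| < a.
  move=> nE; apply: contrapT => nex; apply: nE => n _; apply: contrapT => nj; apply: nex.
  exists n => j nj'; rewrite ltNge; apply/negP => aS; apply: nj; exists j => //.
have [n1 hX] := ev X XE; have [n2 hZ] := ev Z ZE.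
pose be n := stat_coef H (Nv n).1 / C ^+ 2 / (Nv n).1%:R.
have N0 n : (0 < (Nv n).1)%N by have [] := hNv n.
have drift n : S n (X w) - S n (Z w) =
    2 * lambda * be n * (Y (grid_node R 1 1) w - Y (grid_node R 1 0) w) + lambda ^+ 2 * be n - k.
  rewrite /S (_ : C01_eval (X w) = fun t => lambda * \val t + C01_eval (Z w) t); last first.
    by apply/funext => t; rewrite XZ.
  rewrite obs_stat_drift// -/C -/(be n) -/k.
  have -> : grid_node R (Nv n).1 (Nv n).1 = grid_node R 1 1.
    by apply: val_inj; rewrite !grid_nodeE// !divff// gt_eqF// ltr0n.
  have -> : grid_node R (Nv n).1 0 = grid_node R 1 0.
    by apply: val_inj; rewrite !grid_nodeE// !mul0r.
  by [].
(* [D] depends on the sample but not on [n], so [be n * D] tends to 0 for each fixed [w], at the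
   rate [N^(H-1)]. *)
pose D := 2 * lambda * (Y (grid_node R 1 1) w - Y (grid_node R 1 0) w) + lambda ^+ 2.
have driftD n : S n (X w) - S n (Z w) = be n * D - k by rewrite drift /D; ring.
pose kp := H * (H + 1) / (2 * beta_real H).
have kp0 : 0 < kp.
  by rewrite divr_gt0 ?mulr_gt0//; [lra|lra|exact: lt_le_trans (beta_real_ge1 H12)].
have beE n : be n = kp / C ^+ 2 * (Nv n).1%:R `^ (H - 1).
  rewrite /be stat_coefE// -/kp.
  have -> : (Nv n).1%:R `^ (H - 1) = (Nv n).1%:R `^ H / (Nv n).1%:R :> R.
    rewrite powRD; last by rewrite (_ : (Nv n).1%:R != 0) ?implybT// pnatr_eq0 -lt0n.
    by rewrite powR_inv1.
  by rewrite !mulrA; congr (_ / _); rewrite mulrAC.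
have kC : 0 < kp / C ^+ 2 by apply: divr_gt0 => //; exact: exprn_gt0.
have D1 : 0 < `|D| + 1 by rewrite ltr_wpDl.
have q0 : H - 1 < 0 by lra.
have ea : 0 < a / 2 / (kp / C ^+ 2 * (`|D| + 1)) by apply: divr_gt0; [exact: divr_gt0|exact: mulr_gt0].
have [n3 hn3] := powR_small q0 ea.
(* Past all three thresholds at once; [n <= (Nv n).1] transfers the third one to the number of
   blocks. *)
pose n := (n1 + n2 + n3)%N.
have X1 : `|S n (X w)| < a by apply: hX; rewrite /n -addnA leq_addr.
have Z1 : `|S n (Z w)| < a by apply: hZ; rewrite /n -addnA addnCA leq_addr.
have nN : (n3 <= (Nv n).1)%N by have [h _ _] := hNv n; apply: leq_trans h; exact: leq_addl.
have b1 : `|be n * D| <= a / 2.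
  have bn0 : 0 <= be n by rewrite beE mulr_ge0 ?powR_ge0// ltW.
  rewrite normrM (ger0_norm bn0); apply: (@le_trans _ _ (be n * (`|D| + 1))).
    by rewrite ler_wpM2l// lerDl.
  rewrite beE mulrAC mulrC -ler_pdivlMr; [exact: hn3|exact: mulr_gt0].
have := driftD n; move: X1 Z1 b1; rewrite !ltr_norml ler_norml.
have -> : a = `|k| / 3 by [].
by case: (ger0P k) k0 => kk k0 *; lra.
Qed.
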